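(* For every $\hbar\in H$, the product $\star_\hbar$ on $\mathcal{P}(D_n)$ extends continuously to $\mathcal{A}(D_n)$, making $(\mathcal{A}(D_n),\star_\hbar)$ a Fréchet algebra. For all $a,b\in\mathcal{A}(D_n)$ with Schauder expansions $a=\sum_{P,Q\in\mathbb{N}_0^n}a_{P,Q}f_{r,P,Q}$ and $b=\sum_{R,S\in\mathbb{N}_0^n}b_{R,S}f_{r,R,S}$, the extended product is given by $$a\star_\hbar b=\sum_{P,Q,R,S\in\mathbb{N}_0^n}a_{P,Q}\,b_{R,S}\,f_{r,P,Q}\star_\hbar f_{r,R,S},$$ where the series converges absolutely and locally uniformly in $\hbar\in H$ (i.e. for every compact $L\subseteq H$ and every continuous seminorm $p$ on $\mathcal{A}(D_n)$, $\sum_{P,Q,R,S}|a_{P,Q}b_{R,S}|\sup_{\hbar\in L}p(f_{r,P,Q}\star_\hbar f_{r,R,S})<\infty$). If moreover $\hbar$ is real, then $(\mathcal{A}(D_n),\star_\hbar)$ with pointwise complex conjugation as involution is a Fréchet $*$-algebra.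
   Context: Fix $n\ge1$; indices $\mu,\nu\in\{0,\dots,n\}$; $h_{\mu\nu}=\mathrm{diag}(-1,1,\dots,1)$. Multi-index conventions: $|P|=\sum P_i$, $P!=\prod P_i!$, $\binom{P}{T}=\prod\binom{P_i}{T_i}$, $\le$ and $\min$ componentwise, $P'=(P_1,\dots,P_n)$ for $P\in\mathbb{N}_0^{1+n}$. $D_n=Z/U(1)$ with $Z=\{r\in\mathbb{C}^{1+n}:-|r^0|^2+\sum_{i\ge1}|r^i|^2=-1\}$, identified with the open unit ball in $\mathbb{C}^n$ via $w^i=r^i/r^0$. $\hat D_n=\hat Z/\mathbb{C}^*$ with $\hat Z=\{(p,q): -p^0q^0+\sum_{i\ge1}p^iq^i=-1\}$ and $z\cdot(p,q)=(zp,q/z)$; $\Delta_D([r])=[r,\bar r]$. $\mathcal{A}(D_n)=\{\hat a\circ\Delta_D:\hat a\in\mathcal{O}(\hat D_n)\}$ (with $\hat a$ unique), a Fréchet space with seminorms $\|a\|_{D_n,K}=\sup_K|\hat a|$, $K\subseteq\hat D_n$ compact. For $P,Q\in\mathbb{N}_0^{1+n}$ with $|P|=|Q|$: $f_{P,Q}([r])=r^P\bar r^Q=w^{P'}\bar w^{Q'}/(1-w\cdot\bar w)^{|P|}$; $\mathcal{P}(D_n)=\mathrm{span}\{f_{P,Q}\}$. For $P,Q\in\mathbb{N}_0^n$: $f_{r,P,Q}=w^P\bar w^Q/(1-w\cdot\bar w)^{\max\{|P|,|Q|\}}$. The $f_{r,P,Q}$ form a basis of $\mathcal{P}(D_n)$,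 and (a known fact) an absolute Schauder basis of $\mathcal{A}(D_n)$: each $a\in\mathcal{A}(D_n)$ has a unique absolutely convergent expansion $a=\sum a_{P,Q}f_{r,P,Q}$. $\mathcal{P}(D_n)$ is dense in $\mathcal{A}(D_n)$. Star product: $H=\mathbb{C}\setminus(\{0\}\cup\{-1/(2m):m\in\mathbb{N}\})$; Pochhammer symbol $(z)_m=\prod_{k=0}^{m-1}(z+k)$. Let $\mathcal{P}(\mathbb{C}^{1+n})$ be the polynomials in $z^\mu,\bar z^\mu$ with basis $d_{P,Q}=z^P\bar z^Q$, and $\mathcal{P}(\mathbb{C}^{1+n})^{U(1)}$ the span of $d_{P,Q}$ with $|P|=|Q|$. The Wick product is the bilinear product $d_{P,Q}\tilde\star_\hbar d_{R,S}=\sum_{T\le\min\{P,S\}}(-1)^{T_0}(2\hbar)^{|T|}T!\binom{P}{T}\binom{S}{T}d_{P+R-T,Q+S-T}$. For $\hbar\in H$ let $\Psi_\hbar:\mathcal{P}(\mathbb{C}^{1+n})^{U(1)}\to\mathcal{P}(D_n)$ be linear with $\Psi_\hbar(d_{P,Q})=(2\hbar)^{|P|}(\tfrac{1}{2\hbar})_{|P|}f_{P,Q}$; it is surjective and its kernel is a two-sided ideal for $\tilde\star_\hbar$, so $a\star_\hbar b:=\Psi_\hbar(a'\tilde\star_\hbar b')$ for any preimages $a',b'$ is a well-defined associative product on $\mathcal{P}(D_n)$; explicitly $f_{P,Q}\star_\hbar f_{R,S}=\sum_{T\in\mathbb{N}_0^{1+n},\,T\le\min\{P,S\}}(-1)^{T_0}\frac{(\frac1{2\hbar})_{|P+S-T|}T!}{(\frac1{2\hbar})_{|P|}(\frac1{2\hbar})_{|S|}}\binom{P}{T}\binom{S}{T}f_{P+R-T,Q+S-T}$.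 *)

(* Defs.v *)
From mathcomp Require Import all_boot all_order all_algebra.
From mathcomp Require Import all_classical all_reals all_analysis.
From mathcomp Require Import complex.
Import Order.TTheory GRing.Theory Num.Theory.
Import numFieldNormedType.Exports.

Set Implicit Arguments.
Unset Strict Implicit.
Unset Printing Implicit Defensive.

Local Open Scope ring_scope.
Local Open Scope complex_scope.
Local Open Scope classical_set_scope.

Section Defs.
Variable R : realType.
Local Notation C := (R[i]).

Definition Cvec (k : nat) : normedModType C := 'rV[C]_k.
Definition Cpair (k : nat) : normedModType C := ('rV[C]_k * 'rV[C]_k)%type.

Definition cmod (z : C) : R := complex.Re `|z|.

Definition hform (n : nat) (p q : 'rV[C]_n.+1) : C :=
  \sum_(i < n.+1) (if i == ord0 then -1 else 1) * p ord0 i * q ord0 i.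

Definition Zhat (n : nat) : set (Cpair n.+1) :=
  [set z | hform z.1 z.2 = -1].

Definition wnorm2 (n : nat) (w : 'rV[C]_n) : C := \sum_(i < n) w ord0 i * (w ord0 i)^*.

(* D_n identified with the open unit ball of C^n (coordinates w^i = r^i / r^0) *)
Definition ball_n (n : nat) : set 'rV[C]_n := [set w | wnorm2 w < 1].

(* Delta_D([r]) = [r, \bar r].  With r = (1,w)/sqrt(1 - w.\bar w), the class
   [r, \bar r] is represented (after the C^* action z = sqrt(1 - w.\bar w)) by
   p = (1, w),  q = (1, \bar w) / (1 - w.\bar w). *)
Definition DeltaD (n : nat) (w : 'rV[C]_n) : Cpair n.+1 :=
  (\row_(i < n.+1) (if unlift ord0 i is Some j then w ord0 j else 1),
   \row_(i < n.+1) ((if unlift ord0 i is Some j then (w ord0 j)^* else 1)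
                      / (1 - wnorm2 w))).

Definition holo_on (k : nat) (U : set (Cpair k)) (g : Cpair k -> C^o) : Prop :=
  forall y, U y -> differentiable g y.

Definition holo_on_Zhat (n : nat) (F : Cpair n.+1 -> C) : Prop :=
  forall z, @Zhat n z ->
    exists (U : set (Cpair n.+1)) (g : Cpair n.+1 -> C^o),
      [/\ open U, U z, holo_on U g & forall y, U y -> @Zhat n y -> F y = g y].

Definition Cstar_invariant (n : nat) (F : Cpair n.+1 -> C) : Prop :=
  forall z, @Zhat n z -> forall c : C, c != 0 ->
    F (c *: z.1, c^-1 *: z.2) = F z.

(* holomorphic functions on \hat D_n = \hat Z / C^*, as invariant holomorphic
   functions on \hat Z *)
Definition holo_Dhat (n : nat) (F : Cpair n.+1 -> C) : Prop :=
  holo_on_Zhat F /\ Cstar_invariant F.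

(* elements of A(D_n) are functions on D_n (given as functions on C^n of which
   only the values on the ball matter) *)
Definition is_hat (n : nat) (a : 'rV[C]_n -> C) (F : Cpair n.+1 -> C) : Prop :=
  holo_Dhat F /\ forall w, @ball_n n w -> a w = F (DeltaD w).

Definition inA (n : nat) (a : 'rV[C]_n -> C) : Prop := exists F, is_hat a F.

(* the (unique, by the identity theorem) holomorphic extension \hat a *)
Definition hat (n : nat) (a : 'rV[C]_n -> C) : Cpair n.+1 -> C :=
  xget (fun _ => 0) (is_hat a : set (Cpair n.+1 -> C)).

Definition eqD (n : nat) (a b : 'rV[C]_n -> C) : Prop :=
  forall w, @ball_n n w -> a w = b w.

(* compact subsets of \hat D_n, represented by compact subsets of \hat Z *)
Definition cpt (n : nat) (K : set (Cpair n.+1)) : Prop :=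
  compact K /\ K `<=` @Zhat n.

Definition snorm (n : nat) (K : set (Cpair n.+1)) (a : 'rV[C]_n -> C) : R :=
  sup [set cmod (hat a z) | z in K].

Definition fadd (n : nat) (a b : 'rV[C]_n -> C) := fun w => a w + b w.
Definition fscale (n : nat) (c : C) (a : 'rV[C]_n -> C) := fun w => c * a w.
Definition fconj (n : nat) (a : 'rV[C]_n -> C) := fun w => (a w)^*.

Definition midx (k : nat) := {ffun 'I_k -> nat}.
Definition msize (k : nat) (P : midx k) : nat := \sum_(i < k) P i.
Definition mtail (n : nat) (P : midx n.+1) : midx n := [ffun j => P (lift ord0 j)].

Definition wpow (n : nat) (w : 'rV[C]_n) (P Q : midx n) : C :=
  (\prod_(i < n) w ord0 i ^+ P i) * (\prod_(i < n) (w ord0 i)^* ^+ Q i).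

(* f_{P,Q} = w^{P'} \bar w^{Q'} / (1 - w.\bar w)^{|P|}, for |P| = |Q| *)
Definition fPQ (n : nat) (P Q : midx n.+1) : 'rV[C]_n -> C :=
  fun w => wpow w (mtail P) (mtail Q) / (1 - wnorm2 w) ^+ msize P.

Definition frPQ (n : nat) (P Q : midx n) : 'rV[C]_n -> C :=
  fun w => wpow w P Q / (1 - wnorm2 w) ^+ maxn (msize P) (msize Q).

Definition pochhammer (z : C) (m : nat) : C := \prod_(k < m) (z + k%:R).

Definition inH (hb : C) : Prop :=
  hb != 0 /\ forall m : nat, hb != - (2 * m.+1%:R)^-1.

Definition mfact (k : nat) (T : midx k) : nat := \prod_(i < k) (T i)`!.
Definition mbin (k : nat) (P T : midx k) : nat := \prod_(i < k) 'C(P i, T i).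

Definition starPQ (n : nat) (hb : C) (P Q R' S : midx n.+1) : 'rV[C]_n -> C :=
  let z := (2 * hb)^-1 in
  fun w =>
  \sum_(t : {ffun 'I_n.+1 -> 'I_(msize P).+1} |
          [forall i, (t i <= minn (P i) (S i))%N])
    let T : midx n.+1 := [ffun i => nat_of_ord (t i)] in
    (-1) ^+ (T ord0)
    * (pochhammer z (msize P + msize S - msize T) * (mfact T)%:R
       / (pochhammer z (msize P) * pochhammer z (msize S)))
    * (mbin P T)%:R * (mbin S T)%:R
    * fPQ [ffun i => (P i + R' i - T i)%N] [ffun i => (Q i + S i - T i)%N] w.

(* f_{r,P,Q} = f_{(m-|P|,P),(m-|Q|,Q)} with m = max(|P|,|Q|) *)
Definition mext (n : nat) (m : nat) (P : midx n) : midx n.+1 :=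
  [ffun i => if unlift ord0 i is Some j then P j else (m - msize P)%N].

Definition star_r (n : nat) (hb : C) (P Q R' S : midx n) : 'rV[C]_n -> C :=
  let m1 := maxn (msize P) (msize Q) in
  let m2 := maxn (msize R') (msize S) in
  starPQ hb (mext m1 P) (mext m1 Q) (mext m2 R') (mext m2 S).

Definition psummable (T : eqType) (u : T -> R) : Prop :=
  exists B : R, forall s : seq T, uniq s -> \sum_(x <- s) u x <= B.

Definition usum_to (n : nat) (T : eqType) (c : T -> C) (x : T -> 'rV[C]_n -> C)
    (y : 'rV[C]_n -> C) : Prop :=
  forall K, cpt K -> forall eps : R, 0 < eps ->
    exists s0 : seq T, forall s : seq T, uniq s -> {subset s0 <= s} ->
      snorm K (fun w => y w - \sum_(k <- s) c k * x k w) < eps.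

Definition expansion (n : nat) (alpha : midx n * midx n -> C) (a : 'rV[C]_n -> C)
  : Prop :=
  (forall K, cpt K -> psummable (fun PQ => cmod (alpha PQ) * snorm K (frPQ PQ.1 PQ.2)))
  /\ usum_to alpha (fun PQ => frPQ PQ.1 PQ.2) a.

End Defs.

(* Main.v *)
(** Each holomorphic function on [Zhat / C^*] restricts, in each of the two charts
[q^0 = 1] and [p^0 = 1], to an entire function of [2n] variables, so Cauchy estimates there
show that it is a series [sum alpha_i f_i] over the basis with [|alpha_i| rho^|i|] bounded
for every [rho]; hence [A(D_n)] is the space of such rapidly decreasing sequences. Writing
[z = 1/(2 hbar)], [f_{P,Q}] acts on monomials [y^A] of total degree [-z] by
[y^A |-> h^P (A)_P / (z)_|P| y^(A-P+Q)] with [(A)_P] falling factorials. This action is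
faithful on [P(D_n)], respects the relation defining [Zhat], and by Vandermonde's identity
turns the star product into composition: this gives the formula for all [f_{P,Q}] from the
one on the basis, and associativity. Since [|(z)_(a+b-t)| t! / |(z)_a (z)_b| <= C^(a+b)]
locally uniformly in [hbar], the coefficients of [f_i * f_j] are at most [E^(|i|+|j|)], and
the series for the product converges absolutely, locally uniformly in [hbar]. *)
Require Import Defs.
From HB Require Import structures.
From mathcomp Require Import all_boot all_order all_algebra.
From mathcomp Require Import all_classical all_reals all_analysis.
From mathcomp Require Import cyclic separable cyclotomic complex ring lra zify.
Import Order.TTheory GRing.Theory Num.Theory.
Import numFieldNormedType.Exports.

Set Implicit Arguments.
Unset Strict Implicit.
Unset Printing Implicit Defensive.

Local Open Scope ring_scope.
Local Open Scope complex_scope.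
Local Open Scope classical_set_scope.


(** * Complex analysis in one variable *)

Section ComplexModulus.
Variable R : realType.
Implicit Types z w : R[i].

(** The functions [fPQ] are linearly dependent, because [p^0 q^0 = 1 + sum p^j q^j] on [Zhat],
    whereas the product is built from the coefficients on the basis [frPQ]. The obstacle is to show
    that the formula of [starPQ] survives the rewriting of any [fPQ] in the basis. The origin of the
    operators is this: [f_{P,Q}] stands for [h^P y^Q d^P / (z)_|P|] with [d] the derivative in [y].
    Composition contracts the derivatives of the left factor with the variables of the right one, as
    the Wick product does, and on degree [-z] the Euler operator is the scalar [-z], which yields
    the relation above. Since [-z] need not be an integer, exponents are complex vectors and the
    operators act, transposed, on arbitrary functions of the exponent. On the analytic side neither
    chart suffices: a basis function is a monomial in the chart [q^0 = 1] only if [|Q| <= |P|], in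
    the other only if [|P| <= |Q|], and points with [p^0 = q^0 = 0] lie in neither. Each chart
    supplies one half of the coefficients; the circle action separates the halves and continuity
    covers the remaining points. *)

Lemma cmodE z : cmod z = ComplexField.Normc.normc z. Proof. by []. Qed.
Lemma normcC z : `|z| = (cmod z)%:C. Proof. by []. Qed.
Lemma cmodM z w : cmod (z * w) = cmod z * cmod w.
Proof. by rewrite !cmodE ComplexField.Normc.normcM. Qed.
Lemma cmod_ge0 z : 0 <= cmod z.
Proof. by rewrite -ler0c -normcC. Qed.
Lemma cmodD z w : cmod (z + w) <= cmod z + cmod w.
Proof. by rewrite -lecR rmorphD /= -!normcC ler_normD. Qed.
Lemma cmodN z : cmod (- z) = cmod z.
Proof. by rewrite /cmod normrN. Qed.
Lemma cmodB z w : cmod (z - w) <= cmod z + cmod w.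
Proof. by rewrite -(cmodN w) cmodD. Qed.
Lemma cmod0 : cmod (0 : R[i]) = 0.
Proof. by rewrite /cmod normr0. Qed.
Lemma cmod1 : cmod (1 : R[i]) = 1.
Proof. by rewrite /cmod normr1. Qed.
Lemma cmod_eq0 z : (cmod z == 0) = (z == 0).
Proof. by rewrite -(inj_eq (@complexI R)) -normcC normr_eq0. Qed.
Lemma cmod_gt0 z : (0 < cmod z) = (z != 0).
Proof. by rewrite lt_def cmod_ge0 andbT cmod_eq0. Qed.
Lemma cmodV z : cmod z^-1 = (cmod z)^-1.
Proof. by rewrite !cmodE ComplexField.Normc.normcV. Qed.
Lemma cmodX z k : cmod (z ^+ k) = cmod z ^+ k.
Proof. by elim: k => [|k IH]; rewrite ?expr0 ?cmod1 // !exprS cmodM IH. Qed.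
Lemma cmodJ z : cmod z^* = cmod z.
Proof. by rewrite /cmod normcJ. Qed.
Lemma conjCE z : Num.conj z = z^*%C.
Proof. by []. Qed.
Lemma cmod_real (x : R) : cmod x%:C = `|x|.
Proof. by rewrite /cmod normc_def /= expr0n addr0 sqrtr_sqr. Qed.
Lemma cmod_nat k : cmod (k%:R : R[i]) = k%:R.
Proof. by rewrite -(rmorph_nat (real_complex R)) cmod_real ger0_norm. Qed.
Lemma cmod_i : cmod ('i : R[i]) = 1.
Proof. by rewrite /cmod normc_def /= expr0n add0r expr1n sqrtr1. Qed.
Lemma cmod_distC z w : cmod (z - w) = cmod (w - z).
Proof. by rewrite -cmodN opprB. Qed.
Lemma cmod_sum (I : Type) (s : seq I) (P : pred I) (u : I -> R[i]) :
  cmod (\sum_(i <- s | P i) u i) <= \sum_(i <- s | P i) cmod (u i).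
Proof.
elim/big_rec2: _ => [|i y x _ IH]; first by rewrite cmod0.
by apply: le_trans (cmodD _ _) _; rewrite lerD2l.
Qed.
Lemma cmod_prod (I : Type) (s : seq I) (P : pred I) (u : I -> R[i]) :
  cmod (\prod_(i <- s | P i) u i) = \prod_(i <- s | P i) cmod (u i).
Proof.
by elim/big_rec2: _ => [|i y x _ IH]; rewrite ?cmod1 // cmodM IH.
Qed.
Lemma Re_le_cmod z : `|complex.Re z| <= cmod z.
Proof. by rewrite -lecR -normcC normc_ge_Re. Qed.
Lemma Im_le_cmod z : `|complex.Im z| <= cmod z.
Proof.
by have := Re_le_cmod (z * 'i); rewrite ReiNIm normrN cmodM cmod_i mulr1.
Qed.
Lemma cmod_le_ReIm z : cmod z <= `|complex.Re z| + `|complex.Im z|.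
Proof.
rewrite {1}[z]complexE; apply: le_trans (cmodD _ _) _.
by rewrite cmodM cmod_i mul1r !cmod_real.
Qed.
Lemma cmod_triangle z w v : cmod (z - v) <= cmod (z - w) + cmod (w - v).
Proof. by have := cmodD (z - w) (w - v); rewrite subrKA. Qed.
Lemma cmod_ge_sub z w : cmod z - cmod w <= cmod (z - w).
Proof. by rewrite lerBlDr -[z in X in X <= _](subrK w); exact: cmodD. Qed.

Lemma cmod_eps0 z : (forall e : R, 0 < e -> cmod z <= e) -> z = 0.
Proof.
move=> H; apply/eqP; rewrite -cmod_eq0 eq_le cmod_ge0 andbT.
by apply/ler_addgt0Pl => e e0; rewrite addr0 H.
Qed.

End ComplexModulus.

(** * Integrals of complex functions of a real variable *)

Section ComplexIntegral.
Variable R : realType.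
Implicit Types (f g F : R -> R) (u v : R -> R[i]).

Lemma is_derive0_cst f : (forall x, is_derive x (1 : R) f 0) ->
  forall a b, f a = f b.
Proof. by move=> H a b; apply: is_derive_0_is_cst. Qed.

Lemma ex_antiderivative_right f (a : R) : continuous f ->
  exists F, forall x, a < x -> is_derive x (1 : R) F (f x).
Proof.
move=> cf; exists (fun x => \int[@lebesgue_measure R]_(t in `[a, x]) f t) => x ax.
have xx1 : x < x + 1 by rewrite ltrDl.
have int_f : lebesgue_measure.-integrable `[a, x + 1] (EFin \o f).
  apply: continuous_compact_integrable; first exact: segment_compact.
  exact: continuous_subspaceT.
have [] := @continuous_FTC1_closed R f a x (x + 1) xx1 int_f ax (cf x).
by move=> d1 d2; apply: DeriveDef => //; rewrite -derive1E.
Qed.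

(** The fundamental theorem of calculus gives primitives [G a] on half-lines [x > a] only. Two of
    them differ by a constant where both are valid, so the increment [G a x - G a 0] does not depend
    on the base point; letting the base point [N x] recede with [x] glues them into a primitive on
    the whole line. *)
Lemma ex_antiderivative f : continuous f ->
  exists F, forall x, is_derive x (1 : R) F (f x).
Proof.
move=> cf.
have /choice[G HG] : forall a : R, exists F, forall x, a < x -> is_derive x (1 : R) F (f x).
  by move=> a; exact: ex_antiderivative_right.
have E (a b x y : R) : a <= b -> b < x -> b < y -> G a x - G b x = G a y - G b y.
  move=> ab.
  wlog xy : x y / x <= y.
    by move=> W bx by_; case: (leP x y) => [|/ltW] xy; [|symmetry]; apply: W.
  move=> bx by_.
  have [|||c _] := @MVT_segment R (fun z => G a z - G b z) (fun=> 0) x y.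
  - by [].
  - move=> z; rewrite in_itv/= => /andP[xz _].
    have bz : b < z by exact: lt_trans xz.
    have H1 := HG a z (le_lt_trans ab bz); have H2 := HG b z bz.
    by have := is_deriveB H1 H2; rewrite subrr.
  - apply: continuous_in_subspaceT => z; rewrite inE/= in_itv/= => /andP[xz _].
    have bz : b < z by exact: lt_le_trans xz.
    have H1 := HG a z (le_lt_trans ab bz); have H2 := HG b z bz.
    apply: continuousB; apply: differentiable_continuous; apply/derivable1_diffP.
      by case: H1.
    by case: H2.
  - by rewrite mul0r => /eqP; rewrite subr_eq0 => /eqP.
pose N (x : R) := - (`|x| + 2).
exists (fun x => G (N x) x - G (N x) 0) => x.
have Nx : N x - 1 < x.
  by rewrite /N; have := ler_norm (- x); rewrite normrN; lra.
(* For [|x - y| < 1] the base point [N x - 1] does not exceed [N y], so this one base point serves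
   for all [y] near [x]. *)
have HN (y : R) : `|x - y| < 1 -> G (N y) y - G (N y) 0 = G (N x - 1) y - G (N x - 1) 0.
  move=> xy; have := E (N x - 1) (N y) y 0.
  move: (ler_norm (- y)) (ler_distD 0 x y) (ler_distD x y 0).
  rewrite !subr0 sub0r !normrN (distrC y) /N => h1 h2 h3.
  have p1 : - (`|x| + 2) - 1 <= - (`|y| + 2) by lra.
  have p2 : - (`|y| + 2) < y by lra.
  have p3 : - (`|y| + 2) < 0 by have := normr_ge0 y; lra.
  move=> /(_ p1 p2 p3) h4.
  by lra.
have D : is_derive x (1 : R) (fun y => G (N x - 1) y - G (N x - 1) 0) (f x).
  have H1 := HG (N x - 1) x Nx.
  have H2 : is_derive x (1 : R) (fun=> G (N x - 1) 0) 0 by exact: is_derive_cst.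
  by have := is_deriveB H1 H2; rewrite subr0.
apply: (near_eq_is_derive _ D).
apply/nbhs_ballP; exists 1 => //= y xy.
by rewrite HN.
Qed.

Definition antideriv f : R -> R :=
  xget (fun=> 0) [set F | forall x, is_derive x (1 : R) F (f x)].

(** The integral is the increment of a chosen primitive, so linearity, shifts and invariance under
    periods reduce to computing derivatives. *)
Definition rint f (a b : R) := antideriv f b - antideriv f a.

Lemma rintE F f a b : (forall x, is_derive x (1 : R) F (f x)) ->
  rint f a b = F b - F a.
Proof.
move=> HF; rewrite /rint.
have HG : forall x, is_derive x (1 : R) (antideriv f) (f x).
  exact: (@xgetPex _ (fun=> 0) [set F | forall x, is_derive x (1 : R) F (f x)] (ex_intro _ F HF)).
have H : forall x, is_derive x (1 : R) (fun y => antideriv f y - F y) 0.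
  by move=> x; have := is_deriveB (HG x) (HF x); rewrite subrr.
have := is_derive0_cst H a b; lra.
Qed.

Lemma antiderivP f : continuous f -> forall x, is_derive x (1 : R) (antideriv f) (f x).
Proof.
move=> /ex_antiderivative.
exact: (@xgetPex _ (fun=> 0) [set F | forall x, is_derive x (1 : R) F (f x)]).
Qed.

Lemma rintD f g a b : continuous f -> continuous g ->
  rint (fun x => f x + g x) a b = rint f a b + rint g a b.
Proof.
move=> cf cg; rewrite (rintE _ _ (fun x => is_deriveD (antiderivP cf x) (antiderivP cg x))).
by rewrite /rint !fctE; ring.
Qed.

Lemma rintZ (c : R) f a b : continuous f ->
  rint (fun x => c * f x) a b = c * rint f a b.
Proof.
move=> cf; rewrite (rintE _ _ (fun x => is_deriveZ c (antiderivP cf x))).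
by rewrite /rint -scalerBr.
Qed.

Lemma rint_cat f a b c : rint f a b + rint f b c = rint f a c.
Proof. by rewrite /rint; ring. Qed.

Lemma rint_bound f (M a b : R) : continuous f -> a <= b ->
  (forall x, a <= x <= b -> `|f x| <= M) -> `|rint f a b| <= M * (b - a).
Proof.
move=> cf ab HM.
have [||c + E] := @MVT_segment R (antideriv f) f a b ab.
- by move=> x _; exact: antiderivP.
- apply: continuous_subspaceT => x; apply: differentiable_continuous.
  by apply/derivable1_diffP; case: (antiderivP cf x).
rewrite in_itv/= => cab.
by rewrite /rint E normrM (ger0_norm (_ : 0 <= b - a)) ?subr_ge0 // ler_wpM2r ?subr_ge0 // HM.
Qed.

Definition ccontinuous u :=
  continuous (fun x => complex.Re (u x)) /\ continuous (fun x => complex.Im (u x)).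

Definition cint u (a b : R) : R[i] :=
  rint (fun x => complex.Re (u x)) a b +i* rint (fun x => complex.Im (u x)) a b.

Lemma ccontinuousD u v : ccontinuous u -> ccontinuous v ->
  ccontinuous (fun x => u x + v x).
Proof.
move=> [u1 u2] [v1 v2]; split=> x /=.
  have -> : (fun x => complex.Re (u x + v x)) = (fun x => complex.Re (u x) + complex.Re (v x)).
    by apply/funext => y; rewrite raddfD.
  by apply: continuousD; [exact: u1|exact: v1].
have -> : (fun x => complex.Im (u x + v x)) = (fun x => complex.Im (u x) + complex.Im (v x)).
  by apply/funext => y; rewrite raddfD.
by apply: continuousD; [exact: u2|exact: v2].
Qed.

Lemma ccontinuousZ (c : R[i]) u : ccontinuous u -> ccontinuous (fun x => c * u x).
Proof.
case: c => c1 c2 [u1 u2]; split=> x /=.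
  have -> : (fun x => complex.Re ((c1 +i* c2) * u x)) =
            (fun x => c1 * complex.Re (u x) - c2 * complex.Im (u x)).
    by apply/funext => y; case: (u y).
  by apply: cvgB; apply: cvgM; [exact: cvg_cst|exact: u1|exact: cvg_cst|exact: u2].
have -> : (fun x => complex.Im ((c1 +i* c2) * u x)) =
          (fun x => c1 * complex.Im (u x) + c2 * complex.Re (u x)).
  by apply/funext => y; case: (u y).
by apply: cvgD; apply: cvgM; [exact: cvg_cst|exact: u2|exact: cvg_cst|exact: u1].
Qed.

Lemma cintD u v a b : ccontinuous u -> ccontinuous v ->
  cint (fun x => u x + v x) a b = cint u a b + cint v a b.
Proof.
move=> [u1 u2] [v1 v2]; rewrite /cint.
have -> : (fun x => complex.Re (u x + v x)) = (fun x => complex.Re (u x) + complex.Re (v x)).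
  by apply/funext => y; rewrite raddfD.
have -> : (fun x => complex.Im (u x + v x)) = (fun x => complex.Im (u x) + complex.Im (v x)).
  by apply/funext => y; rewrite raddfD.
by rewrite !rintD.
Qed.

Lemma continuousZl (c : R) f : continuous f -> continuous (fun x => c * f x).
Proof. by move=> cf x; apply: continuousM; [exact: cst_continuous|exact: cf]. Qed.

Lemma cintZ (c : R[i]) u a b : ccontinuous u ->
  cint (fun x => c * u x) a b = c * cint u a b.
Proof.
case: c => c1 c2 [u1 u2]; rewrite /cint.
have -> : (fun x => complex.Re ((c1 +i* c2) * u x)) =
          (fun x => c1 * complex.Re (u x) + (- c2) * complex.Im (u x)).
  by apply/funext => y; case: (u y) => ? ? /=; ring.
have -> : (fun x => complex.Im ((c1 +i* c2) * u x)) =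
          (fun x => c1 * complex.Im (u x) + c2 * complex.Re (u x)).
  by apply/funext => y; case: (u y).
rewrite !rintD; try exact: continuousZl.
by rewrite !rintZ //; apply/eqP; rewrite eq_complex /=; apply/andP; split; apply/eqP; ring.
Qed.

Lemma cint_cat u a b c : cint u a b + cint u b c = cint u a c.
Proof. by rewrite /cint -(rint_cat _ a b c) -[X in _ = _ +i* X](rint_cat _ a b c). Qed.

(** Real and imaginary parts are bounded separately, at the cost of the factor 2. *)
Lemma cint_bound u (M a b : R) : ccontinuous u -> a <= b ->
  (forall x, a <= x <= b -> cmod (u x) <= M) -> cmod (cint u a b) <= 2 * M * (b - a).
Proof.
move=> [u1 u2] ab HM; apply: le_trans (cmod_le_ReIm _) _ => /=.
have -> : 2 * M * (b - a) = M * (b - a) + M * (b - a) by ring.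
apply: lerD; apply: rint_bound => // x xab; apply: le_trans (HM x xab).
  exact: Re_le_cmod.
exact: Im_le_cmod.
Qed.

Lemma cintE (U u : R -> R[i]) a b :
  (forall x, is_derive x (1 : R) (fun x => complex.Re (U x)) (complex.Re (u x))) ->
  (forall x, is_derive x (1 : R) (fun x => complex.Im (U x)) (complex.Im (u x))) ->
  cint u a b = U b - U a.
Proof.
move=> H1 H2; rewrite /cint (rintE _ _ H1) (rintE _ _ H2).
by case: (U b) (U a) => ? ? [].
Qed.

End ComplexIntegral.

(** * Goursat's theorem on rectangles *)

Section Goursat.
Variable R : realType.
Implicit Types (u v : R -> R -> R[i]) (a b c d s t : R).

(** Complex differentiability at [s + i t] of a function of two real variables, with the error
    measured by the equivalent norm [|s' - s| + |t' - t|]. *)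
Definition hol_at u s t := exists D : R[i], forall e : R, 0 < e ->
  exists2 r : R, 0 < r & forall s' t', `|s' - s| < r -> `|t' - t| < r ->
    cmod (u s' t' - u s t - D * ((s' - s)%:C + 'i * (t' - t)%:C))
      <= e * (`|s' - s| + `|t' - t|).

Definition sep_continuous u :=
  (forall t, ccontinuous (u^~ t)) /\ (forall s, ccontinuous (u s)).

Definition contour u a b c d : R[i] :=
  cint (u^~ c) a b + 'i * cint (u b) c d - cint (u^~ d) a b - 'i * cint (u a) c d.

Lemma contour_cat_s u m a b c d :
  contour u a b c d = contour u a m c d + contour u m b c d.
Proof.
by rewrite /contour -(cint_cat (u^~ c) a m b) -(cint_cat (u^~ d) a m b); ring.
Qed.

Lemma contour_cat_t u m a b c d :
  contour u a b c d = contour u a b c m + contour u a b m d.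
Proof.
by rewrite /contour -(cint_cat (u a) c m d) -(cint_cat (u b) c m d); ring.
Qed.

Lemma contour_bound u (M : R) a b c d : sep_continuous u -> a <= b -> c <= d ->
  (forall s t, a <= s <= b -> c <= t <= d -> cmod (u s t) <= M) ->
  cmod (contour u a b c d) <= 4 * M * ((b - a) + (d - c)).
Proof.
move=> [u1 u2] ab cd HM; rewrite /contour.
have B1 t : c <= t <= d -> cmod (cint (u^~ t) a b) <= 2 * M * (b - a).
  by move=> ht; apply: cint_bound => // s hs; exact: HM.
have B2 s : a <= s <= b -> cmod (cint (u s) c d) <= 2 * M * (d - c).
  by move=> hs; apply: cint_bound => // t ht; exact: HM.
apply: le_trans (cmodB _ _) _; rewrite cmodM cmod_i mul1r.
have := cmodB (cint (u^~ c) a b + 'i * cint (u b) c d) (cint (u^~ d) a b).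
have := cmodD (cint (u^~ c) a b) ('i * cint (u b) c d).
rewrite cmodM cmod_i mul1r.
have := B1 c; rewrite lexx cd => /(_ isT).
have := B1 d; rewrite lexx cd => /(_ isT).
have := B2 a; rewrite lexx ab => /(_ isT).
have := B2 b; rewrite lexx ab => /(_ isT).
lra.
Qed.

Lemma contourD u v a b c d : sep_continuous u -> sep_continuous v ->
  contour (fun s t => u s t + v s t) a b c d = contour u a b c d + contour v a b c d.
Proof. by move=> [u1 u2] [v1 v2]; rewrite /contour !cintD //; ring. Qed.

Lemma contourN u a b c d : sep_continuous u ->
  contour (fun s t => (- 1) * u s t) a b c d = - contour u a b c d.
Proof. by move=> [u1 u2]; rewrite /contour !cintZ //; ring. Qed.

Lemma cint_affine (p q : R[i]) a b :
  cint (fun x => p + q * x%:C) a b = p * (b - a)%:C + q * ((b ^+ 2 - a ^+ 2) / 2)%:C.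
Proof.
case: p q => p1 p2 [q1 q2].
have H k l (x : R) : is_derive x (1 : R) (fun x => k * x + l * (x * x / 2)) (k + l * x).
  by apply: is_derive_eq; rewrite /GRing.scale /=; field.
have H1 x : is_derive x (1 : R) (fun x => p1 * x + q1 * (x * x / 2))
    (complex.Re ((p1 +i* p2) + (q1 +i* q2) * x%:C)).
  by apply: is_derive_eq (H p1 q1 x) _ => /=; ring.
have H2 x : is_derive x (1 : R) (fun x => p2 * x + q2 * (x * x / 2))
    (complex.Im ((p1 +i* p2) + (q1 +i* q2) * x%:C)).
  by apply: is_derive_eq (H p2 q2 x) _ => /=; ring.
rewrite (@cintE _ (fun x => (p1 * x + q1 * (x * x / 2)) +i* (p2 * x + q2 * (x * x / 2)))
  _ _ _ H1 H2).
by apply/eqP; rewrite eq_complex /=; apply/andP; split; apply/eqP; field.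
Qed.

Lemma ccontinuous_affine (p q : R[i]) : ccontinuous (fun x : R => p + q * x%:C).
Proof.
apply: ccontinuousD; first by split=> x; exact: cvg_cst.
apply: ccontinuousZ; split=> x /=; first exact: cvg_id.
exact: cvg_cst.
Qed.

Definition affine_st (p q : R[i]) : R -> R -> R[i] := fun s t => p + q * (s%:C + 'i * t%:C).

Lemma affine_st_cont p q : sep_continuous (affine_st p q).
Proof.
split=> x.
  have -> : (affine_st p q)^~ x = fun s => (p + q * ('i * x%:C)) + q * s%:C.
    by apply/funext => s; rewrite /affine_st; ring.
  exact: ccontinuous_affine.
have -> : affine_st p q x = fun t => (p + q * x%:C) + (q * 'i) * t%:C.
  by apply/funext => s; rewrite /affine_st; ring.
exact: ccontinuous_affine.
Qed.

Lemma contour_affine p q a b c d : contour (affine_st p q) a b c d = 0.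
Proof.
rewrite /contour.
have E1 x : (affine_st p q)^~ x = fun s => (p + q * ('i * x%:C)) + q * s%:C.
  by apply/funext => s; rewrite /affine_st; ring.
have E2 x : affine_st p q x = fun t => (p + q * x%:C) + (q * 'i) * t%:C.
  by apply/funext => s; rewrite /affine_st; ring.
rewrite !E1 !E2 !cint_affine !(rmorphB, rmorphM, rmorphXn) /=.
have i2 : 'i * 'i = -1 :> R[i] by rewrite -expr2 sqr_i.
by field: i2.
Qed.

End Goursat.

Lemma nested_intervals (R : realType) (l r : nat -> R) :
  (forall k, l k <= l k.+1) -> (forall k, r k.+1 <= r k) -> (forall k, l k <= r k) ->
  exists x, forall k, l k <= x <= r k.
Proof.
move=> hl hr hlr.
have ml : {homo l : m k / (m <= k)%N >-> m <= k} by apply: homo_leq => //; exact: le_trans.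
have mr : {homo r : m k / (m <= k)%N >-> k <= m}.
  by apply: homo_leq => // x y z xy yz; exact: le_trans yz xy.
have ub k : ubound (range l) (r k).
  move=> _ [m _ <-]; apply: le_trans (ml _ _ (leq_maxl m k)) _.
  by apply: le_trans (hlr _) _; apply: mr; exact: leq_maxr.
exists (sup (range l)) => k; apply/andP; split.
  by apply: ub_le_sup; [exists (r 0%N); exact: ub|exists k].
by apply: ge_sup; [exists (l 0%N), 0%N|exact: ub].
Qed.

Section GoursatTheorem.
Variable R : realType.
Implicit Types (u : R -> R -> R[i]).

(** The four quarters sum to the whole, so one of them carries at least a fourth of the modulus. The
    ordering hypotheses are placed inside the existential so that [choice] yields a total step
    function. *)
Let quarter u (q : R * R * (R * R)) : exists q' : R * R * (R * R),
  q.1.1 <= q.1.2 -> q.2.1 <= q.2.2 ->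
  [/\ q.1.1 <= q'.1.1 /\ q'.1.2 <= q.1.2, q.2.1 <= q'.2.1 /\ q'.2.2 <= q.2.2,
      q'.1.2 - q'.1.1 = (q.1.2 - q.1.1) / 2, q'.2.2 - q'.2.1 = (q.2.2 - q.2.1) / 2
    & cmod (contour u q.1.1 q.1.2 q.2.1 q.2.2)
      <= 4 * cmod (contour u q'.1.1 q'.1.2 q'.2.1 q'.2.2)].
Proof.
case: q => [[a b] [c d]] /=.
pose m := (a + b) / 2; pose k := (c + d) / 2.
set V := cmod (contour u a b c d).
have [H1|H1] := leP V (4 * cmod (contour u a m c k)).
  by exists (a, m, (c, k)) => ab cd; rewrite /m /k; split => //=; lra.
have [H2|H2] := leP V (4 * cmod (contour u a m k d)).
  by exists (a, m, (k, d)) => ab cd; rewrite /m /k; split => //=; lra.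
have [H3|H3] := leP V (4 * cmod (contour u m b c k)).
  by exists (m, b, (c, k)) => ab cd; rewrite /m /k; split => //=; lra.
exists (m, b, (k, d)) => ab cd; rewrite /m /k; split => //=; try lra.
have : V <= cmod (contour u a m c k) + cmod (contour u a m k d)
          + (cmod (contour u m b c k) + cmod (contour u m b k d)).
  rewrite /V (contour_cat_s u m) (contour_cat_t u k a m) (contour_cat_t u k m b).
  by apply: le_trans (cmodD _ _) _; apply: lerD; exact: cmodD.
rewrite -/m -/k; lra.
Qed.

Theorem goursat u (a b c d : R) : a <= b -> c <= d -> sep_continuous u ->
  (forall s t, a <= s <= b -> c <= t <= d -> hol_at u s t) ->
  contour u a b c d = 0.
Proof.
move=> ab cd cu hu.
have /choice[step hstep] := quarter u.
pose Q k := iter k step (a, b, (c, d)).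
have Qord k : (Q k).1.1 <= (Q k).1.2 /\ (Q k).2.1 <= (Q k).2.2.
  elim: k => [|k [IH1 IH2]] //=.
  by have [_ _ E1 E2 _] := hstep (Q k) IH1 IH2; rewrite -/(Q k); split; lra.
have Qs k := hstep (Q k) (Qord k).1 (Qord k).2.
have w2 k : 0 < (2 : R) ^+ k by rewrite exprn_gt0.
have W k : (Q k).1.2 - (Q k).1.1 = (b - a) / 2 ^+ k.
  elim: k => [|k IH]; first by rewrite expr0 divr1.
  have [_ _ E1 _ _] := Qs k; rewrite -/(Q k.+1) in E1.
  by rewrite [Q k.+1]/= E1 IH exprS; field; rewrite gt_eqF.
have H k : (Q k).2.2 - (Q k).2.1 = (d - c) / 2 ^+ k.
  elim: k => [|k IH]; first by rewrite expr0 divr1.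
  have [_ _ _ E1 _] := Qs k.
  by rewrite [Q k.+1]/= E1 IH exprS; field; rewrite gt_eqF.
have V k : cmod (contour u a b c d)
    <= 4 ^+ k * cmod (contour u (Q k).1.1 (Q k).1.2 (Q k).2.1 (Q k).2.2).
  elim: k => [|k IH]; first by rewrite expr0 mul1r.
  have [_ _ _ _ E] := Qs k.
  apply: le_trans IH _; by rewrite exprSr -mulrA ler_wpM2l ?exprn_ge0.
have [s0 hs0] : exists x, forall k, (Q k).1.1 <= x <= (Q k).1.2.
  apply: nested_intervals => k; last exact: (Qord k).1.
    by have [[E _] _ _ _ _] := Qs k.
  by have [[_ E] _ _ _ _] := Qs k.
have [t0 ht0] : exists x, forall k, (Q k).2.1 <= x <= (Q k).2.2.
  apply: nested_intervals => k; last exact: (Qord k).2.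
    by have [_ [E _] _ _ _] := Qs k.
  by have [_ [_ E] _ _ _] := Qs k.
have [D hD] := hu s0 t0 (hs0 0%N) (ht0 0%N).
apply: cmod_eps0 => e e0.
pose L := (b - a) + (d - c).
have L0 : 0 <= L by rewrite /L; lra.
(* At every depth [k] the final bound is [4^k * 4 * (e' * L / 2^k) * (L / 2^k) = 4 e' L^2]; dividing
   by [L^2 + 1] makes it at most [e] and keeps the quotient defined when [L = 0]. *)
pose e' := e / (4 * (L ^+ 2 + 1)).
have e'0 : 0 < e'.
  by rewrite divr_gt0 // mulr_gt0 // ltr_wpDl ?sqr_ge0.
have [r r0 hr] := hD e' e'0.
have [k hk] : exists k, L / 2 ^+ k < r.
  have [k hk] : exists k : nat, L / r < k%:R.
    by exists (Num.truncn (L / r)).+1; rewrite truncnS_gt.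
  exists k; rewrite ltr_pdivrMr // mulrC -ltr_pdivrMr //.
  by apply: lt_le_trans hk _; rewrite -natrX ler_nat ltnW // ltn_expl.
(* The first-order Taylor polynomial at the common point of all rectangles has contour integral 0;
   subtracting it leaves only the differentiability error to bound. *)
pose A := affine_st (u s0 t0 - D * (s0%:C + 'i * t0%:C)) D.

have Ec : contour u (Q k).1.1 (Q k).1.2 (Q k).2.1 (Q k).2.2 =
          contour (fun s t => u s t + (-1) * A s t) (Q k).1.1 (Q k).1.2 (Q k).2.1 (Q k).2.2.
  have cA := affine_st_cont (u s0 t0 - D * (s0%:C + 'i * t0%:C)) D.
  rewrite contourD //; last first.
    by case: cA => A1 A2; split=> x; apply: ccontinuousZ; [exact: A1|exact: A2].
  by rewrite contourN // contour_affine oppr0 addr0.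
apply: le_trans (V k) _; rewrite Ec.
have lk : ((Q k).1.2 - (Q k).1.1) + ((Q k).2.2 - (Q k).2.1) = L / 2 ^+ k.
  by rewrite W H -mulrDl.
have B := @contour_bound R (fun s t => u s t + (-1) * A s t) (e' * (L / 2 ^+ k))
  (Q k).1.1 (Q k).1.2 (Q k).2.1 (Q k).2.2.
rewrite lk in B.
apply: le_trans.
  apply: ler_wpM2l; first by rewrite exprn_ge0.
  apply: B; [|exact: (Qord k).1|exact: (Qord k).2|].
    have [A1 A2] := affine_st_cont (u s0 t0 - D * (s0%:C + 'i * t0%:C)) D.
    case: cu => u1 u2.
    by split=> x; apply: ccontinuousD => //; apply: ccontinuousZ; [exact: A1|exact: A2].
  move=> s t hs ht.
  have ds : `|s - s0| <= (Q k).1.2 - (Q k).1.1.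
    by have := hs0 k; move: hs => /andP[? ?] /andP[? ?]; rewrite ler_norml; lra.
  have dt : `|t - t0| <= (Q k).2.2 - (Q k).2.1.
    by have := ht0 k; move: ht => /andP[? ?] /andP[? ?]; rewrite ler_norml; lra.
  have dst : `|s - s0| + `|t - t0| <= L / 2 ^+ k by rewrite -lk lerD.
  have n1 := normr_ge0 (s - s0); have n2 := normr_ge0 (t - t0).
  have -> : u s t + -1 * A s t = u s t - u s0 t0 - D * ((s - s0)%:C + 'i * (t - t0)%:C).
    by rewrite /A /affine_st !rmorphB /=; ring.
  apply: le_trans (hr _ _ _ _) _; [lra|lra|].
  by apply: ler_wpM2l => //; exact: ltW.
have -> : 4 ^+ k * (4 * (e' * (L / 2 ^+ k)) * (L / 2 ^+ k)) = 4 * e' * L ^+ 2 :> R.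
  have -> : 4 ^+ k = 2 ^+ k * 2 ^+ k :> R by rewrite -exprMn -natrM.
  by field; rewrite gt_eqF.
have -> : 4 * e' * L ^+ 2 = e * (L ^+ 2 / (L ^+ 2 + 1)).
  by rewrite /e'; field; rewrite gt_eqF // ltr_wpDl ?sqr_ge0.
rewrite ler_piMr ?(ltW e0) // ler_pdivrMr ?mul1r ?lerDl //.
by rewrite ltr_wpDl ?sqr_ge0.
Qed.

End GoursatTheorem.

Lemma derivable_eps (K : numFieldType) (V : normedModType K) (f : K -> V) (x : K) :
  derivable f x 1 -> forall e : K, 0 < e -> exists2 r : K, 0 < r &
  forall h, `|h| < r -> `|f (h + x) - f x - h *: 'D_1 f x| <= e * `|h|.
Proof.
move=> df e e0.
have /cvgrPdist_le/(_ e e0) := df.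
rewrite -/('D_1 f x) near_withinE => /nbhs_ballP[r r0 hr].
exists r => // h hlt; have [->|h0] := eqVneq h 0.
  by rewrite add0r subrr scale0r subr0 !normr0 mulr0.
have := hr h; rewrite /ball /= sub0r normrN => /(_ hlt h0).
rewrite [h *: 1]mulr1 => H.
have -> : f (h + x) - f x - h *: 'D_1 f x = - (h *: ('D_1 f x - h^-1 *: (f (h + x) - f x))).
  by rewrite scalerBr scalerA divff // scale1r opprB.
by rewrite normrN normrZ mulrC ler_wpM2r.
Qed.

(** * The exponential as a change of coordinates *)

Section PolarCoordinates.
Variable R : realType.
Implicit Types (g : R[i] -> R[i]) (s t : R) (z w : R[i]).

Definition cderiv g z (l : R[i]) := forall e : R, 0 < e -> exists2 r : R, 0 < r &
  forall w, cmod (w - z) < r -> cmod (g w - g z - l * (w - z)) <= e * cmod (w - z).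

Definition ccont g := forall z (e : R), 0 < e -> exists2 r : R, 0 < r &
  forall w, cmod (w - z) < r -> cmod (g w - g z) < e.

Lemma is_derive_cderiv g z l :
  is_derive (z : R[i]^o) 1 (g : R[i]^o -> R[i]^o) l -> cderiv g z l.
Proof.
move=> [d E] e e0; have e0C : 0 < e%:C :> R[i] by rewrite ltcR.
have [r r0 hr] := @derivable_eps R[i] R[i]^o g z d e%:C e0C.
have rE : r = (complex.Re r)%:C by rewrite RRe_real // gtr0_real.
exists (complex.Re r); first by rewrite -ltcR -rE.
move=> w; rewrite -ltcR -rE -normcC => hw.
have := hr (w - z) hw; rewrite subrK E => H.
by rewrite -lecR rmorphM -!normcC /= [l * _]mulrC.
Qed.

Lemma cderiv_cont g z l : cderiv g z l -> forall e : R, 0 < e ->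
  exists2 r : R, 0 < r & forall w, cmod (w - z) < r -> cmod (g w - g z) < e.
Proof.
move=> H e e0; have [r r0 hr] := H 1 ltr01.
have l0 := cmod_ge0 l.
have B0 : 0 < cmod l + 1 by lra.
exists (Num.min r (e / (cmod l + 1))); first by rewrite lt_min r0 divr_gt0.
move=> w; rewrite lt_min => /andP[h1]; rewrite ltr_pdivlMr // => h2.
have := hr w h1; have := cmodD (g w - g z - l * (w - z)) (l * (w - z)).
rewrite subrK cmodM; nra.
Qed.

(** The exponential of [s + i t]. It maps a rectangle of height [2 pi] to an annulus: vertical sides
    become full circles and the horizontal sides cancel by periodicity, so rectangles are the only
    contours ever needed. *)
Definition cexp s t : R[i] := (expR s * cos t) +i* (expR s * sin t).

Lemma cexpD s s' t t' : cexp (s + s') (t + t') = cexp s t * cexp s' t'.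
Proof.
rewrite /cexp expRD cosD sinD.
by apply/eqP; rewrite eq_complex /=; apply/andP; split; apply/eqP; ring.
Qed.

Lemma cmod_cexp s t : cmod (cexp s t) = expR s.
Proof.
rewrite /cmod normc_def /= !exprMn -mulrDr cos2Dsin2 mulr1 sqrtr_sqr.
by rewrite ger0_norm // expR_ge0.
Qed.

Lemma cexp_neq0 s t : cexp s t != 0.
Proof. by rewrite -cmod_eq0 cmod_cexp gt_eqF // expR_gt0. Qed.

Lemma cexp00 : cexp 0 0 = 1.
Proof. by rewrite /cexp expR0 cos0 sin0 mulr1 mulr0. Qed.

Lemma cexp_periodic s t : cexp s (t + pi) = cexp s (t - pi).
Proof. by rewrite /cexp cosDpi sinDpi cosB sinB cospi sinpi !mulr0 !mulrN1 addr0 subr0. Qed.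

Lemma derive_eps0 (f : R -> R) (l : R) : is_derive (0 : R) (1 : R) f l ->
  forall e, 0 < e -> exists2 r, 0 < r & forall h, `|h| < r -> `|f h - f 0 - h * l| <= e * `|h|.
Proof.
move=> [d E] e e0; have [r r0 hr] := derivable_eps d e0; exists r => // h hh.
by have := hr h hh; rewrite addr0 E.
Qed.

(** Differentiability at 0 is assembled from the real derivatives of [expR], [cos] and [sin]; the
    homomorphism property [cexpD] then transports it to every point. *)
Lemma cexp_hol00 (e : R) : 0 < e -> exists2 r : R, 0 < r &
  forall s t, `|s| < r -> `|t| < r ->
  cmod (cexp s t - 1 - (s%:C + 'i * t%:C)) <= e * (`|s| + `|t|).
Proof.
move=> e0; pose d : R := Num.min (e / 4) 1.
have d0 : 0 < d by rewrite lt_min ltr01 andbT; lra.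
have d1 : d <= 1 by rewrite ge_min lexx orbT.
have de : 4 * d <= e.
  have : d <= e / 4 by rewrite ge_min lexx.
  lra.
have D1 : is_derive (0 : R) (1 : R) (@expR R) 1 by have := is_derive_expR (0 : R); rewrite expR0.
have D2 : is_derive (0 : R) (1 : R) (@cos R) 0.
  by have := is_derive_cos (0 : R); rewrite sin0 oppr0.
have D3 : is_derive (0 : R) (1 : R) (@sin R) 1 by have := is_derive_sin (0 : R); rewrite cos0.
have [r1 r10 h1] := derive_eps0 D1 d0.
have [r2 r20 h2] := derive_eps0 D2 d0.
have [r3 r30 h3] := derive_eps0 D3 d0.
exists (Num.min (Num.min r1 r2) (Num.min r3 (d / 2))).
  by rewrite !lt_min r10 r20 r30 /=; lra.
move=> s t; rewrite !lt_min => /andP[/andP[s1 _] /andP[_ s4]] /andP[/andP[_ t2] /andP[t3 t4]].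
have := h1 s s1; have := h2 t t2; have := h3 t t3.
rewrite expR0 cos0 sin0 !mulr1 mulr0 !subr0.
move=> b3 b2 b1.
apply: le_trans (cmod_le_ReIm _) _.
rewrite /cexp /= !(mul0r,mul1r,mulr0,addr0,add0r,subr0,oppr0).
have n1 := normr_ge0 s; have n2 := normr_ge0 t.
have b4 : `|expR s - 1| <= 2 * `|s|.
  have := ler_normD (expR s - 1 - s) s; rewrite subrK.
  have := ler_wpM2r n1 d1; lra.
have b5 : `|expR s| <= 2.
  by have := ler_normD (expR s - 1) 1; rewrite subrK normr1; lra.
have e5 := normr_ge0 (expR s).
have -> : expR s * cos t - 1 - s = (expR s - 1 - s) + expR s * (cos t - 1) by ring.
have -> : expR s * sin t - t = (expR s - 1) * t + expR s * (sin t - t) by ring.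
have := ler_normD (expR s - 1 - s) (expR s * (cos t - 1)).
have := ler_normD ((expR s - 1) * t) (expR s * (sin t - t)).
rewrite !normrM.
have p1 : `|expR s| * `|cos t - 1| <= 2 * (d * `|t|) by apply: ler_pM.
have p2 : `|expR s| * `|sin t - t| <= 2 * (d * `|t|) by apply: ler_pM.
have p3 : `|expR s - 1| * `|t| <= d * `|t|.
  by apply: ler_wpM2r => //; lra.
move=> q1 q2; apply: le_trans (lerD q2 q1) _.
have : 4 * d * (`|s| + `|t|) <= e * (`|s| + `|t|) by apply: ler_wpM2r => //; lra.
nra.
Qed.

Lemma cexp_hol s0 t0 (e : R) : 0 < e -> exists2 r : R, 0 < r &
  forall s t, `|s - s0| < r -> `|t - t0| < r ->
  cmod (cexp s t - cexp s0 t0 - cexp s0 t0 * ((s - s0)%:C + 'i * (t - t0)%:C))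
    <= e * (`|s - s0| + `|t - t0|).
Proof.
move=> e0; have E0 := expR_gt0 s0.
have [r r0 hr] := @cexp_hol00 (e / expR s0) (divr_gt0 e0 E0); exists r => // s t hs ht.
have -> : cexp s t = cexp s0 t0 * cexp (s - s0) (t - t0).
  by rewrite -cexpD; congr (cexp _ _); ring.
have -> : forall a b c : R[i], a * b - a - a * c = a * (b - 1 - c) by move=> *; ring.
rewrite cmodM cmod_cexp -ler_pdivlMl //.
by apply: le_trans (hr _ _ hs ht) _; rewrite [e / _]mulrC mulrA.
Qed.

Lemma cexp_cont s0 t0 (e : R) : 0 < e -> exists2 r : R, 0 < r &
  forall s t, `|s - s0| < r -> `|t - t0| < r -> cmod (cexp s t - cexp s0 t0) < e.
Proof.
move=> e0; have [r r0 hr] := @cexp_hol s0 t0 1 ltr01.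
have E0 := expR_gt0 s0; pose K := 2 * (expR s0 + 1).
have K0 : 0 < K by rewrite /K; lra.
exists (Num.min r (e / K)); first by rewrite lt_min r0 divr_gt0.
move=> s t; rewrite !lt_min => /andP[s1 s2] /andP[t1 t2].
move: s2 t2; rewrite !ltr_pdivlMr // => s2 t2.
have := hr s t s1 t1.
set A := cexp s t - _; set B := cexp s0 t0 * _ => H.
have HB : cmod B <= expR s0 * (`|s - s0| + `|t - t0|).
  rewrite /B cmodM cmod_cexp ler_pM2l //.
  by apply: le_trans (cmodD _ _) _; rewrite cmodM cmod_i mul1r !cmod_real.
have := cmodD (A - B) B; rewrite subrK /K in s2 t2 *; nra.
Qed.

Lemma hol_at_comp g s0 t0 l : cderiv g (cexp s0 t0) l ->
  hol_at (fun s t => g (cexp s t)) s0 t0.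
Proof.
move=> H; set z0 := cexp s0 t0; exists (l * z0) => e e0.
have E0 := expR_gt0 s0; have l0 := cmod_ge0 l.
(* The error splits into that of [g] and [l] times that of [cexp]; [e1] makes the first at most
   [e / 4] of the increment, [e2] the second at most [e / 2]. *)
pose K := 2 * (expR s0 + 1); pose e1 := e / (2 * K).
have K0 : 0 < K by rewrite /K; lra.
have e10 : 0 < e1 by rewrite divr_gt0 // mulr_gt0.
have [r r0 hr] := H e1 e10.
pose e2 := Num.min 1 (e / (2 * (cmod l + 1))).
have e20 : 0 < e2.
  by rewrite lt_min ltr01 divr_gt0 // mulr_gt0 //; lra.
have [r1 r10 h1] := @cexp_hol s0 t0 e2 e20.
have [r2 r20 h2] := @cexp_cont s0 t0 r r0.
exists (Num.min r1 r2); first by rewrite lt_min r10.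
move=> s t; rewrite !lt_min => /andP[s1 s2] /andP[t1 t2].
have A1 := h1 s t s1 t1; have A2 := hr _ (h2 s t s2 t2).
set d := `|s - s0| + `|t - t0| in A1 *.
have d0 : 0 <= d by rewrite addr_ge0.
rewrite -/z0 in A1 A2 *; set c := (s - s0)%:C + _ in A1 *.
have c1 : cmod (z0 * c) <= expR s0 * d.
  rewrite /z0 cmodM cmod_cexp ler_pM2l //.
  by apply: le_trans (cmodD _ _) _; rewrite cmodM cmod_i mul1r !cmod_real.
have A3 : cmod (cexp s t - z0) <= (expR s0 + 1) * d.
  have := cmodD (cexp s t - z0 - z0 * c) (z0 * c); rewrite subrK.
  have : e2 <= 1 by rewrite ge_min lexx.
  nra.
have -> : g (cexp s t) - g z0 - l * z0 * c =
   (g (cexp s t) - g z0 - l * (cexp s t - z0)) + l * (cexp s t - z0 - z0 * c) by ring.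
apply: le_trans (cmodD _ _) _; rewrite cmodM.
have P1 : e1 * cmod (cexp s t - z0) <= e / 4 * d.
  apply: le_trans (ler_wpM2l (ltW e10) A3) _.
  have -> : e1 * ((expR s0 + 1) * d) = e / 4 * d.
    by rewrite /e1 /K; field; rewrite gt_eqF //; lra.
  by [].
have P2 : cmod l * (e2 * d) <= e / 2 * d.
  have : e2 <= e / (2 * (cmod l + 1)) by rewrite ge_min lexx orbT.
  rewrite mulrA => He; apply: ler_wpM2r => //.
  apply: le_trans (_ : cmod l * (e / (2 * (cmod l + 1))) <= _); first exact: ler_wpM2l.
  have -> : cmod l * (e / (2 * (cmod l + 1))) = e / 2 * (cmod l / (cmod l + 1)).
    by field; rewrite gt_eqF //; lra.
  by rewrite ler_piMr ?ler_pdivrMr ?mul1r; lra.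
have := ler_wpM2l l0 A1; nra.
Qed.

Lemma ccontinuous_eps (u : R -> R[i]) :
  (forall x e, 0 < e -> exists2 r, 0 < r & forall y, `|y - x| < r -> cmod (u y - u x) < e) ->
  ccontinuous u.
Proof.
move=> H; split=> x; apply/cvgrPdist_lt => e e0; have [r r0 hr] := H x e e0;
  apply/nbhs_ballP; exists r => //= y; rewrite /ball /= distrC => /hr; apply: le_lt_trans.
  by have := Re_le_cmod (u y - u x); rewrite raddfB /= distrC.
by have := Im_le_cmod (u y - u x); rewrite raddfB /= distrC.
Qed.

Lemma sep_continuous_comp g : ccont g -> sep_continuous (fun s t => g (cexp s t)).
Proof.
move=> H; split=> x; apply: ccontinuous_eps => y e e0.
  have [r r0 hr] := H (cexp y x) e e0; have [q q0 hq] := @cexp_cont y x r r0.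
  by exists q => // s hs; apply: hr; apply: hq; rewrite ?subrr ?normr0.
have [r r0 hr] := H (cexp x y) e e0; have [q q0 hq] := @cexp_cont x y r r0.
by exists q => // s hs; apply: hr; apply: hq; rewrite ?subrr ?normr0.
Qed.

End PolarCoordinates.

(** * Cauchy's theorem on circles *)

Section CauchyFormula.
Variable R : realType.
Implicit Types (g : R[i] -> R[i]) (s t : R) (z w : R[i]) (u : R -> R -> R[i]).

(** Cutting out a square of half-side [h] around the exceptional point leaves rectangles to which
    [goursat] applies; the square contributes at most [4 M * 4 h]. Local boundedness, which separate
    continuity does not give, controls it. *)
Lemma goursat_bad_point u (a b c d s0 t0 : R) : a < s0 < b -> c < t0 < d ->
  sep_continuous u ->
  (exists2 r, 0 < r & exists M, forall s t, `|s - s0| < r -> `|t - t0| < r ->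
     cmod (u s t) <= M) ->
  (forall s t, (s, t) <> (s0, t0) -> a <= s <= b -> c <= t <= d -> hol_at u s t) ->
  contour u a b c d = 0.
Proof.
move=> /andP[as0 s0b] /andP[ct0 t0d] cu bu hu; apply: cmod_eps0 => e e0.
have [r r0 [M HM]] := bu.
have M0 : 0 <= M by apply: le_trans (cmod_ge0 _) (HM s0 t0 _ _); rewrite subrr normr0.
pose h := Num.min (Num.min (s0 - a) (b - s0)) (Num.min (Num.min (t0 - c) (d - t0))
  (Num.min (r / 2) (e / (16 * (M + 1))))).
have h0 : 0 < h.
  rewrite /h !lt_min !subr_gt0 as0 s0b ct0 t0d !divr_gt0 //; lra.
have : h <= h by [].
rewrite {2}/h !le_min => /andP[/andP[h1 h2] /andP[/andP[h3 h4] /andP[h5 h6]]].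
have Z (a' b' c' d' : R) : a <= a' -> a' <= b' -> b' <= b -> c <= c' -> c' <= d' -> d' <= d ->
    (b' < s0 \/ s0 < a') \/ (d' < t0 \/ t0 < c') -> contour u a' b' c' d' = 0.
  move=> aa ab bb cc cd dd far; apply: goursat => // s t /andP[s1 s2] /andP[t1 t2].
  apply: hu; [|lra|lra] => -[es et]; rewrite es in s1 s2; rewrite et in t1 t2.
  by case: far => -[]; lra.
rewrite (contour_cat_s u (s0 - h)) (contour_cat_s u (s0 + h) (s0 - h)).
rewrite (contour_cat_t u (t0 - h) (s0 - h)) (contour_cat_t u (t0 + h) _ _ (t0 - h)).
rewrite (Z a (s0 - h)) ?add0r; try lra.
rewrite (Z (s0 + h) b) ?addr0; try lra.
rewrite (Z _ _ c (t0 - h)) ?add0r; try lra.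
rewrite (Z _ _ (t0 + h) d) ?addr0; try lra.
apply: le_trans (contour_bound (M := M) cu _ _ _) _; [lra|lra| |].
  by move=> s t hs ht; apply: HM; rewrite ltr_norml; lra.
move: h6; rewrite ler_pdivlMr //; last lra.
nra.
Qed.

(** As a function of the centre of the window, the integral has derivative
    [k (x + pi) - k (x - pi) = 0]. *)
Lemma cint_period (f : R -> R[i]) (th : R) : ccontinuous f ->
  (forall t, f (t + pi) = f (t - pi)) ->
  cint f (th - pi) (th + pi) = cint f (- pi) pi.
Proof.
move=> [c1 c2] pf.
have H (k : R -> R) : continuous k -> (forall t, k (t + pi) = k (t - pi)) ->
    rint k (th - pi) (th + pi) = rint k (- pi) pi.
  move=> ck pk; rewrite /rint.
  suff D : forall x : R, is_derive x (1 : R)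
      (fun x => antideriv k (x + pi) - antideriv k (x - pi)) 0.
    by have := is_derive0_cst D th 0; rewrite add0r sub0r.
  move=> x.
  have D1 : is_derive x (1 : R) (fun x : R => x + pi) 1.
    by apply: is_derive_eq; rewrite addr0.
  have D2 : is_derive x (1 : R) (fun x : R => x - pi) 1.
    by apply: is_derive_eq; rewrite subr0.
  have D3 := @is_derive1_comp _ (antideriv k) (fun x => x + pi) x _ _ (antiderivP ck (x + pi)) D1.
  have D4 := @is_derive1_comp _ (antideriv k) (fun x => x - pi) x _ _ (antiderivP ck (x - pi)) D2.
  by have := is_deriveB D3 D4; rewrite !mulr1 pk subrr.
rewrite /cint !H //.
  by move=> t; rewrite pf.
by move=> t; rewrite pf.
Qed.

Lemma polar z : z != 0 -> exists th, z = cexp (ln (cmod z)) th.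
Proof.
rewrite -cmod_gt0 => z0; rewrite /cexp lnK //.
case: z z0 => x y; set m := cmod _ => z0.
have m2 : m ^+ 2 = x ^+ 2 + y ^+ 2.
  by rewrite /m /cmod normc_def /= sqr_sqrtr // addr_ge0 ?sqr_ge0.
have xm : -1 <= x / m <= 1.
  rewrite -ler_norml normrM normfV (gtr0_norm z0) ler_pdivrMr // mul1r.
  exact: (Re_le_cmod (x +i* y)).
have [_ ca] := acos_def xm; have sa := sin_acos xm.
have s2 : sin (acos (x / m)) ^+ 2 = (y / m) ^+ 2.
  rewrite sin2cos2 ca !expr_div_n m2.
  by field; rewrite -m2 expf_neq0 // gt_eqF.
have m_neq0 : m != 0 by rewrite gt_eqF.
have : sin (acos (x / m)) = y / m \/ sin (acos (x / m)) = - (y / m).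
  by move/eqP: s2; rewrite eqf_sqr => /orP[/eqP|/eqP]; [left|right].
case=> sy; [exists (acos (x / m))|exists (- acos (x / m))];
  rewrite ?cosN ?sinN ca sy ?opprK; by congr (_ +i* _); field.
Qed.

Lemma cexp_inj s t s0 t0 : `|t - t0| <= pi -> cexp s t = cexp s0 t0 -> (s, t) = (s0, t0).
Proof.
move=> tt E.
have Es : s = s0 by apply: (@expR_inj R); rewrite -(cmod_cexp s t) E cmod_cexp.
have : cexp (s - s0) (t - t0) = 1.
  apply: (mulfI (cexp_neq0 s0 t0)); rewrite -cexpD mulr1 -E.
  by congr (cexp _ _); ring.
rewrite Es subrr /cexp expR0 !mul1r => -[c1 _].
suff : `|t - t0| = 0 by move/normr0_eq0/eqP; rewrite subr_eq0 => /eqP ->.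
apply: (@cos_inj R); rewrite ?cos_norm ?cos0 //.
  by rewrite in_itv /= normr_ge0.
by rewrite in_itv /= lexx pi_ge0.
Qed.

(** The measure is [dt = dz / (i z)], not [dz]; this accounts for the extra factor [z] of the
    integrand in [cauchy_estimate]. *)
Definition circ_int (f : R[i] -> R[i]) (s : R) := cint (fun t => f (cexp s t)) (- pi) pi.

Lemma ccont_circ f s : ccont f -> ccontinuous (fun t => f (cexp s t)).
Proof. by move=> /sep_continuous_comp[_ H]; exact: H. Qed.

Lemma circ_int_bound f (M s : R) : ccontinuous (fun t => f (cexp s t)) -> (forall z, cmod z = expR s -> cmod (f z) <= M) ->
  cmod (circ_int f s) <= 4 * pi * M.
Proof.
move=> cf HM.
have -> : 4 * pi * M = 2 * M * (pi - - pi) by ring.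
apply: cint_bound => //; first by have := pi_ge0 R; lra.
by move=> t _; apply: HM; rewrite cmod_cexp.
Qed.

(** In exponential coordinates the circle integral does not depend on the radius, the exceptional
    point [w] being harmless, and it tends to 0 with the radius because [f 0 = 0]. The angular
    window is centred at the argument of [w], so that [w] has a single preimage, interior to the
    rectangle. *)
Lemma circ_int_eq0 f w : ccont f -> f 0 = 0 -> (forall z, z != w -> exists l, cderiv f z l) ->
  forall s, cmod w < expR s -> circ_int f s = 0.
Proof.
move=> cf f0 df s ws.
have [s0 [th [s0s hw]]] : exists s0 th, s0 < s /\ forall s t, `|t - th| <= pi -> (s, t) <> (s0, th) ->
    cexp s t != w.
  have [w0|wn0] := eqVneq w 0.
    (* For [w = 0] nothing is mapped to [w], and the exceptional point is a dummy. *)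
    by exists (s - 1), 0; split=> [|s' t' _ _]; [lra|rewrite w0 cexp_neq0].
  have [th' hw'] := polar wn0; exists (ln (cmod w)), th'; split.
    by rewrite -(ltr_expR (ln _)) lnK // posrE cmod_gt0.
  move=> s' t' ht far; apply/eqP; rewrite [in RHS]hw' => E.
  exact: far (cexp_inj ht E).
have p0 := pi_gt0 R.
have per s' : circ_int f s' = cint (fun t => f (cexp s' t)) (th - pi) (th + pi).
  rewrite /circ_int cint_period //; first exact: ccont_circ.
  by move=> t; rewrite cexp_periodic.
apply: cmod_eps0 => e e0.
have [r r0 hr] := cf 0 (e / (4 * pi)) (divr_gt0 e0 (mulr_gt0 (ltr0n _ 4) p0)).
pose a := Num.min (s0 - 1) (ln (r / 2)).
have as0 : a < s0 by rewrite gt_min; apply/orP; left; lra.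
have ar : expR a < r.
  apply: le_lt_trans (_ : expR (ln (r / 2)) < r); first by rewrite ler_expR ge_min lexx orbT.
  by rewrite lnK ?posrE; lra.
have Z : contour (fun s t => f (cexp s t)) a s (th - pi) (th + pi) = 0.
  apply: (@goursat_bad_point _ _ _ _ _ s0 th); [lra|lra|exact: sep_continuous_comp| |].
    have [q q0 hq] := cf (cexp s0 th) 1 ltr01.
    have [q' q'0 hq'] := cexp_cont s0 th q0.
    exists q' => //; exists (1 + cmod (f (cexp s0 th))) => s' t' h1 h2.
    rewrite -lerBlDr; apply: le_trans (cmod_ge_sub _ _) _.
    exact/ltW/hq/hq'.
  move=> s' t' far hs' ht'.
  have [|l hl] := df (cexp s' t'); last exact: hol_at_comp hl.
  by apply: hw => //; rewrite ler_norml; lra.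
have : circ_int f s = circ_int f a.
  move: Z; rewrite /contour !per.
  have -> : (fun s' => f (cexp s' (th - pi))) = (fun s' => f (cexp s' (th + pi))).
    by apply/funext => s'; rewrite cexp_periodic.
  set A := cint _ a s; set B := cint _ _ _; set C := cint _ _ _ => Z.
  have i0 : ('i%R : R[i]) != 0 by rewrite -cmod_eq0 cmod_i oner_eq0.
  apply: (mulfI i0); apply/eqP; rewrite -subr_eq0; apply/eqP; rewrite -[RHS]Z; ring.
move=> ->; apply: le_trans (circ_int_bound (M := e / (4 * pi)) (ccont_circ _ cf) _) _.
  move=> z hz; have := hr z; rewrite subr0 f0 subr0 hz => /(_ ar); exact: ltW.
by rewrite mulrC divfK // gt_eqF // mulr_gt0.
Qed.

End CauchyFormula.

(** * Taylor polynomials of entire functions of one variable *)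

Section CauchyEstimate.
Variable R : realType.
Local Notation C := (R[i]).
Implicit Types (g f : C -> C) (s t : R) (z w : C).

Definition cdiff g z := derivable (g : C^o -> C^o) z 1.

Definition entire g := forall z, cdiff g z.

Lemma cdiff_id z : cdiff (fun z => z) z.
Proof. exact: (@derivable_id _ (C^o)). Qed.

Lemma cdiff_cst w z : cdiff (fun=> w) z.
Proof. exact: (@derivable_cst _ (C^o) (C^o)). Qed.

Lemma cdiffB f g z : cdiff f z -> cdiff g z -> cdiff (fun z => f z - g z) z.
Proof. by move=> df dg; exact: (derivableB df dg). Qed.

Lemma cdiffM f g z : cdiff f z -> cdiff g z -> cdiff (fun z => f z * g z) z.
Proof. by move=> df dg; exact: (derivableM df dg). Qed.

Lemma cdiffV f z : f z != 0 -> cdiff f z -> cdiff (fun z => (f z)^-1) z.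
Proof. by move=> f0 df; exact: (@derivableV _ _ (f : C^o -> C^o) z 1 f0 df). Qed.

Lemma cdiffX f k z : cdiff f z -> cdiff (fun z => f z ^+ k) z.
Proof.
move=> d; elim: k => [|k IH].
  have -> : (fun z => f z ^+ 0) = (fun=> 1) by apply/funext => y; rewrite expr0.
  exact: cdiff_cst.
have -> : (fun z => f z ^+ k.+1) = (fun z => f z * f z ^+ k).
  by apply/funext => y; rewrite exprS.
exact: cdiffM.
Qed.

Lemma cdiff_invX k z : z != 0 -> cdiff (fun z => z^-1 ^+ k) z.
Proof. by move=> z0; apply: cdiffX; apply: cdiffV => //; exact: cdiff_id. Qed.

Lemma cdiff_cderiv g z : cdiff g z -> exists l, cderiv g z l.
Proof. by move=> d; exists ('D_1 (g : C^o -> C^o) z); exact: is_derive_cderiv. Qed.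

Lemma cdiff_cont g z : cdiff g z -> forall e : R, 0 < e ->
  exists2 r : R, 0 < r & forall w, cmod (w - z) < r -> cmod (g w - g z) < e.
Proof. by move=> /cdiff_cderiv[l hl]; exact: cderiv_cont hl. Qed.

Lemma cdiff_circ f s : (forall z, cmod z = expR s -> cdiff f z) ->
  ccontinuous (fun t => f (cexp s t)).
Proof.
move=> H; apply: ccontinuous_eps => y e e0.
have [r r0 hr] := cdiff_cont (H (cexp s y) (cmod_cexp _ _)) e0.
have [q q0 hq] := cexp_cont s y r0.
by exists q => // t ht; apply: hr; apply: hq; rewrite ?subrr ?normr0.
Qed.

Lemma rint_shift (k : R -> R) (h a b : R) : continuous k ->
  rint (fun x => k (x + h)) a b = rint k (a + h) (b + h).
Proof.
move=> ck.
have D x : is_derive x (1 : R) (fun x : R => antideriv k (x + h)) (k (x + h)).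
  have D1 : is_derive x (1 : R) (fun x : R => x + h) 1.
    by apply: is_derive_eq; rewrite addr0.
  have := @is_derive1_comp _ (antideriv k) (fun x => x + h) x _ _ (antiderivP ck (x + h)) D1.
  by rewrite mulr1.
by rewrite (rintE _ _ D).
Qed.

Lemma cint_shift (F : R -> C) (h a b : R) : ccontinuous F ->
  cint (fun x => F (x + h)) a b = cint F (a + h) (b + h).
Proof.
by move=> [c1 c2]; rewrite /cint; congr (_ +i* _);
  [exact: (rint_shift h a b c1)|exact: (rint_shift h a b c2)].
Qed.

Lemma cint_antiperiodic (F : R -> C) (h : R) : ccontinuous F ->
  (forall t, F (t + pi) = F (t - pi)) -> (forall t, F (t + h) = (-1) * F t) ->
  cint F (- pi) pi = 0.
Proof.
move=> cF pF hF.
have E : cint (fun t => F (t + h)) (- pi) pi = cint F (- pi) pi.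
  by rewrite -(cint_period h cF pF) cint_shift // [- pi + _]addrC [pi + _]addrC.
have {E} : cint (fun t => -1 * F t) (- pi) pi = cint F (- pi) pi.
  by rewrite -E; congr (cint _ _ _); apply/funext => t; rewrite hF.
rewrite cintZ // => E.
have : 2 * cint F (- pi) pi = 0.
  by rewrite mulr2n mulrDl mul1r -{1}E mulN1r addNr.
by move/eqP; rewrite mulf_eq0 pnatr_eq0 /= => /eqP.
Qed.

(** Rotation by [pi / k] multiplies [z^-k] by -1 but preserves the circle integral, so the latter
    vanishes. *)
Lemma circ_intVX k s : (0 < k)%N -> circ_int (fun z => z^-1 ^+ k) s = 0.
Proof.
move=> k0; have kR : (k%:R : R) != 0 by rewrite pnatr_eq0 -lt0n.
have cX (t : R) j : cexp 0 t ^+ j = cexp 0 (t * j%:R).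
  elim: j => [|j IH]; first by rewrite mulr0 cexp00.
  by rewrite exprS IH -cexpD addr0 mulrS mulrDr mulr1.
apply: (@cint_antiperiodic _ (pi / k%:R)).
- apply: (@cdiff_circ (fun z => z^-1 ^+ k)) => z hz.
  have z0 : z != 0 by rewrite -cmod_eq0 hz gt_eqF // expR_gt0.
  exact: cdiff_invX.
- by move=> t; rewrite cexp_periodic.
move=> t; have -> : cexp s (t + pi / k%:R) = cexp s t * cexp 0 (pi / k%:R).
  by rewrite -cexpD addr0.
rewrite invfM exprMn mulrC; congr (_ * _).
rewrite exprVn cX divfK // /cexp expR0 cospi sinpi !mul1r.
have -> : (-1) +i* 0 = -1 :> C by apply/eqP; rewrite eq_complex /= oppr0 !eqxx.
by rewrite invrN1.
Qed.

Lemma circ_int1 s : circ_int (fun=> 1 : C) s = (2 * pi)%:C.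
Proof.
have D1 x : is_derive x (1 : R) (fun x : R => complex.Re (x +i* 0)) (complex.Re (1 : C)).
  exact: is_derive_id.
have D2 x : is_derive x (1 : R) (fun x : R => complex.Im (x +i* 0)) (complex.Im (1 : C)).
  exact: is_derive_cst.
rewrite /circ_int (@cintE _ (fun x => x +i* 0) _ _ _ D1 D2).
by apply/eqP; rewrite eq_complex /= subr0 eqxx andbT; apply/eqP; ring.
Qed.

(** With [dt] in place of [dz], the exponent of Cauchy's formula is [k] and not [k + 1].
    Independence of the radius is never established: the remainder bound is used at one fixed radius
    at a time. *)
Definition cauchy_coef g s k : C := circ_int (fun z => g z * z^-1 ^+ k) s / (2 * pi)%:C.

(** The function [(g z - g w) / (z - w) * z] vanishes at 0, so its circle integral is 0. Expanding
    [z / (z - w)] as a finite geometric sum in [w / z] turns this into Taylor's formula, whose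
    remainder is bounded through [|w / z| <= 1 / 2] and [|z / (z - w)| <= 2]. *)
Lemma cauchy_estimate g (M s : R) N w : entire g ->
  (forall z, cmod z <= expR s -> cmod (g z) <= M) -> cmod w <= expR s / 2 ->
  cmod (g w - \sum_(k < N) cauchy_coef g s k * w ^+ k) <= 8 * M / 2 ^+ N.
Proof.
move=> eg HM hw; have E0 := expR_gt0 s; have p0 := pi_gt0 R.
have ws : cmod w < expR s by lra.
have M0 : 0 <= M by apply: le_trans (cmod_ge0 _) (HM 0 _); rewrite cmod0 ltW.
have [l hl] := cdiff_cderiv (eg w).
(* The value at [w] is the limit of the quotient, which makes [f] continuous there. *)
pose f z := if z == w then l * w else (g z - g w) / (z - w) * z.
have df z : z != w -> cdiff f z.
  move=> zw; have D : cdiff (fun z => (g z - g w) / (z - w) * z) z.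
    apply: cdiffM; last exact: cdiff_id.
    apply: cdiffM.
      by apply: cdiffB; [exact: eg|exact: cdiff_cst].
    apply: cdiffV; first by rewrite subr_eq0.
    by apply: cdiffB; [exact: cdiff_id|exact: cdiff_cst].
  apply: near_eq_derivable D.
  have zw0 : 0 < `|z - w| by rewrite normr_gt0 subr_eq0.
  apply/(@nbhs_ballP _ (C^o)); exists `|z - w| => //= y; rewrite /ball /= => zy.
  by rewrite /f ifN //; apply: contraTneq zy => ->; rewrite ltxx.
have cf : ccont f.
  move=> z e e0; have [->|zw] := eqVneq z w; last exact: cdiff_cont (df _ zw) _ e0.
  have e1 : 0 < Num.min 1 (e / (2 * (cmod w + 1))).
    by rewrite lt_min ltr01 divr_gt0 // mulr_gt0 // ltr_wpDl ?cmod_ge0.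
  have [r r0 hr] := hl _ e1.
  pose e2 := Num.min r (e / (2 * (cmod l + 1))).
  have l0 := cmod_ge0 l; have w0 := cmod_ge0 w.
  have e20 : 0 < e2 by rewrite lt_min r0 divr_gt0 //; lra.
  exists (Num.min e2 (e / (2 * (cmod l + 2)))); first by rewrite lt_min e20 divr_gt0 //; lra.
  move=> z'; have [->|zw'] := eqVneq z' w; first by rewrite !subrr cmod0.
  rewrite /f eqxx ifN // !lt_min => /andP[/andP[h1 h2] h3].
  have := hr z' h1.
  have d0 : 0 < cmod (z' - w).
    by rewrite cmod_gt0 subr_eq0.
  set q := (g z' - g w) / (z' - w).
  have -> : g z' - g w - l * (z' - w) = (q - l) * (z' - w).
    by rewrite /q; field; rewrite subr_eq0.
  rewrite cmodM ler_pM2r // le_min => /andP[q1 q2].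
  have -> : q * z' - l * w = (q - l) * w + (q - l) * (z' - w) + l * (z' - w) by ring.
  move: h3; rewrite ltr_pdivlMr; last lra.
  move: q2; rewrite ler_pdivlMr; last lra.
  have := cmodD ((q - l) * w + (q - l) * (z' - w)) (l * (z' - w)).
  have := cmodD ((q - l) * w) ((q - l) * (z' - w)).
  rewrite !cmodM; have := cmod_ge0 (q - l); nra.
have f0 : f 0 = 0.
  by rewrite /f; case: eqVneq => [<-|_]; rewrite mulr0.
have Z : circ_int f s = 0.
  apply: (circ_int_eq0 cf f0 (w := w)) => // z zw.
  exact: cdiff_cderiv (df _ zw).
have ne0 z : cmod z = expR s -> z != 0 by move=> hz; rewrite -cmod_eq0 hz gt_eqF.
have new z : cmod z = expR s -> z - w != 0.
  by move=> hz; rewrite subr_eq0; apply: contraTneq ws => <-; rewrite hz ltxx.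
have dV k z : cmod z = expR s -> cdiff (fun z => z^-1 ^+ k) z.
  by move=> /ne0; exact: cdiff_invX.
pose rem z := (g z - g w) * ((w / z) ^+ N * (z / (z - w))).
have cg k : ccontinuous (fun t => g (cexp s t) * (cexp s t)^-1 ^+ k).
  apply: (@cdiff_circ (fun z => g z * z^-1 ^+ k)) => z hz.
  by apply: cdiffM; [exact: eg|exact: dV].
have cV k : ccontinuous (fun t => (cexp s t)^-1 ^+ k).
  by apply: (@cdiff_circ (fun z => z^-1 ^+ k)) => z hz; exact: dV.
have crem : ccontinuous (fun t => rem (cexp s t)).
  apply: cdiff_circ => z hz; apply: cdiffM.
    by apply: cdiffB; [exact: eg|exact: cdiff_cst].
  apply: cdiffM.
    apply: (@cdiffX (fun z => w / z)); apply: cdiffM; first exact: cdiff_cst.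
    by apply: cdiffV; [exact: ne0|exact: cdiff_id].
  apply: cdiffM; first exact: cdiff_id.
  apply: cdiffV; first exact: new.
  by apply: cdiffB; [exact: cdiff_id|exact: cdiff_cst].
pose h k t := w ^+ k * (g (cexp s t) * (cexp s t)^-1 ^+ k + (- g w) * (cexp s t)^-1 ^+ k).
have ch k : ccontinuous (h k).
  by apply: ccontinuousZ; apply: ccontinuousD => //; exact: ccontinuousZ.
have fE t : f (cexp s t) = \sum_(k < N) h k t + rem (cexp s t).
  have hz := cmod_cexp s t; set z := cexp s t in hz *.
  have z0 := ne0 z hz; have zw := new z hz.
  rewrite /f ifN; last by rewrite -subr_eq0.
  have -> : \sum_(k < N) h k t = (g z - g w) * \sum_(k < N) (w / z) ^+ k.
    rewrite mulr_sumr; apply: eq_bigr => k _; rewrite /h -/z exprMn; ring.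
  rewrite /rem -mulrDr -mulrA; congr (_ * _).
  have x1 : 1 - w / z != 0.
    by rewrite -(mulfV z0) -mulrBl mulf_neq0 ?invr_neq0.
  have -> : \sum_(k < N) (w / z) ^+ k = (1 - (w / z) ^+ N) / (1 - w / z).
    apply: (canRL (mulfK x1)).
    by rewrite mulrC -opprB mulNr -subrX1 opprB.
  have -> : z / (z - w) = (1 - w / z)^-1 by field; rewrite zw z0.
  by rewrite [_^-1 * z]mulrC -mulrDl subrK mul1r; field; rewrite ?x1 ?zw ?z0.
have csum n : ccontinuous (fun t => \sum_(k < n) h k t) /\
    cint (fun t => \sum_(k < n) h k t) (- pi) pi = \sum_(k < n) cint (h k) (- pi) pi.
  elim: n => [|n [IH1 IH2]].
    have -> : (fun t => \sum_(k < 0) h k t) = (fun t => 0 * h 0%N t).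
      by apply/funext => t; rewrite big_ord0 mul0r.
    by split; [exact: ccontinuousZ|rewrite cintZ // mul0r big_ord0].
  have -> : (fun t => \sum_(k < n.+1) h k t) = (fun t => \sum_(k < n) h k t + h n t).
    by apply/funext => t; rewrite big_ord_recr.
  by split; [exact: ccontinuousD|rewrite cintD // IH2 big_ord_recr].
have P0 : ((2 * pi)%:C : C) != 0.
  by rewrite (inj_eq (@complexI R)) mulf_neq0 ?gt_eqF.
(* The part of [h k] containing [- g w] integrates to 0 unless [k = 0], where it produces the term
   [g w] of Taylor's formula. *)
have hE k : cint (h k) (- pi) pi = (2 * pi)%:C * (cauchy_coef g s k * w ^+ k)
    - (k == 0)%:R * ((2 * pi)%:C * g w).
  rewrite /h cintZ; last by apply: ccontinuousD => //; exact: ccontinuousZ.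
  rewrite cintD //; last exact: ccontinuousZ.
  rewrite cintZ // /cauchy_coef -/(circ_int (fun z => z^-1 ^+ k) s).
  rewrite -/(circ_int (fun z => g z * z^-1 ^+ k) s).
  set I := circ_int _ _; case: k @I => [|k] I; last first.
    by rewrite circ_intVX //= mulr0 addr0 mul0r subr0 mulrCA mulrA divfK // mulrC.
  have -> : circ_int (fun z => z^-1 ^+ 0) s = (2 * pi)%:C by exact: circ_int1.
  by rewrite expr0 eqxx /= mulr1 !mul1r [X in _ = X - _]mulrC divfK // mulNr [g w * _]mulrC.
(* For [N = 0] the summand that produces [g w] is absent; the claim is then the bound on [g]
   itself. *)
case: N => [|N] in rem crem fE *.
  rewrite big_ord0 subr0 expr0 divr1; have := HM w; have := cmod_ge0 w; lra.
have B : cmod (circ_int rem s) <= 4 * pi * (2 * M * ((1 / 2) ^+ N.+1 * 2)).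
  apply: circ_int_bound => // z hz; rewrite /rem !cmodM.
  apply: ler_pM; rewrite ?mulr_ge0 ?cmod_ge0 //.
    have := cmodB (g z) (g w); have := HM z; have := HM w; rewrite hz.
    have : cmod w <= expR s by lra.
    by move=> -> /(_ isT) ? /(_ (lexx _)) ? ?; lra.
  apply: ler_pM; rewrite ?mulr_ge0 ?cmod_ge0 //.
    rewrite cmodX; apply: lerXn2r; rewrite ?nnegrE ?cmod_ge0 //.
    by rewrite cmodM cmodV hz ler_pdivrMr //; lra.
  rewrite cmodV hz ler_pdivrMr ?cmod_gt0 ?new //.
  by have := cmod_ge_sub z w; rewrite hz; lra.
move: Z; rewrite /circ_int (_ : (fun t => f (cexp s t)) =
    (fun t => \sum_(k < N.+1) h k t + rem (cexp s t))); last exact/funext.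
rewrite cintD //; last exact: (csum N.+1).1.
rewrite (csum N.+1).2 (eq_bigr _ (fun (k : 'I_N.+1) _ => hE k)) sumrB.
rewrite -mulr_sumr [X in _ - X]big_ord_recl [X in _ - (_ + X)]big1 ?eqxx ?mul1r ?addr0; last first.
  by move=> i _; rewrite lift0 mul0r.
rewrite -mulrBr -/(circ_int rem s).
set S := \sum_(k < N.+1) _ => Z.
have E : (2 * pi)%:C * (g w - S) = circ_int rem s.
  by apply/eqP; rewrite -subr_eq0 -oppr_eq0 -Z; apply/eqP; ring.
have pp0 : 0 < 2 * pi :> R by rewrite mulr_gt0.
move: B; rewrite -E cmodM cmod_real (gtr0_norm pp0) -ler_pdivlMl //.
move/le_trans; apply; rewrite expr_div_n expr1n le_eqVlt; apply/orP; left; apply/eqP.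
have pn : pi != 0 :> R by rewrite gt_eqF.
have en : (2 : R) ^+ N != 0 by rewrite expf_neq0 ?pnatr_eq0.
move: pn; rewrite exprS; generalize (pi : R) => p pn.
by field; rewrite pn en.
Qed.

End CauchyEstimate.

(** * Unordered sums *)

Section ComplexSequences.
Variable R : realType.
Local Notation C := (R[i]).

Lemma real_cauchy_lim (u : nat -> R) :
  (forall e, 0 < e -> exists n0, forall m n, (n0 <= m)%N -> (n0 <= n)%N -> `|u m - u n| < e) ->
  exists l, forall e, 0 < e -> exists n0, forall n, (n0 <= n)%N -> `|u n - l| < e.
Proof.
move=> H; have cu : cvg (u @ \oo).
  apply/cauchy_cvgP/cauchyP => e e0.
  have [n0 hn0] := H e e0.
  exists (u n0); exists n0 => //= n hn; rewrite /ball /=; exact: hn0.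
move/cvg_ex : cu => [l /cvgrPdist_lt hl]; exists l => e e0.
have [n0 _ hn0] := hl e e0; exists n0 => n hn.
by rewrite distrC; exact: hn0.
Qed.

Lemma complex_cauchy_lim (z : nat -> C) :
  (forall e : R, 0 < e -> exists n0, forall m n, (n0 <= m)%N -> (n0 <= n)%N -> cmod (z m - z n) < e) ->
  exists l, forall e : R, 0 < e -> exists n0, forall n, (n0 <= n)%N -> cmod (z n - l) < e.
Proof.
move=> H.
have [|a ha] := @real_cauchy_lim (fun n => complex.Re (z n)).
  move=> e e0; have [n0 hn0] := H e e0; exists n0 => m n hm hn.
  apply: le_lt_trans (hn0 m n hm hn).
  by have := Re_le_cmod (z m - z n); rewrite raddfB.
have [|b hb] := @real_cauchy_lim (fun n => complex.Im (z n)).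
  move=> e e0; have [n0 hn0] := H e e0; exists n0 => m n hm hn.
  apply: le_lt_trans (hn0 m n hm hn).
  by have := Im_le_cmod (z m - z n); rewrite raddfB.
exists (a +i* b) => e e0; have e2 : 0 < e / 2 by lra.
have [n1 h1] := ha _ e2; have [n2 h2] := hb _ e2.
exists (maxn n1 n2) => n; rewrite geq_max => /andP[/h1 l1 /h2 l2].
apply: le_lt_trans (cmod_le_ReIm _) _.
by rewrite !raddfB /=; lra.
Qed.

End ComplexSequences.

Section UnorderedSums.
Variables (R : realType) (T : eqType).
Local Notation C := (R[i]).
Implicit Types (u v : T -> C) (s t : seq T) (w : T -> R).

(** Unconditional summation along the net of finite sets, represented by duplicate-free lists; it
    requires no enumeration of the index type and is invariant under reindexing. *)
Definition csum u (l : C) := forall e : R, 0 < e -> exists s0 : seq T,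
  forall s, uniq s -> {subset s0 <= s} -> cmod (l - \sum_(x <- s) u x) < e.

Lemma psummable_tail w : (forall x, 0 <= w x) -> psummable w ->
  forall e : R, 0 < e -> exists2 s0 : seq T, uniq s0 &
  forall s, uniq s -> (forall x, x \in s -> x \notin s0) -> \sum_(x <- s) w x < e.
Proof.
move=> w0 [B HB] e e0.
pose A := [set y | exists2 s : seq T, uniq s & y = \sum_(x <- s) w x].
have supA : has_sup A.
  split; first by exists 0, [::] => //; rewrite big_nil.
  by exists B => _ [s us ->]; exact: HB.
have [_ [s0 us0 ->] h0] := sup_adherent e0 supA.
exists s0 => // s us dis.
have : \sum_(x <- s0 ++ s) w x <= sup A.
  apply: ub_le_sup; first by case: supA.
  exists (s0 ++ s) => //; rewrite cat_uniq us0 us andbT /=.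
  by apply/hasPn => x /dis.
by rewrite big_cat /=; lra.
Qed.

Lemma sum_seq_sub_split (V : zmodType) (f : T -> V) s0 s : uniq s0 -> uniq s ->
  {subset s0 <= s} ->
  \sum_(x <- s) f x = \sum_(x <- s0) f x + \sum_(x <- [seq x <- s | x \notin s0]) f x.
Proof.
move=> us0 us sub; rewrite -big_cat /=; apply: perm_big; apply: uniq_perm => //.
  rewrite cat_uniq us0 filter_uniq // andbT /=; apply/hasPn => x.
  by rewrite mem_filter => /andP[].
move=> x; rewrite mem_cat mem_filter; case: (boolP (x \in s0)) => //= xs0.
by rewrite sub.
Qed.

(** Finite sets [S k], outside of which all finite sums of moduli are below [1 / (k + 1)], give a
    Cauchy sequence of partial sums; its limit is the limit of the whole net. *)
Lemma csum_ex u : psummable (fun x => cmod (u x)) -> exists l, csum u l.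
Proof.
move=> su; have tl := psummable_tail (fun x => cmod_ge0 (u x)) su.
have /choice[S HS] : forall k : nat, exists s0 : seq T, uniq s0 /\
  forall s, uniq s -> (forall x, x \in s -> x \notin s0) ->
    \sum_(x <- s) cmod (u x) < k.+1%:R^-1.
  move=> k; have [|s0 us0 hs0] := tl (k.+1%:R^-1); first by rewrite invr_gt0.
  by exists s0.
have near_k k s : uniq s -> {subset S k <= s} ->
    cmod (\sum_(x <- s) u x - \sum_(x <- S k) u x) < k.+1%:R^-1.
  move=> us sub; have [usk hk] := HS k.
  rewrite (sum_seq_sub_split u usk us sub) addrC addKr.
  apply: le_lt_trans (cmod_sum _ _ _) _; apply: hk; first exact: filter_uniq.
  by move=> x; rewrite mem_filter => /andP[].
have small (e : R) : 0 < e -> exists n0, forall k, (n0 <= k)%N -> k.+1%:R^-1 < e.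
  move=> e0; exists (Num.truncn e^-1) => k hk.
  rewrite invf_plt ?posrE //; apply: lt_le_trans (truncnS_gt _) _.
  by rewrite ler_nat ltnS.
have [|l hl] := @complex_cauchy_lim R (fun k => \sum_(x <- S k) u x).
  move=> e e0; have [|n0 hn0] := small (e / 2); first lra.
  exists n0 => m n hm hn.
  pose s := undup (S m ++ S n).
  have us : uniq s by exact: undup_uniq.
  apply: le_lt_trans (cmod_triangle _ (\sum_(x <- s) u x) _) _.
  have dC := cmod_distC (\sum_(x <- S m) u x) (\sum_(x <- s) u x).
  have s1 : {subset S m <= s} by move=> x xs; rewrite mem_undup mem_cat xs.
  have s2 : {subset S n <= s} by move=> x xs; rewrite mem_undup mem_cat xs orbT.
  have := near_k m s us s1; have := near_k n s us s2.
  have := hn0 m hm; have := hn0 n hn.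
  by move: (n.+1%:R^-1) (m.+1%:R^-1) => a b; lra.
exists l => e e0; have [|n0 hn0] := small (e / 2); first lra.
have [|n1 hn1] := hl (e / 2); first lra.
pose k := maxn n0 n1; exists (S k) => s us sub.
apply: le_lt_trans (cmod_triangle _ (\sum_(x <- S k) u x) _) _.
have := near_k k s us sub; have := hn1 k (leq_maxr _ _); have := hn0 k (leq_maxl _ _).
move: (k.+1%:R^-1) => a.
have := cmod_distC l (\sum_(x <- S k) u x).
by have := cmod_distC (\sum_(x <- S k) u x) (\sum_(x <- s) u x); lra.
Qed.

Lemma csum_unique u l l' : csum u l -> csum u l' -> l = l'.
Proof.
move=> h h'; apply/eqP; rewrite -subr_eq0; apply/eqP; apply: cmod_eps0 => e e0.
have [|s0 h0] := h (e / 2); first lra.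
have [|s1 h1] := h' (e / 2); first lra.
pose s := undup (s0 ++ s1); have us : uniq s by exact: undup_uniq.
have sb0 : {subset s0 <= s} by move=> x xs; rewrite mem_undup mem_cat xs.
have sb1 : {subset s1 <= s} by move=> x xs; rewrite mem_undup mem_cat xs orbT.
have := h0 s us sb0; have := h1 s us sb1.
have := cmod_distC l' (\sum_(x <- s) u x).
by have := cmod_triangle l (\sum_(x <- s) u x) l'; lra.
Qed.

Lemma csumD u v l m : csum u l -> csum v m -> csum (fun x => u x + v x) (l + m).
Proof.
move=> h h' e e0; have [|s0 h0] := h (e / 2); first lra.
have [|s1 h1] := h' (e / 2); first lra.
exists (s0 ++ s1) => s us sub.
rewrite big_split /=.
have q1 : cmod (m - \sum_(x <- s) v x) < e / 2.
  by apply: h1 => // x xs; apply: sub; rewrite mem_cat xs orbT.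
have q2 : cmod (l - \sum_(x <- s) u x) < e / 2.
  by apply: h0 => // x xs; apply: sub; rewrite mem_cat xs.
have := cmodD (l - \sum_(x <- s) u x) (m - \sum_(x <- s) v x).
by rewrite addrACA -opprD; lra.
Qed.

Lemma csumZ (c : C) u l : csum u l -> csum (fun x => c * u x) (c * l).
Proof.
move=> h e e0; have c0 : 0 < cmod c + 1 by have := cmod_ge0 c; lra.
have [|s0 h0] := h (e / (cmod c + 1)); first by rewrite divr_gt0.
exists s0 => s us sub; rewrite -mulr_sumr -mulrBr cmodM.
have := h0 s us sub; rewrite ltr_pdivlMr // mulrC; apply: le_lt_trans.
by rewrite ler_wpM2r ?cmod_ge0 // lerDl.
Qed.

Lemma csum_bound u l (B : R) : csum u l ->
  (forall s, uniq s -> \sum_(x <- s) cmod (u x) <= B) -> cmod l <= B.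
Proof.
move=> h hB; apply/ler_addgt0Pr => e e0; have [s0 h0] := h e e0.
have us := undup_uniq s0.
have q : cmod (l - \sum_(x <- undup s0) u x) < e by apply: (h0 _ us) => x; rewrite mem_undup.
rewrite -[l in leLHS](subrK (\sum_(x <- undup s0) u x)).
apply: le_trans (cmodD _ _) _; rewrite addrC lerD ?(ltW q) //.
by apply: le_trans (cmod_sum _ _ _) _; exact: hB.
Qed.

Lemma eq_csum u v l : u =1 v -> csum u l -> csum v l.
Proof. by move=> /funext ->. Qed.

Lemma csum_finite u (s : seq T) : uniq s -> (forall x, x \notin s -> u x = 0) ->
  csum u (\sum_(x <- s) u x).
Proof.
move=> us u0 e e0; exists s => t ut sub.
have r0 : \sum_(x <- [seq x <- t | x \notin s]) u x = 0.
  by apply: big1_seq => x /andP[_]; rewrite mem_filter => /andP[/u0].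
by rewrite (sum_seq_sub_split u us ut sub) r0 addr0 subrr cmod0.
Qed.

(** The remainder is itself the sum of the series in which the terms in [s0] are replaced by 0, so
    [csum_bound] applies. *)
Lemma csum_tail u l (B : R) s0 : csum u l -> uniq s0 ->
  (forall s, uniq s -> (forall x, x \in s -> x \notin s0) -> \sum_(x <- s) cmod (u x) <= B) ->
  cmod (l - \sum_(x <- s0) u x) <= B.
Proof.
move=> h us0 hB.
have h1 : csum (fun x => u x + (-1) * (if x \in s0 then u x else 0)) (l + (-1) * \sum_(x <- s0) u x).
  apply: csumD => //; apply: csumZ.
  have := @csum_finite (fun x => if x \in s0 then u x else 0) s0 us0.
  rewrite (eq_big_seq u); last by move=> x /= ->.
  by apply=> x /negbTE ->.
have -> : l - \sum_(x <- s0) u x = l + (-1) * \sum_(x <- s0) u x by rewrite mulN1r.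
apply: csum_bound h1 _ => s us.
rewrite (bigID (mem s0)) /= big1 ?add0r; last first.
  by move=> x xs; rewrite xs mulN1r subrr cmod0.
rewrite -big_filter; apply: le_trans (hB [seq x <- s | x \notin s0] _ _).
- rewrite le_eqVlt; apply/orP; left; apply/eqP; apply: eq_big_seq => x.
  by rewrite mem_filter => /andP[/negbTE -> _]; rewrite mulr0 addr0.
- exact: filter_uniq.
by move=> x; rewrite mem_filter => /andP[].
Qed.

End UnorderedSums.

Section UnorderedSumReindex.
Variables (R : realType) (T T' : eqType).
Local Notation C := (R[i]).

Lemma csum_reindex (f : T -> T') (g : T' -> T) (u : T' -> C) l : cancel f g -> cancel g f ->
  csum u l -> csum (fun x => u (f x)) l.
Proof.
move=> fg gf h e e0; have [s0 h0] := h e e0; exists (map g s0) => s us sub.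
rewrite -(big_map f xpredT u); apply: h0; first by rewrite map_inj_uniq //; exact: can_inj fg.
by move=> x xs; rewrite -(gf x) map_f // sub // map_f.
Qed.

End UnorderedSumReindex.

Section GeometricSums.
Variables (R : realType) (d : nat).

(** Enlarging [s] to a box turns the sum into a product of [d] geometric sums, each at most 2. Sums
    over multi-indices are made absolute by this bound: estimates are taken at twice the radius,
    which leaves a spare factor [2^-|P|]. *)
Lemma sum_half_pow_msize (s : seq (midx d)) : uniq s ->
  \sum_(P <- s) (2^-1 : R) ^+ msize P <= 2 ^+ d.
Proof.
move=> us; pose N := (\max_(P <- s) \max_(i < d) P i)%N.+1.
have bN P i : P \in s -> (P i < N)%N.
  move=> Ps; rewrite ltnS.
  have h1 := leq_bigmax_seq (F := fun P : midx d => (\max_(i < d) P i)%N) P Ps isT.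
  have h2 : (P i <= \max_(i < d) P i)%N by exact: (leq_bigmax (F := fun i => P i) i).
  exact: leq_trans h2 h1.
pose h (t : {ffun 'I_d -> 'I_N}) : midx d := [ffun i => nat_of_ord (t i)].
have hinj : injective h.
  move=> t t' E; apply/ffunP => i; apply/val_inj.
  by have := congr1 (fun P : midx d => P i) E; rewrite !ffunE.
have sub : {subset s <= map h (enum {: {ffun 'I_d -> 'I_N}})}.
  move=> P Ps; apply/mapP; exists [ffun i => Ordinal (bN P i Ps)]; first by rewrite mem_enum.
  by apply/ffunP => i; rewrite !ffunE.
have uh : uniq (map h (enum {: {ffun 'I_d -> 'I_N}})) by rewrite map_inj_uniq // enum_uniq.
apply: le_trans (_ : \sum_(P <- map h (enum {: {ffun 'I_d -> 'I_N}})) (2^-1 : R) ^+ msize P <= _).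
  rewrite (sum_seq_sub_split _ us uh sub) lerDl; apply: sumr_ge0 => P _.
  by apply: exprn_ge0; rewrite invr_ge0.
rewrite big_map big_enum /=.
have -> : \sum_(t : {ffun 'I_d -> 'I_N}) (2^-1 : R) ^+ msize (h t) =
          \sum_(t : {ffun 'I_d -> 'I_N}) \prod_(i < d) (2^-1 : R) ^+ t i.
  apply: eq_bigr => t _; rewrite prodrXr; congr (_ ^+ _).
  by apply: eq_bigr => i _; rewrite ffunE.
rewrite -(bigA_distr_bigA (fun (i : 'I_d) (j : 'I_N) => (2^-1 : R) ^+ j)) /=.
rewrite prodr_const card_ord; apply: lerXn2r; rewrite ?nnegrE ?sumr_ge0 //.
have E : (1 - 2^-1) * (\sum_(j < N) (2^-1 : R) ^+ j) = 1 - 2^-1 ^+ N.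
  by rewrite -opprB mulNr -subrX1 opprB.
have : 0 <= (2^-1 : R) ^+ N by rewrite exprn_ge0 ?invr_ge0.
lra.
Qed.

End GeometricSums.

(** * Taylor expansion of entire functions of several variables *)

Section RootsOfUnity.
Variable R : realType.
Local Notation C := (R[i]).

Lemma prim_root_exists N : (0 < N)%N -> exists w : C, N.-primitive_root w.
Proof.
move=> N0; have [rs] := closed_field_poly_normal ('X^N - 1 : {poly C}).
rewrite (monicP (monicXnsubC _ N0)) scale1r => E.
have /hasP[w _ pw] : has N.-primitive_root rs; last by exists w.
apply: has_prim_root => //.
- by apply/allP => z; rewrite -root_prod_XsubC -E.
- by rewrite -separable_prod_XsubC -E separable_Xn_sub_1 // pnatr_eq0 -lt0n.
by rewrite -ltnS -(size_prod_XsubC rs id) -E size_XnsubC.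
Qed.

Lemma cmod_prim_root N (w : C) : (0 < N)%N -> N.-primitive_root w -> cmod w = 1.
Proof.
move=> N0 /prim_expr_order E; apply/eqP; rewrite -(pexpr_eq1 N0) ?cmod_ge0 //.
by rewrite -cmodX E cmod1.
Qed.

(** Discrete Fourier orthogonality: for [a <> b] the quotient [w^a / w^b] is an [N]-th root of unity
    other than 1, and its powers sum to 0. *)
Lemma sum_prim_root N (w : C) a b : (0 < N)%N -> N.-primitive_root w -> (a < N)%N -> (b < N)%N ->
  \sum_(j < N) (w ^+ j) ^+ a / (w ^+ j) ^+ b = N%:R * (a == b)%:R.
Proof.
move=> N0 pw aN bN; have w0 : w != 0 by rewrite -cmod_eq0 (cmod_prim_root N0 pw) oner_eq0.
have -> : \sum_(j < N) (w ^+ j) ^+ a / (w ^+ j) ^+ b = \sum_(j < N) (w ^+ a / w ^+ b) ^+ j.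
  by apply: eq_bigr => j _; rewrite expr_div_n -!exprM ![(j * _)%N]mulnC.
set z := w ^+ a / w ^+ b.
have zN : z ^+ N = 1.
  by rewrite /z expr_div_n -!exprM ![(_ * N)%N]mulnC !exprM (prim_expr_order pw) !expr1n divr1.
have z1 : (z == 1) = (a == b).
  rewrite /z -(inj_eq (mulIf (expf_neq0 b w0))) divfK ?expf_neq0 // mul1r.
  by rewrite (eq_prim_root_expr pw) !modn_small.
rewrite -z1; case: eqVneq => [->|zn1].
  by under eq_bigr do rewrite expr1n; rewrite sumr_const card_ord mulr1.
apply: (mulfI (x := z - 1)); first by rewrite subr_eq0.
by rewrite -subrX1 zN subrr !mulr0.
Qed.

End RootsOfUnity.

(** * Polynomials in several variables and their coefficients *)

Section Polynomials.
Variable R : realType.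
Local Notation C := (R[i]).

Definition mpow d (x : 'I_d -> C) (P : midx d) : C := \prod_(i < d) x i ^+ P i.

Definition polydisc d (r : R) (x : 'I_d -> C) := forall i, cmod (x i) <= r.

(** A polynomial is a list of terms in which a multi-index may recur; [pcoef] collects its
    occurrences. *)
Definition peval d (s : seq (C * midx d)) (x : 'I_d -> C) : C := \sum_(p <- s) p.1 * mpow x p.2.

Definition pcoef d (s : seq (C * midx d)) (P : midx d) : C := \sum_(p <- s | p.2 == P) p.1.

Definition is_poly d (f : ('I_d -> C) -> C) := exists s, forall x, f x = peval s x.

Lemma cmod_mpow_le d r (x : 'I_d -> C) P : polydisc r x -> cmod (mpow x P) <= r ^+ msize P.
Proof.
move=> hx; rewrite /mpow cmod_prod /msize -prodrXr; apply: ler_prod => i _.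
rewrite cmod_ge0 cmodX lerXn2r ?nnegrE ?cmod_ge0 //.
exact: le_trans (cmod_ge0 _) (hx i).
Qed.

Lemma peval_pcoef d (s : seq (C * midx d)) S x : uniq S -> {subset map snd s <= S} ->
  peval s x = \sum_(P <- S) pcoef s P * mpow x P.
Proof.
move=> uS sub; rewrite /peval /pcoef.
under [RHS]eq_bigr do rewrite mulr_suml big_mkcond /=.
rewrite exchange_big /= big_seq [RHS]big_seq; apply: eq_bigr => p ps.
rewrite (bigD1_seq p.2) //=; last by apply: sub; exact: map_f.
rewrite eqxx big1 ?addr0 // => Q /negbTE; rewrite eq_sym => -> //.
Qed.

(** The Cauchy estimate with the torus replaced by the grid of [N]-th roots of unity scaled by [r]:
    averaging against inverse powers isolates the coefficient exactly as soon as [N] exceeds all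
    exponents involved, so no multiple integral occurs. *)
Lemma pcoef_bound d (s : seq (C * midx d)) P (r M : R) : 0 <= r ->
  (forall x, polydisc r x -> cmod (peval s x) <= M) -> cmod (pcoef s P) * r ^+ msize P <= M.
Proof.
move=> r0 HM.
pose mx (Q : midx d) := (\max_(i < d) Q i)%N.
pose N := (maxn (mx P) (\max_(p <- s) mx p.2)).+1.
have mxP (Q : midx d) i : (Q i <= mx Q)%N by exact: (leq_bigmax (F := fun i => Q i) i).
have PN i : (P i < N)%N by rewrite ltnS (leq_trans (mxP P i)) // leq_maxl.
have sN p i : p \in s -> (p.2 i < N)%N.
  move=> ps; rewrite ltnS (leq_trans (mxP p.2 i)) // (leq_trans _ (leq_maxr _ _)) //.
  exact: (leq_bigmax_seq (F := fun p : C * midx d => mx p.2) p ps isT).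
have N0 : (0 < N)%N by [].
have [w pw] := prim_root_exists R N0; have w1 := cmod_prim_root N0 pw.
pose pt (t : {ffun 'I_d -> 'I_N}) i : C := r%:C * w ^+ t i.
pose ph (t : {ffun 'I_d -> 'I_N}) : C := \prod_(i < d) ((w ^+ t i) ^+ P i)^-1.
have E : \sum_(t : {ffun 'I_d -> 'I_N}) peval s (pt t) * ph t =
    (N%:R ^+ d) * (pcoef s P * r%:C ^+ msize P).
  rewrite /peval; under eq_bigr do rewrite mulr_suml.
  rewrite exchange_big /= /pcoef mulr_suml mulr_sumr [RHS]big_mkcond /=.
  rewrite big_seq [RHS]big_seq; apply: eq_bigr => p ps.
  have -> : \sum_(t : {ffun 'I_d -> 'I_N}) p.1 * mpow (pt t) p.2 * ph t =
      p.1 * \sum_(t : {ffun 'I_d -> 'I_N}) \prod_(i < d)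
        (r%:C ^+ p.2 i * ((w ^+ t i) ^+ p.2 i / (w ^+ t i) ^+ P i)).
    rewrite mulr_sumr; apply: eq_bigr => t _; rewrite -mulrA; congr (_ * _).
    by rewrite /mpow /ph -big_split /=; apply: eq_bigr => i _; rewrite /pt exprMn mulrA.
  rewrite -(bigA_distr_bigA (fun (i : 'I_d) (j : 'I_N) =>
     r%:C ^+ p.2 i * ((w ^+ j) ^+ p.2 i / (w ^+ j) ^+ P i))) /=.
  under eq_bigr => i _ do rewrite -mulr_sumr (sum_prim_root N0 pw (sN p i ps) (PN i)).
  case: eqP => [->|neq].
    under eq_bigr do rewrite eqxx mulr1.
    by rewrite big_split /= prodrXr prodr_const card_ord -/(msize P); ring.
  have [i ni] : exists i, p.2 i != P i.
    apply/existsP; apply: contra_notT neq; rewrite negb_exists => /forallP h.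
    by apply/ffunP => i; apply/eqP; have := h i; rewrite negbK.
  by rewrite (bigD1 i) //= (negbTE ni) !mulr0 mul0r mulr0.
have ND : 0 < (N%:R : R) ^+ d by rewrite exprn_gt0 // ltr0n.
rewrite -(ler_pM2l ND).
have -> : N%:R ^+ d * (cmod (pcoef s P) * r ^+ msize P) =
    cmod (N%:R ^+ d * (pcoef s P * r%:C ^+ msize P)).
  by rewrite !cmodM !cmodX cmod_nat cmod_real ger0_norm.
rewrite -E; apply: le_trans (cmod_sum _ _ _) _.
have -> : N%:R ^+ d * M = \sum_(t : {ffun 'I_d -> 'I_N}) M.
  by rewrite sumr_const card_ffun !card_ord -[in RHS]mulr_natl natrX.
apply: ler_sum => t _; rewrite cmodM /ph cmod_prod big1 ?mulr1; last first.
  by move=> i _; rewrite cmodV !cmodX w1 !expr1n invr1.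
by apply: HM => i; rewrite /pt cmodM cmodX w1 expr1n mulr1 cmod_real ger0_norm.
Qed.

Lemma is_poly0 d : is_poly (fun _ : 'I_d -> C => 0).
Proof. by exists [::] => x; rewrite /peval big_nil. Qed.

Lemma is_polyD d (f g : ('I_d -> C) -> C) : is_poly f -> is_poly g -> is_poly (fun x => f x + g x).
Proof.
by move=> [s hs] [t ht]; exists (s ++ t) => x; rewrite hs ht /peval big_cat.
Qed.

Lemma is_polyZ d (c : C) (f : ('I_d -> C) -> C) : is_poly f -> is_poly (fun x => c * f x).
Proof.
move=> [s hs]; exists [seq (c * p.1, p.2) | p <- s] => x; rewrite hs /peval big_map mulr_sumr.
by apply: eq_bigr => p _ /=; rewrite mulrA.
Qed.

Lemma is_poly_sum d I (r : seq I) (f : I -> ('I_d -> C) -> C) : (forall i, is_poly (f i)) ->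
  is_poly (fun x => \sum_(i <- r) f i x).
Proof.
move=> hf; elim: r => [|i r IH].
  have -> : (fun x => \sum_(i <- [::]) f i x) = (fun=> 0) by apply/funext => x; rewrite big_nil.
  exact: is_poly0.
have -> : (fun x => \sum_(i <- i :: r) f i x) = (fun x => f i x + \sum_(i <- r) f i x).
  by apply/funext => x; rewrite big_cons.
exact: is_polyD.
Qed.

Definition pcons d (w : C) (x : 'I_d -> C) : 'I_d.+1 -> C :=
  fun i => if unlift ord0 i is Some j then x j else w.
Definition mcons d k (P : midx d) : midx d.+1 :=
  [ffun i => if unlift ord0 i is Some j then P j else k].

Lemma mpow_cons d w (x : 'I_d -> C) k P : mpow (pcons w x) (mcons k P) = w ^+ k * mpow x P.
Proof.
rewrite /mpow big_ord_recl /pcons ffunE unlift_none; congr (_ * _).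
by apply: eq_bigr => i _; rewrite ffunE liftK.
Qed.

Lemma pcons_tail d (x : 'I_d.+1 -> C) : pcons (x ord0) (fun i => x (lift ord0 i)) = x.
Proof. by apply/funext => i; rewrite /pcons; case: unliftP => [j|] ->. Qed.

Lemma is_poly_cons d k (s : seq (C * midx d)) :
  is_poly (fun x : 'I_d.+1 -> C => x ord0 ^+ k * peval s (fun i => x (lift ord0 i))).
Proof.
exists [seq (p.1, mcons k p.2) | p <- s] => x.
rewrite -{3}(pcons_tail x) /peval big_map mulr_sumr; apply: eq_bigr => p _ /=.
by rewrite mpow_cons mulrCA.
Qed.

End Polynomials.

Section SeveralVariables.
Variable R : realType.
Local Notation C := (R[i]).

Definition upd d (x : 'I_d -> C) (i : 'I_d) (w : C) : 'I_d -> C :=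
  fun j => if j == i then w else x j.

(** Holomorphy in each variable separately, together with local boundedness, is the input of the
    expansion; local boundedness comes from compactness later on, which avoids Hartogs' theorem. *)
Definition sep_entire d (F : ('I_d -> C) -> C) := forall x i, entire (fun w => F (upd x i w)).

Definition locally_bounded d (F : ('I_d -> C) -> C) :=
  forall r : R, exists M, forall x, polydisc r x -> cmod (F x) <= M.

Lemma sep_entire_cons0 d (F : ('I_d.+1 -> C) -> C) x : sep_entire F ->
  entire (fun w => F (pcons w x)).
Proof.
move=> /(_ (pcons 0 x) ord0); congr entire; apply/funext => w; congr F.
apply/funext => i; rewrite /upd /pcons; case: unliftP => [j|] -> //.
Qed.

Lemma sep_entire_cons d (F : ('I_d.+1 -> C) -> C) w : sep_entire F ->
  sep_entire (fun x => F (pcons w x)).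
Proof.
move=> hF x i; have := hF (pcons w x) (lift ord0 i); congr entire; apply/funext => v; congr F.
apply/funext => j; rewrite /upd /pcons; case: unliftP => [k|] -> //.
Qed.

Lemma polydisc_cons d r w (x : 'I_d -> C) : cmod w <= r -> polydisc r x -> polydisc r (pcons w x).
Proof. by move=> hw hx i; rewrite /pcons; case: unliftP. Qed.

(* The nodes are the [N]-th roots of unity scaled to radius [2 r]. *)
Lemma interpolation N (r : R) : 0 < r -> (0 < N)%N ->
  exists2 z : 'I_N -> C, (forall j, cmod (z j) = 2 * r) &
  exists c : 'I_N -> 'I_N -> C,
    (forall (a : 'I_N -> C) w,
       \sum_(j < N) (\sum_(k < N) c j k * w ^+ k) * (\sum_(m < N) a m * z j ^+ m)
       = \sum_(m < N) a m * w ^+ m) /\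
    (forall (h : 'I_N -> C) (e : R) w, cmod w <= r -> (forall j, cmod (h j) <= e) ->
       cmod (\sum_(j < N) (\sum_(k < N) c j k * w ^+ k) * h j) <= 2 * e).
Proof.
move=> r0 N0; have [w0 pw] := prim_root_exists R N0; have w1 := cmod_prim_root N0 pw.
have r20 : 0 < 2 * r by rewrite mulr_gt0.
pose z (j : 'I_N) : C := (2 * r)%:C * w0 ^+ j.
have zN (j : 'I_N) : cmod (z j) = 2 * r.
  by rewrite /z cmodM cmodX w1 expr1n mulr1 cmod_real gtr0_norm.
(* The coefficients of the inverse discrete Fourier transform. For [|w| <= r] each interpolation
   weight is at most [2 / N], since the nodes have modulus [2 r]. *)
exists z => //; exists (fun j k => (N%:R * z j ^+ k)^-1); split.
  have rC0 : ((2 * r)%:C : C) != 0 by rewrite -cmod_eq0 cmod_real normr_eq0 gt_eqF.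
  have NC : (N%:R : C) != 0 by rewrite pnatr_eq0 -lt0n.
  move=> a w; transitivity (\sum_(m < N) \sum_(k < N) a m * w ^+ k *
      (\sum_(j < N) (N%:R * z j ^+ k)^-1 * z j ^+ m)).
    under eq_bigr do rewrite mulr_suml; rewrite exchange_big /=.
    under eq_bigr do under eq_bigr do rewrite mulr_sumr.
    under eq_bigr do rewrite exchange_big /=.
    rewrite exchange_big /=; apply: eq_bigr => m _; apply: eq_bigr => k _.
    by rewrite mulr_sumr; apply: eq_bigr => j _; ring.
  apply: eq_bigr => m _.
  have E (k : 'I_N) : \sum_(j < N) (N%:R * z j ^+ k)^-1 * z j ^+ m = (k == m)%:R.
    transitivity ((2 * r)%:C ^+ m / (N%:R * (2 * r)%:C ^+ k) *
        \sum_(j < N) (w0 ^+ j) ^+ m / (w0 ^+ j) ^+ k).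
      rewrite mulr_sumr; apply: eq_bigr => j _; rewrite /z !exprMn !invfM; ring.
    rewrite (sum_prim_root N0 pw) // eq_sym -val_eqE /=; case: eqP => [->|_]; last by rewrite !mulr0.
    by rewrite mulr1 invfM mulrCA mulfV ?expf_neq0 // mulr1 mulVf.
  under eq_bigr do rewrite E.
  rewrite (bigD1 m) //= eqxx mulr1 big1 ?addr0 // => k /negbTE.
  by rewrite -val_eqE /= => ->; rewrite mulr0.
move=> h e w hw he; have e0 : 0 <= e by apply: le_trans (cmod_ge0 _) (he (Ordinal N0)).
have NR : 0 < (N%:R : R) by rewrite ltr0n.
have B (j : 'I_N) : cmod ((\sum_(k < N) (N%:R * z j ^+ k)^-1 * w ^+ k) * h j) <= N%:R^-1 * (2 * e).
  rewrite cmodM [2 * e]mulrC mulrA mulrAC; apply: ler_pM; rewrite ?cmod_ge0 //.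
  apply: le_trans (cmod_sum _ _ _) _.
  apply: le_trans (_ : \sum_(k < N) N%:R^-1 * 2^-1 ^+ k <= _).
    apply: ler_sum => k _; rewrite cmodM cmodV cmodM !cmodX cmod_nat zN invfM -mulrA.
    rewrite ler_pM2l ?invr_gt0 // -exprVn -exprMn lerXn2r ?nnegrE ?invr_ge0 //.
      by rewrite mulr_ge0 ?cmod_ge0 // invr_ge0 ltW.
    rewrite invfM -mulrA ler_piMr ?invr_ge0 // mulrC ler_pdivrMr ?mul1r //.
  rewrite -mulr_sumr ler_pM2l ?invr_gt0 //.
  have E : (1 - 2^-1) * (\sum_(j < N) (2^-1 : R) ^+ j) = 1 - 2^-1 ^+ N.
    by rewrite -opprB mulNr -subrX1 opprB.
  have : 0 <= (2^-1 : R) ^+ N by rewrite exprn_ge0 ?invr_ge0.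
  lra.
apply: le_trans (cmod_sum _ _ _) _; apply: le_trans (ler_sum _ (fun j _ => B j)) _.
by rewrite sumr_const card_ord -[_ *+ N]mulr_natl mulrA mulfV ?mul1r // gt_eqF.
Qed.

(** Induction on the number of variables. In the first variable [F] is close to a Taylor polynomial,
    which is recovered from its values at finitely many nodes; at each node the remaining variables
    are handled by induction. The interpolation weights have total size at most 2, whatever the
    number of nodes, so the errors are not amplified. *)
Theorem polydisc_approx d (F : ('I_d -> C) -> C) : sep_entire F -> locally_bounded F ->
  forall r e : R, 0 < r -> 0 < e -> exists s, forall x, polydisc r x -> cmod (F x - peval s x) <= e.
Proof.
elim: d F => [|d IH] F eF bF r e r0 e0.
  exists [:: (F (fun=> 0), [ffun=> 0%N])] => x _; rewrite /peval big_seq1 /mpow big_ord0 mulr1 /=.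
  have -> : x = (fun=> 0) by apply/funext => -[].
  by rewrite subrr cmod0 ltW.
(* The Taylor estimate holds up to half the radius and has to reach the nodes, of modulus [2 r]. *)
have [M0 hM0] := bF (4 * r); pose M := M0 + 1.
have M00 : 0 <= M0.
  by apply: le_trans (cmod_ge0 _) (hM0 (fun=> 0) _) => i; rewrite cmod0 mulr_ge0 // ltW.
have hM x : polydisc (4 * r) x -> cmod (F x) <= M.
  by move=> /hM0; rewrite /M; lra.
have Mp : 0 < M by rewrite /M; lra.
have [N hN] : exists N : nat, 8 * M / (e / 6) < N%:R.
  by exists (Num.truncn (8 * M / (e / 6))).+1; rewrite truncnS_gt.
have N0 : (0 < N)%N.
  rewrite -(ltr0n R); apply: lt_trans hN; rewrite !(mulr_gt0, divr_gt0, invr_gt0) //; lra.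
have hN2 : 8 * M / 2 ^+ N <= e / 6.
  rewrite ler_pdivrMr ?exprn_gt0 // [X in _ <= X]mulrC -ler_pdivrMr; last lra.
  apply: le_trans (ltW hN) _; rewrite -natrX ler_nat ltnW // ltn_expl //.
have [z hz [c [c1 c2]]] := interpolation r0 N0.
have e4 : 0 < e / 4 by lra.
have /choice[s hs] : forall j : 'I_N, exists s, forall x, polydisc r x ->
    cmod (F (pcons (z j) x) - peval s x) <= e / 4.
  move=> j; apply: IH => //; first exact: sep_entire_cons.
  move=> r'; have [M' hM'] := bF (Num.max r' (2 * r)); exists M' => x hx; apply: hM'.
  apply: polydisc_cons; first by rewrite hz le_max lexx orbT.
  by move=> i; rewrite le_max hx.
have [t ht] : is_poly (fun x : 'I_d.+1 -> C => \sum_(j < N) (\sum_(k < N) c j k * x ord0 ^+ k) *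
    peval (s j) (fun i => x (lift ord0 i))).
  apply: is_poly_sum => j.
  have -> : (fun x : 'I_d.+1 -> C => (\sum_(k < N) c j k * x ord0 ^+ k) *
      peval (s j) (fun i => x (lift ord0 i))) =
      (fun x => \sum_(k < N) c j k * (x ord0 ^+ k * peval (s j) (fun i => x (lift ord0 i)))).
    by apply/funext => x; rewrite mulr_suml; apply: eq_bigr => k _; rewrite mulrA.
  by apply: is_poly_sum => k; apply: is_polyZ; exact: is_poly_cons.
exists t => x hx; rewrite -ht.
set x0 := x ord0; pose x' i := x (lift ord0 i).
have hx' : polydisc r x' by move=> i; exact: hx.
pose g w := F (pcons w x').
have xE : F x = g x0 by rewrite /g /x0 /x' pcons_tail.
have eg : entire g by exact: sep_entire_cons0.
have ln4 : expR (ln (4 * r)) = 4 * r by rewrite lnK // posrE mulr_gt0.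
pose a k := cauchy_coef g (ln (4 * r)) k.
have hT w : cmod w <= 2 * r -> cmod (g w - \sum_(k < N) a k * w ^+ k) <= e / 6.
  move=> hw; apply: le_trans hN2; apply: cauchy_estimate => //.
    move=> v; rewrite ln4 => hv; apply: hM; apply: polydisc_cons => // i.
    by apply: le_trans (hx' i) _; lra.
  by rewrite ln4; lra.
pose L h := \sum_(j < N) (\sum_(k < N) c j k * x0 ^+ k) * h j.
have LB (h h' : 'I_N -> C) : L (fun j => h j - h' j) = L h - L h'.
  by rewrite /L -sumrB; apply: eq_bigr => j _; rewrite mulrBr.
rewrite xE -/(L (fun j => peval (s j) x')).
pose T w := \sum_(k < N) a k * w ^+ k.
have LT : L (fun j => T (z j)) = T x0 by exact: (c1 (fun m => a m)).
have x0r : cmod x0 <= r by exact: hx.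
have B0 : cmod (g x0 - T x0) <= e / 6 by apply: hT; lra.
have B1 : cmod (L (fun j => g (z j) - T (z j))) <= 2 * (e / 6).
  by apply: c2 => // j; apply: hT; rewrite hz.
have B2 : cmod (L (fun j => g (z j) - peval (s j) x')) <= 2 * (e / 4).
  by apply: c2 => // j; exact: hs.
(* Errors at the point, at the nodes and from the induction:
   [e / 6 + 2 * (e / 6) + 2 * (e / 4) = e]. *)
have -> : g x0 - L (fun j => peval (s j) x') = (g x0 - T x0)
    - L (fun j => g (z j) - T (z j)) + L (fun j => g (z j) - peval (s j) x').
  by rewrite !LB LT; ring.
apply: le_trans (cmodD _ _) _; apply: le_trans (lerD (cmodB _ _) (lexx _)) _; lra.
Qed.

(** The coefficients are limits of those of polynomials approximating [F] on growing polydiscs: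
    [pcoef_bound], applied to differences of approximants, gives a Cauchy rate weighted by [r^|P|].
    For the expansion at [x] this rate is used at twice the radius of [x]. *)
Theorem taylor d (F : ('I_d -> C) -> C) : sep_entire F -> locally_bounded F ->
  exists alpha : midx d -> C,
    (forall r M : R, 0 <= r -> (forall x, polydisc r x -> cmod (F x) <= M) ->
       forall P, cmod (alpha P) * r ^+ msize P <= M) /\
    (forall x, csum (fun P => alpha P * mpow x P) (F x)).
Proof.
move=> eF bF; pose ev (N : nat) : R := N.+1%:R^-1.
have ev0 N : 0 < ev N by rewrite invr_gt0.
have evS N N' : (N <= N')%N -> ev N' <= ev N by move=> h; rewrite lef_pV2 ?posrE // ler_nat ltnS.
have small (e : R) : 0 < e -> exists n0, ev n0 < e.
  move=> e0; exists (Num.truncn e^-1); rewrite /ev invf_plt ?posrE //; exact: truncnS_gt.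
have /choice[S hS] : forall N : nat, exists s, forall x, polydisc N.+1%:R x ->
    cmod (F x - peval s x) <= ev N.
  by move=> N; apply: polydisc_approx.
have pd_mono r r' (x : 'I_d -> C) : r <= r' -> polydisc r x -> polydisc r' x.
  by move=> rr hx i; exact: le_trans (hx i) rr.
pose dif (s t : seq (C * midx d)) := s ++ [seq (- p.1, p.2) | p <- t].
have difE s t x : peval (dif s t) x = peval s x - peval t x.
  rewrite /dif /peval big_cat big_map /= -sumrN; congr (_ + _).
  by apply: eq_bigr => p _ /=; rewrite mulNr.
have difC s t P : pcoef (dif s t) P = pcoef s P - pcoef t P.
  by rewrite /dif /pcoef big_cat big_map /= -sumrN.
have cauchy N N' (r : R) P : 0 <= r -> r <= N.+1%:R -> (N <= N')%N ->
    cmod (pcoef (S N) P - pcoef (S N') P) * r ^+ msize P <= 2 * ev N.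
  move=> r0 rN NN'; rewrite -difC; apply: pcoef_bound => // x hx; rewrite difE.
  have h1 := hS N x (pd_mono _ _ _ rN hx).
  have rN' : r <= N'.+1%:R by apply: le_trans rN _; rewrite ler_nat ltnS.
  have h2 := hS N' x (pd_mono _ _ _ rN' hx).
  have := cmod_triangle (peval (S N) x) (F x) (peval (S N') x).
  have := cmod_distC (peval (S N) x) (F x).
  have := evS _ _ NN'; lra.
have /choice[alpha halpha] : forall P, exists l, forall e : R, 0 < e -> exists n0, forall n,
    (n0 <= n)%N -> cmod (pcoef (S n) P - l) < e.
  move=> P; apply: complex_cauchy_lim => e e0.
  have [|n0 hn0] := small (e / 4); first lra.
  exists n0 => m n hm hn.
  have h1 := @cauchy n0 m 1 P ler01 (ler1n _ _) hm.
  have h2 := @cauchy n0 n 1 P ler01 (ler1n _ _) hn.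
  rewrite expr1n !mulr1 in h1 h2.
  have := cmod_triangle (pcoef (S m) P) (pcoef (S n0) P) (pcoef (S n) P).
  have := cmod_distC (pcoef (S m) P) (pcoef (S n0) P); lra.
have close N (r : R) P : 0 <= r -> r <= N.+1%:R ->
    cmod (pcoef (S N) P - alpha P) * r ^+ msize P <= 2 * ev N.
  move=> r0 rN; apply/ler_addgt0Pr => e e0.
  have rp : 0 <= r ^+ msize P by rewrite exprn_ge0.
  have [|n0 hn0] := halpha P (e / (r ^+ msize P + 1)); first by rewrite divr_gt0 //; lra.
  have h1 := @cauchy N (maxn N n0) r P r0 rN (leq_maxl _ _).
  have := hn0 _ (leq_maxr N n0); rewrite ltr_pdivlMr; last lra.
  move=> h2.
  have h3 := ler_wpM2r rp (cmod_triangle (pcoef (S N) P) (pcoef (S (maxn N n0)) P) (alpha P)).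
  have := cmod_ge0 (pcoef (S (maxn N n0)) P - alpha P).
  rewrite mulrDl in h3; rewrite mulrDr mulr1 in h2; lra.
exists alpha; split.
  move=> r M r0 hM P; apply/ler_addgt0Pr => e e0.
  have [|n0 hn0] := small (e / 3); first lra.
  pose N := maxn n0 (Num.truncn r).
  have rN : r <= N.+1%:R.
    apply: le_trans (ltW (truncnS_gt r)) _; rewrite ler_nat ltnS; exact: leq_maxr.
  have h1 := close N r P r0 rN.
  have h2 : cmod (pcoef (S N) P) * r ^+ msize P <= M + ev N.
    apply: pcoef_bound => // x hx.
    have := hS N x (pd_mono _ _ _ rN hx); have := hM x hx.
    have := cmod_triangle (peval (S N) x) (F x) 0; rewrite !subr0.
    have := cmod_distC (peval (S N) x) (F x); lra.
  have rp : 0 <= r ^+ msize P by rewrite exprn_ge0.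
  have := ler_wpM2r rp (cmod_triangle (alpha P) (pcoef (S N) P) 0); rewrite !subr0 mulrDl.
  rewrite cmod_distC; have := evS _ _ (leq_maxl n0 (Num.truncn r)); rewrite -/N; lra.
move=> x e e0.
pose r : R := \sum_(i < d) cmod (x i).
have r0 : 0 <= r by apply: sumr_ge0 => i _; exact: cmod_ge0.
have xr : polydisc r x.
  move=> i; rewrite /r (bigD1 i) //= lerDl; apply: sumr_ge0 => j _; exact: cmod_ge0.
have [|n0 hn0] := small (e / (2 * 2 ^+ d + 1)); first by rewrite divr_gt0 // ltr_wpDl // mulr_ge0 // exprn_ge0.
pose N := maxn n0 (Num.truncn (2 * r)).
have rN : 2 * r <= N.+1%:R.
  apply: le_trans (ltW (truncnS_gt _)) _; rewrite ler_nat ltnS; exact: leq_maxr.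
exists (map snd (S N)) => s us sub.
have -> : F x - \sum_(P <- s) alpha P * mpow x P =
    (F x - peval (S N) x) + \sum_(P <- s) (pcoef (S N) P - alpha P) * mpow x P.
  rewrite (peval_pcoef x us sub).
  have -> : \sum_(P <- s) (pcoef (S N) P - alpha P) * mpow x P =
      \sum_(P <- s) pcoef (S N) P * mpow x P - \sum_(P <- s) alpha P * mpow x P.
    by rewrite -sumrB; apply: eq_bigr => P _; rewrite mulrBl.
  by rewrite addrA subrK.
have B1 : cmod (F x - peval (S N) x) <= ev N.
  by apply: hS; apply: pd_mono xr; apply: le_trans rN; lra.
have B2 : cmod (\sum_(P <- s) (pcoef (S N) P - alpha P) * mpow x P) <= 2 * ev N * 2 ^+ d.
  apply: le_trans (cmod_sum _ _ _) _.
  apply: le_trans (_ : \sum_(P <- s) 2 * ev N * 2^-1 ^+ msize P <= _); last first.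
    rewrite -mulr_sumr ler_wpM2l ?mulr_ge0 ?(ltW (ev0 _)) //; exact: sum_half_pow_msize.
  apply: ler_sum => P _; rewrite cmodM.
  have h := close N (2 * r) P; have {}h := h _ rN.
  apply: le_trans (_ : cmod (pcoef (S N) P - alpha P) * r ^+ msize P <= _).
    by rewrite ler_wpM2l ?cmod_ge0 // cmod_mpow_le.
  rewrite -[r](mulKf (_ : 2 != 0)) ?pnatr_eq0 // exprMn mulrCA mulrC.
  by rewrite ler_wpM2r ?exprn_ge0 ?invr_ge0 // h // mulr_ge0.
apply: le_lt_trans (cmodD _ _) _; apply: le_lt_trans (lerD B1 B2) _.
have := le_lt_trans (evS _ _ (leq_maxl n0 (Num.truncn (2 * r)))) hn0; rewrite -/N.
rewrite ltr_pdivlMr; last by rewrite ltr_wpDl // mulr_ge0 // exprn_ge0.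
by move=> h; apply: le_lt_trans h; rewrite le_eqVlt; apply/orP; left; apply/eqP; ring.
Qed.

End SeveralVariables.

(** * Differentiability of series of monomials *)

Section PairEntries.
Variables (R : realType) (N : nat).
Local Notation C := (R[i]).
Implicit Types (h z c : Cpair R N).

Definition entries_le h (r : R) :=
  (forall i, cmod (h.1 ord0 i) <= r) /\ (forall i, cmod (h.2 ord0 i) <= r).

Definition pnorm h : R := complex.Re `|h|.

Lemma pnormE h : `|h| = (pnorm h)%:C.
Proof. by rewrite /pnorm RRe_real // normr_real. Qed.

Lemma pnorm_ge0 h : 0 <= pnorm h.
Proof. by rewrite -ler0c -pnormE. Qed.

Lemma pnorm_entries h : entries_le h (pnorm h).
Proof.
have H (e : C) : 0 < e -> `|h| < e -> forall i, `|h.1 ord0 i| < e /\ `|h.2 ord0 i| < e.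
  move=> e0 he i; have : ball (0 : Cpair R N) e h.
    by rewrite -ball_normE /ball_ /= sub0r normrN.
  case=> [[_ h1] [_ h2]]; have := h1 ord0 i; have := h2 ord0 i.
  by rewrite /ball /= !mxE !sub0r !normrN.
have H' (e : R) : 0 < e -> forall i, cmod (h.1 ord0 i) <= pnorm h + e /\ cmod (h.2 ord0 i) <= pnorm h + e.
  move=> e0 i; have [||h1 h2] := H (pnorm h + e)%:C _ _ i.
  - by rewrite ltcR ltr_wpDl // pnorm_ge0.
  - by rewrite pnormE ltcR ltrDl.
  by move: h1 h2; rewrite !normcC !ltcR => h1 h2; split; exact: ltW.
by split=> i; apply/ler_addgt0Pr => e e0; have [] := H' e e0 i.
Qed.

Lemma nbhs_entries z (A : set (Cpair R N)) : nbhs z A -> exists2 r : R, 0 < r &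
  forall y : Cpair R N, (forall i, cmod (y.1 ord0 i - z.1 ord0 i) < r) ->
            (forall i, cmod (y.2 ord0 i - z.2 ord0 i) < r) -> A y.
Proof.
move=> /nbhs_ballP[e e0 he]; have eE : e = (complex.Re e)%:C by rewrite RRe_real // gtr0_real.
exists (complex.Re e); first by rewrite -ltcR -eE.
move=> y h1 h2; apply: he; split; split=> // i j; rewrite /ball /= (ord1 i) eE normcC ltcR cmod_distC.
  exact: h1.
exact: h2.
Qed.

Lemma entries_nbhs z (r : R) : 0 < r -> nbhs z [set y : Cpair R N |
  (forall i, cmod (y.1 ord0 i - z.1 ord0 i) < r) /\ (forall i, cmod (y.2 ord0 i - z.2 ord0 i) < r)].
Proof.
move=> r0; apply/nbhs_ballP; exists r%:C; first by rewrite /= ltcR.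
move=> y [[_ h1] [_ h2]]; split=> i; [have := h1 ord0 i|have := h2 ord0 i];
  by rewrite /ball /= normcC ltcR cmod_distC.
Qed.

Definition dotp c h : C^o := \sum_i c.1 ord0 i * h.1 ord0 i + \sum_i c.2 ord0 i * h.2 ord0 i.

Lemma dotp_is_linear c : linear (dotp c).
Proof.
move=> a h h'; rewrite /dotp scalerDr !scaler_sumr addrACA -!big_split /=.
apply: eq_bigr => i _; rewrite !mxE /GRing.scale /=; ring.
Qed.

HB.instance Definition _ c :=
  GRing.isLinear.Build C (Cpair R N) C^o *:%R (dotp c) (dotp_is_linear c).

Lemma cmod_dotp c h (B r : R) : 0 <= r -> entries_le c B -> entries_le h r ->
  cmod (dotp c h) <= N%:R * 2 * (B * r).
Proof.
move=> r0 [c1 c2] [h1 h2]; apply: le_trans (cmodD _ _) _.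
have -> : N%:R * 2 * (B * r) = N%:R * (B * r) + N%:R * (B * r) by ring.
by apply: lerD; apply: le_trans (cmod_sum _ _ _) _;
  rewrite mulr_natl -[X in _ *+ X](card_ord N) -sumr_const; apply: ler_sum => i _;
  rewrite cmodM ler_pM ?cmod_ge0.
Qed.

Lemma dotp_continuous c : continuous (dotp c : Cpair R N -> C^o).
Proof.
move=> z; apply/cvgrPdist_le => e e0.
have eE : e = (complex.Re e)%:C by rewrite RRe_real // gtr0_real.
have e0' : 0 < complex.Re e by rewrite -ltcR -eE.
pose K : R := N%:R * 2 * pnorm c + 1.
have K0 : 0 < K by rewrite /K ltr_wpDl // !mulr_ge0 // pnorm_ge0.
have := entries_nbhs z (divr_gt0 e0' K0); apply: filterS => y [y1 y2].
rewrite -raddfB eE normcC lecR.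
have hz : entries_le (z - y) (complex.Re e / K).
  by split=> i; rewrite !mxE cmod_distC ltW.
apply: le_trans (cmod_dotp _ (pnorm_entries c) hz) _; first by rewrite divr_ge0 // ltW.
have -> : N%:R * 2 * (pnorm c * (complex.Re e / K)) = complex.Re e * ((N%:R * 2 * pnorm c) / K).
  by field; rewrite gt_eqF.
rewrite ler_piMr ?(ltW e0') // ler_pdivrMr // mul1r /K; lra.
Qed.

Lemma quadratic_differentiable (g : Cpair R N -> C) z c (B : R) :
  (forall h, entries_le h 1 -> cmod (g (z + h) - g z - dotp c h) <= B * pnorm h ^+ 2) ->
  differentiable (g : Cpair R N -> C^o) z.
Proof.
move=> H; have E : (g : Cpair R N -> C^o) \o shift z = cst (g z) + (dotp c) +o_ (0 : Cpair R N) id.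
  apply/eqaddoP => e e0 /=.
  have eE : e = (complex.Re e)%:C by rewrite RRe_real // gtr0_real.
  have e0' : 0 < complex.Re e by rewrite -ltcR -eE.
  pose K := `|B| + 1; have K0 : 0 < K by rewrite /K ltr_wpDl.
  pose d := Num.min 1 (complex.Re e / K).
  have d0 : 0 < d by rewrite lt_min ltr01 divr_gt0.
  have dC : 0 < (d%:C : C) by rewrite ltcR.
  have := nbhsx_ballx (0 : Cpair R N) d%:C dC; apply: filterS => h.
  rewrite -ball_normE /ball_ /= sub0r normrN pnormE ltcR lt_min => /andP[h1 h2].
  have hh : entries_le h 1.
    by have [q1 q2] := pnorm_entries h; split=> i; [apply: le_trans (q1 i) _|apply: le_trans (q2 i) _]; exact: ltW.
  rewrite !fctE eE normcC -rmorphM /= lecR.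
  have := H h hh; rewrite [z + h]addrC.
  have -> : g (h + z) - (g z + dotp c h) = g (h + z) - g z - dotp c h by rewrite opprD addrA.
  move=> /le_trans; apply.
  rewrite expr2 mulrA; apply: ler_wpM2r; first exact: pnorm_ge0.
  move: h2; rewrite ltr_pdivlMr // /K => h2; have := ler_norm B; have := pnorm_ge0 h; nra.
have cd := @dotp_continuous c.
have dE := diff_unique cd E.
by apply/diff_locallyP; rewrite dE; split.
Qed.

End PairEntries.

(** * First-order expansions with uniform constants *)

Section Tame.
Variables (R : realType) (N : nat).
Local Notation C := (R[i]).
Implicit Types (h z c : Cpair R N) (u v : Cpair R N -> C) (B : R).

Lemma entries_pnorm h (r : R) : 0 <= r -> entries_le h r -> pnorm h <= r.
Proof.
move=> r0 [h1 h2]; apply/ler_addgt0Pr => e e0.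
have re : 0 < ((r + e)%:C : C) by rewrite ltcR ltr_wpDl.
have : ball (0 : Cpair R N) (r + e)%:C h.
  by split; split=> // i j; rewrite /ball /= !mxE sub0r normrN (ord1 i) normcC ltcR;
    [apply: le_lt_trans (h1 j) _|apply: le_lt_trans (h2 j) _]; rewrite ltrDl.
rewrite -ball_normE /ball_ /= sub0r normrN pnormE ltcR; exact: ltW.
Qed.

(** One constant bounds the value, the gradient and the second-order remainder on the unit ball.
    Such constants add along sums and multiply, up to [tame_cst], along products; hence
    differentiability of a series follows from summability of constants, without a theorem on
    uniform limits of holomorphic functions. *)
Definition tame B u z := cmod (u z) <= B /\ exists2 c, entries_le c B &
  forall h, entries_le h 1 -> cmod (u (z + h) - u z - dotp c h) <= B * pnorm h ^+ 2.

(** Chosen to dominate [4 N^2 + 4 N + 3], the total of the cross terms in the remainder of a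
    product. *)
Definition tame_cst : R := (2 * N%:R + 3) ^+ 2.

Lemma tame_cst_ge1 : 1 <= tame_cst.
Proof. by rewrite /tame_cst; have := ler0n R N; nra. Qed.

Lemma tame_ge0 B u z : tame B u z -> 0 <= B.
Proof. by case=> h _; exact: le_trans (cmod_ge0 _) h. Qed.

Lemma tame_le B B' u z : B <= B' -> tame B u z -> tame B' u z.
Proof.
move=> BB [h1 [c [c1 c2] h2]]; split; first exact: le_trans BB.
exists c => [|h hh]; first by split=> i; [apply: le_trans (c1 i) BB|apply: le_trans (c2 i) BB].
by apply: le_trans (h2 h hh) _; rewrite ler_wpM2r // sqr_ge0.
Qed.

Lemma dotpDl c c' h : dotp (c + c') h = dotp c h + dotp c' h.
Proof.
by rewrite /dotp addrACA -!big_split /=; apply: eq_bigr => i _; rewrite !mxE; ring.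
Qed.

Lemma dotpZl (a : C) c h : dotp (a *: c) h = a * dotp c h.
Proof.
by rewrite /dotp mulrDr !mulr_sumr; congr (_ + _); apply: eq_bigr => i _; rewrite !mxE mulrA.
Qed.

Lemma tameM B B' u v z : tame B u z -> tame B' v z ->
  tame (tame_cst * (B * B')) (fun z => u z * v z) z.
Proof.
move=> tu tv; have B0 := tame_ge0 tu; have B'0 := tame_ge0 tv.
case: tu tv => [u1 [c [c1 c2] hu]] [v1 [c' [c1' c2'] hv]].
have BB : 0 <= B * B' by exact: mulr_ge0.
have n0 := ler0n R N.
have uv : cmod (u z * v z) <= B * B' by rewrite cmodM ler_pM ?cmod_ge0.
have K2 : 2 * (B * B') <= tame_cst * (B * B').
  by rewrite ler_wpM2r // /tame_cst; nra.
split; first by apply: le_trans uv _; have := tame_cst_ge1; nra.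
exists (v z *: c + u z *: c').
  split=> i; rewrite !mxE; apply: le_trans (cmodD _ _) _; rewrite !cmodM; apply: le_trans _ K2;
    have -> : 2 * (B * B') = B' * B + B * B' by ring.
    by apply: lerD; apply: ler_pM; rewrite ?cmod_ge0.
  by apply: lerD; apply: ler_pM; rewrite ?cmod_ge0.
move=> h hh; rewrite dotpDl !dotpZl.
have hu' := hu h hh; have hv' := hv h hh.
have p0 := pnorm_ge0 h; have p1 := entries_pnorm ler01 hh.
set a := dotp c h in hu' *; set b := dotp c' h in hv' *.
have ha : cmod a <= N%:R * 2 * (B * pnorm h) by apply: cmod_dotp => //; exact: pnorm_entries.
have hb : cmod b <= N%:R * 2 * (B' * pnorm h) by apply: cmod_dotp => //; exact: pnorm_entries.
set p := pnorm h in p0 p1 ha hb hu' hv' *.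
set ru := u (z + h) - u z - a in hu' *; set rv := v (z + h) - v z - b in hv' *.
have -> : u (z + h) * v (z + h) - u z * v z - (v z * a + u z * b) =
    ru * (v z + b + rv) + ((u z + a) * rv + a * b) by rewrite /ru /rv; ring.
have q : p ^+ 2 <= p by rewrite expr2 ler_piMl.
have hv3 : cmod (v z + b + rv) <= B' * (2 + 2 * N%:R).
  apply: le_trans (cmodD _ _) _; apply: le_trans (lerD (cmodD _ _) (lexx _)) _.
  have : N%:R * 2 * (B' * p) <= N%:R * 2 * B' by rewrite ler_wpM2l ?mulr_ge0 // ler_piMr.
  have : B' * p ^+ 2 <= B' by rewrite ler_piMr //; lra.
  lra.
have hu3 : cmod (u z + a) <= B * (1 + 2 * N%:R).
  apply: le_trans (cmodD _ _) _.
  have : N%:R * 2 * (B * p) <= N%:R * 2 * B by rewrite ler_wpM2l ?mulr_ge0 // ler_piMr.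
  lra.
apply: le_trans (cmodD _ _) _; rewrite cmodM.
apply: le_trans (lerD (lexx _) (cmodD _ _)) _; rewrite !cmodM.
have t1 := ler_pM (cmod_ge0 _) (cmod_ge0 _) hu' hv3.
have t2 := ler_pM (cmod_ge0 _) (cmod_ge0 _) hu3 hv'.
have t3 := ler_pM (cmod_ge0 _) (cmod_ge0 _) ha hb.
apply: le_trans (lerD t1 (lerD t2 t3)) _.
have -> : B * p ^+ 2 * (B' * (2 + 2 * N%:R)) + (B * (1 + 2 * N%:R) * (B' * p ^+ 2)
   + N%:R * 2 * (B * p) * (N%:R * 2 * (B' * p))) =
   ((2 + 2 * N%:R) + (1 + 2 * N%:R) + 4 * N%:R ^+ 2) * ((B * B') * p ^+ 2) by ring.
have -> : tame_cst * (B * B') * p ^+ 2 = tame_cst * (B * B' * p ^+ 2) by rewrite -mulrA.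
apply: ler_wpM2r; first by rewrite mulr_ge0 // sqr_ge0.
by rewrite /tame_cst; nra.
Qed.

Lemma tame_const (a : C) z : tame (cmod a) (fun=> a) z.
Proof.
split=> //; exists 0; first by split=> i; rewrite mxE cmod0 cmod_ge0.
move=> h _; rewrite /dotp !big1 ?addr0 ?subrr ?cmod0.
- by rewrite mulr_ge0 ?cmod_ge0 // sqr_ge0.
- by move=> i _; rewrite mxE mul0r.
by move=> i _; rewrite mxE mul0r.
Qed.

Lemma tame_coord1 B i z : entries_le z B -> 1 <= B -> tame B (fun z => z.1 ord0 i) z.
Proof.
move=> [z1 z2] B1; split=> //; exists (delta_mx ord0 i, 0).
  split=> j; rewrite mxE.
    by case: (_ && _); rewrite ?cmod1 ?cmod0 //; lra.
  by rewrite cmod0; lra.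
move=> h _; rewrite /dotp (bigD1 i) //= !mxE !eqxx mul1r !big1 ?addr0.
- have -> : z.1 ord0 i + h.1 ord0 i - z.1 ord0 i - h.1 ord0 i = 0 by ring.
  by rewrite cmod0 mulr_ge0 ?sqr_ge0 //; lra.
- by move=> j _; rewrite mxE mul0r.
by move=> j /negbTE ji; rewrite mxE eqxx ji mul0r.
Qed.

Lemma tame_coord2 B i z : entries_le z B -> 1 <= B -> tame B (fun z => z.2 ord0 i) z.
Proof.
move=> [z1 z2] B1; split=> //; exists (0, delta_mx ord0 i).
  split=> j; rewrite mxE.
    by rewrite cmod0; lra.
  by case: (_ && _); rewrite ?cmod1 ?cmod0 //; lra.
move=> h _; have -> : dotp (0, delta_mx ord0 i) h = h.2 ord0 i.
  rewrite /dotp big1 ?add0r => [|j _]; last by rewrite mxE mul0r.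
  rewrite (bigD1 i) //= !mxE !eqxx mul1r big1 ?addr0 // => j /negbTE ji.
  by rewrite mxE eqxx ji mul0r.
have -> : (z + h).2 ord0 i - z.2 ord0 i - h.2 ord0 i = 0 by rewrite mxE; ring.
by rewrite cmod0 mulr_ge0 ?sqr_ge0 //; lra.
Qed.

Lemma tameD B B' u v z : tame B u z -> tame B' v z -> tame (B + B') (fun z => u z + v z) z.
Proof.
move=> [u1 [c [c1 c2] hu]] [v1 [c' [c1' c2'] hv]].
split; first by apply: le_trans (cmodD _ _) (lerD u1 v1).
exists (c + c').
  by split=> i; rewrite mxE; apply: le_trans (cmodD _ _) _; rewrite lerD.
move=> h hh; rewrite dotpDl mulrDl; apply: le_trans _ (lerD (hu h hh) (hv h hh)).
apply: le_trans (cmodD _ _); rewrite le_eqVlt; apply/orP; left; apply/eqP; congr cmod; ring.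
Qed.

Lemma tame_sum (I : Type) (s : seq I) (B : I -> R) (u : I -> Cpair R N -> C) z :
  (forall i, tame (B i) (u i) z) -> tame (\sum_(i <- s) B i) (fun z => \sum_(i <- s) u i z) z.
Proof.
move=> H; elim: s => [|i s IH].
  rewrite big_nil (_ : (fun z => _) = fun=> 0); last by apply/funext => y; rewrite big_nil.
  by have := tame_const 0 z; rewrite cmod0.
rewrite big_cons (_ : (fun z => _) = fun z => u i z + \sum_(i <- s) u i z).
  exact: tameD.
by apply/funext => y; rewrite big_cons.
Qed.

Lemma tameX B u k z : tame B u z -> tame ((tame_cst * B) ^+ k) (fun z => u z ^+ k) z.
Proof.
move=> tu; elim: k => [|k IH].
  rewrite expr0 (_ : (fun z => _) = fun=> 1); last by apply/funext => y; rewrite expr0.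
  by have := tame_const 1 z; rewrite cmod1.
rewrite exprS -mulrA (_ : (fun z => _) = fun z => u z * u z ^+ k); first exact: tameM.
by apply/funext => y; rewrite exprS.
Qed.

Lemma tame_prod (I : Type) (s : seq I) (B : I -> R) (u : I -> Cpair R N -> C) z :
  (forall i, tame (B i) (u i) z) ->
  tame (\prod_(i <- s) (tame_cst * B i)) (fun z => \prod_(i <- s) u i z) z.
Proof.
move=> H; elim: s => [|i s IH].
  rewrite big_nil (_ : (fun z => _) = fun=> 1); last by apply/funext => y; rewrite big_nil.
  by have := tame_const 1 z; rewrite cmod1.
rewrite big_cons -mulrA (_ : (fun z => _) = fun z => u i z * \prod_(i <- s) u i z).
  exact: tameM.
by apply/funext => y; rewrite big_cons.
Qed.

Definition mon (P Q : midx N) (z : Cpair R N) : C :=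
  (\prod_i z.1 ord0 i ^+ P i) * (\prod_i z.2 ord0 i ^+ Q i).

(** The point is that the constant grows only geometrically with the degree, which rapidly
    decreasing coefficients absorb. *)
Lemma tame_mon (r : R) P Q z : entries_le z r -> 1 <= r ->
  tame (tame_cst ^+ (2 * N).+1 * (tame_cst * r) ^+ (msize P + msize Q)) (mon P Q) z.
Proof.
move=> hz r1.
have E (T : midx N) : tame_cst ^+ N * (tame_cst * r) ^+ msize T =
    \prod_(i < N) (tame_cst * (tame_cst * r) ^+ T i).
  by rewrite big_split /= prodr_const card_ord prodrXr.
have -> : tame_cst ^+ (2 * N).+1 * (tame_cst * r) ^+ (msize P + msize Q) =
    tame_cst * ((tame_cst ^+ N * (tame_cst * r) ^+ msize P) *
                (tame_cst ^+ N * (tame_cst * r) ^+ msize Q)).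
  by rewrite exprS mul2n -addnn !exprD; ring.
rewrite !E; apply: (@tameM _ _ (fun z => \prod_i z.1 ord0 i ^+ P i) (fun z => \prod_i z.2 ord0 i ^+ Q i));
  apply: tame_prod => i; apply: tameX.
  exact: tame_coord1.
exact: tame_coord2.
Qed.

Lemma cmod_mon_le (r : R) P Q z : 0 <= r -> entries_le z r -> cmod (mon P Q z) <= r ^+ (msize P + msize Q).
Proof.
move=> r0 [z1 z2]; rewrite /mon cmodM exprD; apply: ler_pM; rewrite ?cmod_ge0 //.
  exact: (@cmod_mpow_le _ _ r (fun i => z.1 ord0 i)).
exact: (@cmod_mpow_le _ _ r (fun i => z.2 ord0 i)).
Qed.

(** The gradients, bounded by summable constants, sum entrywise to a vector [L]; summing the
    remainders term by term shows that [L] is the differential, with a quadratic error. *)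
Lemma tame_series (T : eqType) (u : T -> Cpair R N -> C) (B : T -> R) (g : Cpair R N -> C) z :
  psummable B -> (forall k, tame (B k) (u k) z) -> (forall y, csum (u^~ y) (g y)) ->
  differentiable (g : Cpair R N -> C^o) z.
Proof.
move=> [S HS] tu cg.
have /choice[c hc] : forall k, exists c, entries_le c (B k) /\ forall h, entries_le h 1 ->
    cmod (u k (z + h) - u k z - dotp c h) <= B k * pnorm h ^+ 2.
  by move=> k; have [_ [c c1 c2]] := tu k; exists c.
have s1 i : psummable (fun k => cmod ((c k).1 ord0 i)).
  by exists S => s us; apply: le_trans (HS s us); apply: ler_sum => k _; have [[c1 _] _] := hc k.
have s2 i : psummable (fun k => cmod ((c k).2 ord0 i)).
  by exists S => s us; apply: le_trans (HS s us); apply: ler_sum => k _; have [[_ c2] _] := hc k.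
have /choice[l1 hl1] : forall i, exists l, csum (fun k => (c k).1 ord0 i) l.
  by move=> i; apply: csum_ex.
have /choice[l2 hl2] : forall i, exists l, csum (fun k => (c k).2 ord0 i) l.
  by move=> i; apply: csum_ex.
pose L : Cpair R N := (\row_i l1 i, \row_i l2 i).
have sumc (f : 'I_N -> T -> C) (l : 'I_N -> C) : (forall i, csum (f i) (l i)) ->
    csum (fun k => \sum_i f i k) (\sum_i l i).
  move=> hf.
  have H (s : seq 'I_N) : csum (fun k => \sum_(i <- s) f i k) (\sum_(i <- s) l i).
    elim: s => [|i s IH].
      have := csumZ 0 (cg z); rewrite mul0r big_nil; apply: eq_csum => k.
      by rewrite big_nil mul0r.
    rewrite big_cons; apply: eq_csum (csumD (hf i) IH) => k.
    by rewrite big_cons.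
  exact: H.
have dL h : csum (fun k => dotp (c k) h) (dotp L h).
  rewrite /dotp; apply: csumD.
    apply: sumc => i; rewrite mxE mulrC.
    by apply: eq_csum (csumZ (h.1 ord0 i) (hl1 i)) => k; rewrite mulrC.
  apply: sumc => i; rewrite mxE mulrC.
  by apply: eq_csum (csumZ (h.2 ord0 i) (hl2 i)) => k; rewrite mulrC.
apply: (@quadratic_differentiable _ _ _ _ L S) => h hh.
have D : csum (fun k => u k (z + h) + (-1) * u k z + (-1) * dotp (c k) h)
    (g (z + h) + (-1) * g z + (-1) * dotp L h).
  by apply: csumD; [apply: csumD => //; exact: csumZ|exact: csumZ].
rewrite !mulN1r in D; apply: csum_bound D _ => s us.
apply: le_trans (_ : \sum_(k <- s) B k * pnorm h ^+ 2 <= _); last first.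
  by rewrite -mulr_suml ler_wpM2r ?sqr_ge0 ?HS.
by apply: ler_sum => k _; rewrite !mulN1r; exact: (hc k).2.
Qed.

End Tame.

(** * Holomorphic functions on the complexified disc *)

Section Charts.
Variables (R : realType) (n : nat).
Local Notation C := (R[i]).
Implicit Types (F : Cpair R n.+1 -> C) (b : bool) (v : 'I_(n + n) -> C).

(** The value of [p^0 q^0] that the equation of [Zhat] forces. *)
Definition chart_form v : C := 1 + \sum_(i < n) v (lshift n i) * v (rshift n i).

(* For [b = true] the chart [q^0 = 1] of the quotient, with coordinates [p^i], [q^i];
   for [b = false] the chart [p^0 = 1]. *)
Definition chart b v : Cpair R n.+1 :=
  (\row_j (if unlift ord0 j is Some i then v (lshift n i) else if b then chart_form v else 1),
   \row_j (if unlift ord0 j is Some i then v (rshift n i) else if b then 1 else chart_form v)).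

Lemma hform_recl (p q : 'rV[C]_n.+1) :
  hform p q = - (p ord0 ord0 * q ord0 ord0) + \sum_(i < n) p ord0 (lift ord0 i) * q ord0 (lift ord0 i).
Proof.
rewrite /hform big_ord_recl eqxx mulN1r mulNr; congr (_ + _).
by apply: eq_bigr => i _; rewrite -val_eqE /= mul1r.
Qed.

Lemma chart_Zhat b v : Zhat (chart b v).
Proof.
rewrite /Zhat /= hform_recl !mxE unlift_none.
under eq_bigr do rewrite !mxE liftK.
by rewrite /chart_form; case: b; ring.
Qed.

(** In [chart_form] each coordinate is multiplied only by a different one, so moving a single
    coordinate traces a straight line in [Zhat]. *)
Lemma chart_upd_affine b v i w :
  chart b (upd v i w) = chart b (upd v i 0) + w *: (chart b (upd v i 1) - chart b (upd v i 0)).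
Proof.
have E : chart_form (upd v i w) = chart_form (upd v i 0) +
    w * (chart_form (upd v i 1) - chart_form (upd v i 0)).
  have S : \sum_(k < n) upd v i w (lshift n k) * upd v i w (rshift n k) =
      \sum_(k < n) upd v i 0 (lshift n k) * upd v i 0 (rshift n k) +
      w * (\sum_(k < n) upd v i 1 (lshift n k) * upd v i 1 (rshift n k) -
           \sum_(k < n) upd v i 0 (lshift n k) * upd v i 0 (rshift n k)).
    rewrite -sumrB mulr_sumr -big_split /=; apply: eq_bigr => k _; rewrite /upd.
    by case: (split_ordP i) => j ->; rewrite !eq_shift; case: eqP => _; ring.
  by rewrite /chart_form S; ring.
have U k : upd v i w k = upd v i 0 k + w * (upd v i 1 k - upd v i 0 k).
  by rewrite /upd; case: eqP => _; ring.
by rewrite /chart; congr (_, _); apply/rowP => j; rewrite !mxE; case: unliftP => [k|] _;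
  rewrite ?U //; case: b; rewrite ?E //; ring.
Qed.

(** Near each point of a line contained in [Zhat] the function coincides along the line with a local
    extension to the ambient space, which has directional derivatives. *)
Lemma entire_line F (a d : Cpair R n.+1) : holo_on_Zhat F ->
  (forall w : C, Zhat (a + w *: d)) -> entire (fun w => F (a + w *: d)).
Proof.
move=> hF Zl w0; have [U [g [oU Uz hg Fg]]] := hF _ (Zl w0).
have dg : derivable g (a + w0 *: d) d by apply: diff_derivable; exact: hg.
have dl : derivable (fun w : C^o => g (a + w *: d)) w0 1.
  rewrite /derivable (_ : (fun h => _) =
    (fun h => h^-1 *: ((g \o shift (a + w0 *: d)) (h *: d) - g (a + w0 *: d)))) //.
  by apply/funext => h /=; rewrite [h *: 1]mulr1 scalerDl addrCA.
apply: near_eq_derivable dl.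
have cl : {for w0, continuous (fun w : C^o => a + w *: d)}.
  exact: (cvgD (cvg_cst a) (@scalel_continuous C (Cpair R n.+1) d w0)).
have : \forall w \near (w0 : C^o), U (a + w *: d).
  by apply: cl; apply: open_nbhs_nbhs.
by apply: filterS => w Uw; rewrite (Fg _ Uw) //; exact: Zl.
Qed.

Lemma chart_sep_entire b F : holo_on_Zhat F -> sep_entire (fun v => F (chart b v)).
Proof.
move=> hF v i.
rewrite (_ : (fun w => _) =
  fun w => F (chart b (upd v i 0) + w *: (chart b (upd v i 1) - chart b (upd v i 0)))).
  by apply: entire_line => // w; rewrite -chart_upd_affine; exact: chart_Zhat.
by apply/funext => w; rewrite -chart_upd_affine.
Qed.

Lemma continuous_pair (T : topologicalType) (f : T -> Cpair R n.+1) :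
  (forall i, continuous (fun t => (f t).1 ord0 i : C^o)) ->
  (forall i, continuous (fun t => (f t).2 ord0 i : C^o)) -> continuous f.
Proof.
move=> c1 c2 t A /nbhs_entries[r r0 hr].
have near_i (h : T -> C^o) : continuous h -> \forall y \near t, cmod (h y - h t) < r.
  move=> ch; have rC : 0 < (r%:C : C) by rewrite ltcR.
  have /cvgrPdist_lt/(_ _ rC) := ch t.
  by apply: filterS => y; rewrite normcC ltcR cmod_distC.
have N1 : \forall y \near t, forall i, cmod ((f y).1 ord0 i - (f t).1 ord0 i) < r.
  by apply: filter_forall => i; exact: (near_i (fun y => (f y).1 ord0 i)).
have N2 : \forall y \near t, forall i, cmod ((f y).2 ord0 i - (f t).2 ord0 i) < r.
  by apply: filter_forall => i; exact: (near_i (fun y => (f y).2 ord0 i)).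
by apply: filterS (filterI N1 N2) => y [h1 h2]; exact: hr.
Qed.

(** A square rather than a disc, being the image of a product of two segments. *)
Definition square (r : R) : set C^o := [set z | `|complex.Re z| <= r /\ `|complex.Im z| <= r].

Lemma square_compact r : compact (square r).
Proof.
have -> : square r = (fun p : R * R => p.1 +i* p.2 : C^o) @` (`[- r, r] `*` `[- r, r]).
  apply/seteqP; split=> [[x y] [/= hx hy]|_ [[x y] [/= hx hy] <-]].
    by exists (x, y) => //=; rewrite !in_itv /= -!ler_norml.
  by move: hx hy; rewrite !in_itv /= -!ler_norml.
apply: continuous_compact; last by apply: compact_setX; exact: segment_compact.
apply: continuous_subspaceT => -[x y]; apply/cvgrPdist_lt => e e0.
have eE : e = (complex.Re e)%:C by rewrite RRe_real // gtr0_real.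
have e2 : 0 < complex.Re e / 2 by rewrite divr_gt0 // -ltcR -eE.
have := nbhsx_ballx ((x, y) : R * R) _ e2; apply: filterS => -[x' y'] [/= hx hy].
rewrite eE normcC ltcR; apply: le_lt_trans (cmod_le_ReIm _) _.
by rewrite !raddfB /=; rewrite /ball /= in hx hy; lra.
Qed.

(** Both charts contribute, since the expansion coefficients are taken from both; the supremum over
    this set bounds all of them. *)
Definition chart_cpt (r : R) : set (Cpair R n.+1) :=
  (fun u : 'rV[C^o]_(n + n) => chart true (u ord0)) @` [set u : 'rV[C^o]_(n + n) | forall i, square r (u ord0 i)] `|`
  (fun u : 'rV[C^o]_(n + n) => chart false (u ord0)) @` [set u : 'rV[C^o]_(n + n) | forall i, square r (u ord0 i)].

Lemma chart_continuous b : continuous (fun u : 'rV[C^o]_(n + n) => chart b (u ord0)).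
Proof.
have cc i : continuous (fun u : 'rV[C^o]_(n + n) => u ord0 i : C^o) by exact: coord_continuous.
have cf : continuous (fun u : 'rV[C^o]_(n + n) => chart_form (u ord0) : C^o).
  have S : continuous (fun u : 'rV[C^o]_(n + n) =>
      \sum_(i < n) u ord0 (lshift n i) * u ord0 (rshift n i) : C^o).
    apply: continuous_big => [|i _ u]; first exact: add_continuous.
    exact: (cvgM (cc _ u) (cc _ u)).
  by move=> u; exact: (cvgD (cvg_cst (1 : C^o)) (S u)).
apply: continuous_pair => j.
  rewrite (_ : (fun _ => _) = (fun u : 'rV[C^o]_(n + n) =>
      if unlift ord0 j is Some i then u ord0 (lshift n i)
      else if b then chart_form (u ord0) else 1)); last by apply/funext => u; rewrite mxE.
  case: (unlift ord0 j) => [i|]; first exact: cc.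
  by case: b; [exact: cf|exact: cst_continuous].
rewrite (_ : (fun _ => _) = (fun u : 'rV[C^o]_(n + n) =>
    if unlift ord0 j is Some i then u ord0 (rshift n i)
    else if b then 1 else chart_form (u ord0))); last by apply/funext => u; rewrite mxE.
case: (unlift ord0 j) => [i|]; first exact: cc.
by case: b; [exact: cst_continuous|exact: cf].
Qed.

Lemma chart_cpt_cpt r : cpt (chart_cpt r).
Proof.
split; last by move=> _ [[u _ <-]|[u _ <-]]; exact: chart_Zhat.
have cc : compact [set u : 'rV[C^o]_(n + n) | forall i, square r (u ord0 i)].
  by apply: (@rV_compact _ _ (fun=> square r)) => i; exact: square_compact.
by apply: compactU; apply: continuous_compact => //;
  apply: continuous_subspaceT; exact: chart_continuous.
Qed.

Lemma chart_cpt_mem b r v : polydisc r v -> chart_cpt r (chart b v).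
Proof.
move=> hv.
have E : (\row_i v i : 'rV[C^o]_(n + n)) ord0 = v by apply/funext => i; rewrite mxE.
case: b; [left|right]; exists (\row_i v i); rewrite ?E // => i; rewrite mxE;
  by split; [exact: le_trans (Re_le_cmod _) (hv i)|exact: le_trans (Im_le_cmod _) (hv i)].
Qed.

(** Compactness as a covering property along the filter at [+oo]: bounds valid near each point for
    all large [M] have a common [M]. *)
Lemma compact_locally_bounded (T : topologicalType) (K : set T) (P : R -> T -> Prop) : compact K ->
  (forall z, K z -> exists M, \forall y \near z, K y -> forall M', M <= M' -> P M' y) ->
  exists M, forall z, K z -> P M z.
Proof.
move=> /compact_near_coveringP cK hP.
have := cK R (pinfty_nbhs R) (fun M y => K y -> P M y) _ _.
case=> [z Kz|M [_ hM]].
  have [M hM] := hP z Kz.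
  exists ([set y | K y -> forall M', M <= M' -> P M' y], [set M' | M <= M']).
    by split=> //; apply: nbhs_pinfty_ge; exact: num_real.
  by move=> [y M'] [/= h1 h2] Ky; exact: h1.
by exists (M + 1) => z Kz; apply: (hM (M + 1) _ z Kz Kz); rewrite ltrDl.
Qed.

Lemma cpt_entries (K : set (Cpair R n.+1)) : compact K ->
  exists2 r : R, 1 <= r & forall z, K z -> entries_le z r.
Proof.
move=> cK; suff [M hM] : exists M, forall z, K z -> entries_le z M.
  exists (Num.max 1 M); first by rewrite le_max lexx.
  by move=> z /hM[z1 z2]; split=> i; rewrite le_max ?z1 ?z2 orbT.
apply: (@compact_locally_bounded _ K (fun M z => entries_le z M)) => // z Kz.
exists (pnorm z + 1); have := entries_nbhs z (@ltr01 R).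
apply: filterS => y [y1 y2] _ M' hM'; have [z1 z2] := pnorm_entries z.
by split=> i; apply: le_trans hM';
  [apply: le_trans (lerD (z1 i) (ltW (y1 i)))|apply: le_trans (lerD (z2 i) (ltW (y2 i)))];
  (apply: le_trans (cmodD _ _); rewrite addrC subrK).
Qed.

End Charts.

(** * Separation of degrees by the circle action *)

Section CircleAction.
Variables (R : realType) (T : eqType).
Local Notation C := (R[i]).

(* Averaging over roots of unity against [\sum_(1 <= m <= D) w^m] picks out the terms of
   degree [a - b] in [-D, -1], up to aliasing in degrees of absolute value > D. *)
Lemma csum_neg_degree (u : T -> C) (a b : T -> nat) :
  psummable (fun i => cmod (u i)) ->
  (forall w : C, cmod w = 1 -> csum (fun i => u i * (w ^+ a i / w ^+ b i)) 0) ->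
  csum (fun i => if (a i < b i)%N then u i else 0) 0.
Proof.
move=> su hu.
have [l hl] : exists l, csum (fun i => if (a i < b i)%N then u i else 0) l.
  apply: csum_ex; case: su => B HB; exists B => s us; apply: le_trans (HB s us).
  by apply: ler_sum => i _; case: ifP => _ //; rewrite cmod0 cmod_ge0.
suff l0 : l = 0 by rewrite l0 in hl.
apply: cmod_eps0 => e e0.
have [s0 us0 hs0] := psummable_tail (fun i => cmod_ge0 (u i)) su e0.
pose D := (\max_(i <- s0) (a i + b i))%N.
have hD i : i \in s0 -> (a i + b i <= D)%N.
  by move=> is0; exact: (leq_bigmax_seq (F := fun i => (a i + b i)%N) i is0 isT).
(* As [N > 2 D], neither [m + a] nor [b] wraps around modulo [N] when [m <= D] and [a + b <= D],
   that is, for the indices in [s0]. *)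
pose N := D.+1.*2; have N0 : (0 < N)%N by [].
have [w pw] := prim_root_exists R N0; have w1 := cmod_prim_root N0 pw.
have NC : (N%:R : C) != 0 by rewrite pnatr_eq0.
pose kap i : C := N%:R^-1 * \sum_(j < N) \sum_(m < D) (w ^+ j) ^+ m.+1 * ((w ^+ j) ^+ a i / (w ^+ j) ^+ b i).
have kapE i : kap i = \sum_(m < D) (((m.+1 + a i) %% N)%N == (b i %% N)%N)%:R.
  rewrite /kap exchange_big mulr_sumr; apply: eq_bigr => m _ /=.
  apply: (mulfI NC); rewrite mulrA divff // mul1r.
  rewrite -(sum_prim_root N0 pw (ltn_pmod _ N0) (ltn_pmod _ N0)).
  apply: eq_bigr => j _; rewrite mulrA -exprD.
  have wj k : (w ^+ j) ^+ (k %% N) = (w ^+ j) ^+ k.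
    by rewrite -!exprM ![(j * _)%N]mulnC !exprM (prim_expr_mod pw).
  by rewrite !wj.
(* Outside [s0] aliasing may occur, but at most one [m] in [1..D] meets a given residue; the weight
   stays 0 or 1 and the tail bound is not spoiled. *)
have kap_le i : kap i = 0 \/ kap i = 1.
  rewrite kapE; have [/existsP[m hm]|/existsPn h] :=
    boolP [exists m : 'I_D, ((m.+1 + a i) %% N)%N == (b i %% N)%N]; last first.
    by left; apply: big1 => m _; rewrite (negbTE (h m)).
  right; rewrite (bigD1 m) //= hm big1 ?addr0 // => k km.
  case: eqP => // hk; case/eqP: km; apply/val_inj => /=.
  move/eqP: hm; rewrite -hk => /eqP; rewrite eqn_modDr !modn_small.
  - by rewrite eqSS => /eqP.
  - by rewrite /N; have := ltn_ord k; lia.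
  by rewrite /N; have := ltn_ord m; lia.
have kap_s0 i : i \in s0 -> kap i = (a i < b i)%:R.
  move=> /hD hi; rewrite kapE.
  transitivity (\sum_(m < D) (((m.+1 + a i)%N == b i)%:R : C)).
    apply: eq_bigr => m _; rewrite !modn_small // /N; have := ltn_ord m; lia.
  have [ab|ab] := ltnP (a i) (b i).
    have hm : (b i - a i - 1 < D)%N by lia.
    rewrite (bigD1 (Ordinal hm)) //= big1 => [|k].
      by rewrite addr0 (_ : (_ == _) = true) //; apply/eqP; lia.
    rewrite -val_eqE /= => /eqP km; case: eqP => // hk; case: km; lia.
  apply: big1 => m _; case: eqP => //; lia.
have hk : csum (fun i => u i * kap i) 0.
  have H (I : Type) (s : seq I) (g : I -> T -> C) : (forall j, csum (g j) 0) ->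
      csum (fun i => \sum_(j <- s) g j i) 0.
    move=> hg; elim: s => [|j s IH].
      have := csumZ 0 hl; rewrite mul0r; apply: eq_csum => i.
      by rewrite mul0r big_nil.
    have := csumD (hg j) IH; rewrite addr0; apply: eq_csum => i.
    by rewrite big_cons.
  have := csumZ N%:R^-1 (H _ (index_enum _) (fun j : 'I_N => fun i =>
     (\sum_(m < D) (w ^+ j) ^+ m.+1) * (u i * ((w ^+ j) ^+ a i / (w ^+ j) ^+ b i))) _).
  rewrite mulr0 => h; apply: eq_csum (h _) => [i|j].
    rewrite /kap mulrCA; congr (_ * _); rewrite mulr_sumr; apply: eq_bigr => j _.
    by rewrite mulr_suml mulr_sumr; apply: eq_bigr => m _; rewrite mulrCA.
  have wj1 : cmod (w ^+ j) = 1 by rewrite cmodX w1 expr1n.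
  by have := csumZ (\sum_(m < D) (w ^+ j) ^+ m.+1) (hu _ wj1); rewrite mulr0.
have hd := csumD hl (csumZ (-1) hk); rewrite mulr0 addr0 in hd.
have s00 : \sum_(i <- s0) ((if (a i < b i)%N then u i else 0) + -1 * (u i * kap i)) = 0.
  apply: big1_seq => i /andP[_ /kap_s0 ->].
  by case: ltnP => _; rewrite ?mulr1 ?mulr0 ?mulN1r ?subrr ?addr0.
have := csum_tail (B := e) hd us0; rewrite s00 subr0; apply => s us dis.
apply: le_trans (ltW (hs0 s us dis)); apply: ler_sum => i _.
by case: (kap_le i) => ->; case: ltnP => _;
  rewrite ?mulr1 ?mulr0 ?mulN1r ?subrr ?add0r ?cmod0 ?addr0 ?cmodN ?cmod_ge0.
Qed.

End CircleAction.

(** * Index pairs and basis monomials *)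

Section PairIndices.
Variables (R : realType) (n : nat).
Local Notation C := (R[i]).
Local Notation I := (midx n * midx n)%type.
Implicit Types (i : I) (v : 'I_(n + n) -> C).

Definition isz i : nat := (msize i.1 + msize i.2)%N.

Definition mjoin i : midx (n + n) :=
  [ffun k : 'I_(n + n) => match fintype.split k with inl j => i.1 j | inr j => i.2 j end].

Definition msplit (P : midx (n + n)) : I :=
  ([ffun j => P (lshift n j)], [ffun j => P (rshift n j)]).

Lemma mjoinK : cancel mjoin msplit.
Proof.
move=> [P Q]; rewrite /msplit; congr (_, _); apply/ffunP => j; rewrite !ffunE.
  by have := unsplitK (inl j : 'I_n + 'I_n) => /= ->.
by have := unsplitK (inr j : 'I_n + 'I_n) => /= ->.
Qed.

Lemma msplitK : cancel msplit mjoin.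
Proof.
move=> P; apply/ffunP => k; rewrite ffunE; have := splitK k.
by case: (fintype.split k) => j /= <-; rewrite ffunE.
Qed.

Lemma mjoin_lshift i j : mjoin i (lshift n j) = i.1 j.
Proof. by have := congr1 (fun q : I => q.1 j) (mjoinK i); rewrite /msplit /= ffunE. Qed.

Lemma mjoin_rshift i j : mjoin i (rshift n j) = i.2 j.
Proof. by have := congr1 (fun q : I => q.2 j) (mjoinK i); rewrite /msplit /= ffunE. Qed.

Lemma msize_mjoin i : msize (mjoin i) = isz i.
Proof.
rewrite /msize /isz big_split_ord /=; congr (_ + _)%N; apply: eq_bigr => j _.
  exact: mjoin_lshift.
exact: mjoin_rshift.
Qed.

Lemma mpow_mjoin v i : mpow v (mjoin i) =
  mpow (fun j => v (lshift n j)) i.1 * mpow (fun j => v (rshift n j)) i.2.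
Proof.
rewrite /mpow big_split_ord /=; congr (_ * _); apply: eq_bigr => j _.
  by rewrite mjoin_lshift.
by rewrite mjoin_rshift.
Qed.

(** Decrease faster than every geometric sequence, as for Taylor coefficients of entire
    functions. *)
Definition rapid (g : I -> C) := forall r : R, 0 <= r ->
  exists M, forall i, cmod (g i) * r ^+ isz i <= M.

Lemma sum_half_pow_isz (s : seq I) : uniq s -> \sum_(i <- s) (2^-1 : R) ^+ isz i <= 2 ^+ (n + n).
Proof.
move=> us; have um : uniq (map mjoin s) by rewrite map_inj_uniq //; exact: can_inj mjoinK.
have := sum_half_pow_msize R um; rewrite big_map.
by under eq_bigr do rewrite msize_mjoin.
Qed.

Lemma rapid_sum (g : I -> C) (c : R) : rapid g -> 0 <= c ->
  exists B, forall s, uniq s -> \sum_(i <- s) cmod (g i) * c ^+ isz i <= B.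
Proof.
move=> hg c0; have [|M hM] := hg (2 * c); first by rewrite mulr_ge0.
exists (M * 2 ^+ (n + n)) => s us.
have M0 : 0 <= M by apply: le_trans (hM ([ffun=> 0%N], [ffun=> 0%N])); rewrite mulr_ge0 ?cmod_ge0 ?exprn_ge0 ?mulr_ge0.
apply: le_trans (_ : \sum_(i <- s) M * 2^-1 ^+ isz i <= _); last first.
  by rewrite -mulr_sumr ler_wpM2l // sum_half_pow_isz.
apply: ler_sum => i _; rewrite -[c](mulKf (_ : 2 != 0)) ?pnatr_eq0 // exprMn mulrCA mulrC.
by rewrite ler_wpM2r ?exprn_ge0 ?invr_ge0.
Qed.

(** The extension of [f_{r,P,Q}] from the ball to all pairs [(p, q)]. Padding with powers of [p^0]
    or [q^0] equalizes the degrees in [p] and in [q], hence the invariance [rmon_scale]. *)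
Definition rmon i : Cpair R n.+1 -> C :=
  mon (mext (maxn (msize i.1) (msize i.2)) i.1) (mext (maxn (msize i.1) (msize i.2)) i.2).

Lemma mext0 m (P : midx n) : mext m P ord0 = (m - msize P)%N.
Proof. by rewrite ffunE unlift_none. Qed.

Lemma mextS m (P : midx n) j : mext m P (lift ord0 j) = P j.
Proof. by rewrite ffunE liftK. Qed.

Lemma msize_mext m (P : midx n) : (msize P <= m)%N -> msize (mext m P) = m.
Proof.
move=> Pm; rewrite {1}/msize big_ord_recl mext0.
under eq_bigr do rewrite mextS.
by rewrite -/(msize P) subnK.
Qed.

Lemma mon_recl (P Q : midx n.+1) (z : Cpair R n.+1) : mon P Q z =
  z.1 ord0 ord0 ^+ P ord0 * (\prod_(j < n) z.1 ord0 (lift ord0 j) ^+ P (lift ord0 j)) *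
  (z.2 ord0 ord0 ^+ Q ord0 * (\prod_(j < n) z.2 ord0 (lift ord0 j) ^+ Q (lift ord0 j))).
Proof. by rewrite /mon !big_ord_recl. Qed.

Lemma mon_scale (P Q : midx n.+1) (c : C) (z : Cpair R n.+1) : msize P = msize Q -> c != 0 ->
  mon P Q (c *: z.1, c^-1 *: z.2) = mon P Q z.
Proof.
move=> PQ c0; rewrite /mon /=.
under eq_bigr do rewrite mxE exprMn; rewrite big_split /= prodrXr.
under [X in _ * X]eq_bigr do rewrite mxE exprMn.
rewrite [X in _ * X]big_split /= prodrXr -/(msize P) -/(msize Q) PQ.
by rewrite mulrACA -exprMn mulfV // expr1n mul1r.
Qed.

Lemma mon_DeltaD (P Q : midx n.+1) (w : 'rV[C]_n) : msize P = msize Q ->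
  mon P Q (DeltaD w) = fPQ P Q w.
Proof.
move=> PQ; rewrite mon_recl /fPQ /wpow /DeltaD /= !mxE unlift_none expr1n mul1r.
set D := 1 - wnorm2 w.
have -> : \prod_(j < n) ((\row_j0 (if unlift ord0 j0 is Some j1 then w ord0 j1 else 1))
    ord0 (lift ord0 j)) ^+ P (lift ord0 j) = \prod_(j < n) w ord0 j ^+ mtail P j.
  by apply: eq_bigr => j _; rewrite !mxE liftK ffunE.
have -> : \prod_(j < n) ((\row_j0 ((if unlift ord0 j0 is Some j1 then (w ord0 j1)^* else 1) / D))
    ord0 (lift ord0 j)) ^+ Q (lift ord0 j) = \prod_(j < n) ((w ord0 j)^* ^+ mtail Q j) *
    \prod_(j < n) D^-1 ^+ Q (lift ord0 j).
  by rewrite -big_split /=; apply: eq_bigr => j _; rewrite !mxE liftK ffunE exprMn.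
rewrite -mulrA; congr (_ * _); rewrite mul1r mulrCA; congr (_ * _).
by rewrite prodrXr -exprD PQ /msize big_ord_recl exprVn.
Qed.

(** When [|Q| <= |P|] the padding consists of powers of [q^0], which is 1 in this chart. *)
Lemma rmon_chart_true v i : (msize i.2 <= msize i.1)%N -> rmon i (chart true v) = mpow v (mjoin i).
Proof.
move=> h; rewrite /rmon (maxn_idPl h) mon_recl !mext0 subnn expr0 mul1r !mxE unlift_none expr1n mul1r.
rewrite mpow_mjoin; congr (_ * _); apply: eq_bigr => j _; rewrite !mxE liftK mextS //.
Qed.

Lemma rmon_chart_false v i : (msize i.1 <= msize i.2)%N -> rmon i (chart false v) = mpow v (mjoin i).
Proof.
move=> h; rewrite /rmon (maxn_idPr h) mon_recl !mext0 subnn expr0 !mxE unlift_none expr1n !mul1r.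
rewrite mpow_mjoin; congr (_ * _); apply: eq_bigr => j _; rewrite !mxE liftK mextS //.
Qed.

Lemma rmon_scale i (c : C) (z : Cpair R n.+1) : c != 0 -> rmon i (c *: z.1, c^-1 *: z.2) = rmon i z.
Proof.
by move=> c0; apply: mon_scale => //; rewrite !msize_mext ?leq_maxl ?leq_maxr.
Qed.

Lemma cmod_rmon_le i (r : R) z : 1 <= r -> entries_le z r -> cmod (rmon i z) <= (r ^+ 2) ^+ isz i.
Proof.
move=> r1 hz; apply: le_trans (cmod_mon_le _ _ _ hz) _; first lra.
rewrite !msize_mext ?leq_maxl ?leq_maxr // -exprM; apply: ler_weXn2l => //.
by rewrite /isz; case: (leqP (msize i.1) (msize i.2)) => _; lia.
Qed.

End PairIndices.

(** * Series of basis monomials *)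

Section Series.
Variables (R : realType) (n : nat).
Local Notation C := (R[i]).
Local Notation I := (midx n * midx n)%type.
Implicit Types (i : I) (z : Cpair R n.+1) (g : I -> C).

Definition csumv (T : eqType) (u : T -> C) : C := xget 0 (csum u).

Lemma csumvP (T : eqType) (u : T -> C) : psummable (fun x => cmod (u x)) -> csum u (csumv u).
Proof. by move=> /csum_ex; exact: xgetPex. Qed.

Lemma csumvE (T : eqType) (u : T -> C) l : csum u l -> csumv u = l.
Proof. by move=> h; apply: csum_unique (h); exact: (xgetPex _ (ex_intro _ l h)). Qed.

Lemma entries_le_pnorm1 z : exists2 r : R, 1 <= r & entries_le z r.
Proof.
have [h1 h2] := pnorm_entries z; exists (pnorm z + 1); first by rewrite lerDr pnorm_ge0.
by split=> i; [apply: le_trans (h1 i) _|apply: le_trans (h2 i) _]; rewrite lerDl.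
Qed.

Lemma rapid_summable g z : rapid g -> psummable (fun i => cmod (g i * rmon i z)).
Proof.
move=> hg; have [r r1 hr] := entries_le_pnorm1 z.
have [|B HB] := rapid_sum hg (c := r ^+ 2); first by rewrite sqr_ge0.
exists B => s us; apply: le_trans (HB s us); apply: ler_sum => i _.
by rewrite cmodM ler_wpM2l ?cmod_ge0 // cmod_rmon_le.
Qed.

Definition series g z : C := csumv (fun i => g i * rmon i z).

Lemma seriesP g z : rapid g -> csum (fun i => g i * rmon i z) (series g z).
Proof. by move=> hg; apply: csumvP; exact: rapid_summable. Qed.

(** Differentiability holds on the whole ambient space, so the local extension that holomorphy on
    [Zhat] asks for is the series itself. *)
Lemma series_differentiable g z : rapid g -> differentiable (series g : Cpair R n.+1 -> C^o) z.
Proof.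
move=> hg; have [r r1 hr] := entries_le_pnorm1 z.
pose K := tame_cst R n.+1; have K1 : 1 <= K := tame_cst_ge1 R n.+1.
have Kr : 1 <= K * r by nra.
have [|B HB] := rapid_sum hg (c := (K * r) ^+ 2); first by rewrite sqr_ge0.
pose c0 : R := K * K ^+ (2 * n.+1).+1.
have c00 : 0 <= c0 by rewrite mulr_ge0 ?exprn_ge0 //; lra.
apply: (@tame_series _ _ _ (fun i z => g i * rmon i z)
    (fun i => c0 * (cmod (g i) * ((K * r) ^+ 2) ^+ isz i))).
- by exists (c0 * B) => s us; rewrite -mulr_sumr ler_wpM2l // HB.
- move=> i; have := tameM (tame_const (g i) z) (tame_mon (mext (maxn (msize i.1) (msize i.2)) i.1)
    (mext (maxn (msize i.1) (msize i.2)) i.2) hr r1).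
  rewrite -/K !msize_mext ?leq_maxl ?leq_maxr //; set m := maxn _ _.
  have -> : K * (cmod (g i) * (K ^+ (2 * n.+1).+1 * (K * r) ^+ (m + m))) =
      c0 * (cmod (g i) * (K * r) ^+ (m + m)) by rewrite /c0; ring.
  apply: tame_le; apply: ler_wpM2l => //; apply: ler_wpM2l; first exact: cmod_ge0.
  rewrite -exprM; apply: ler_weXn2l => //.
  have mi : (m <= isz i)%N by rewrite geq_max leq_addr leq_addl.
  by rewrite mul2n -addnn leq_add.
by move=> y; exact: seriesP.
Qed.

Lemma series_scale g (c : C) z : c != 0 -> series g (c *: z.1, c^-1 *: z.2) = series g z.
Proof.
by move=> c0; rewrite /series; congr csumv; apply/funext => i; rewrite rmon_scale.
Qed.

Lemma series_holo g : rapid g -> holo_Dhat (series g).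
Proof.
move=> hg; split=> [z _|z _ c c0]; last exact: series_scale.
exists setT, (series g : Cpair R n.+1 -> C^o); split => //; first exact: openT.
by move=> y _; exact: series_differentiable.
Qed.

Lemma differentiable_eps (f : Cpair R n.+1 -> C) z : differentiable (f : Cpair R n.+1 -> C^o) z ->
  forall e : R, 0 < e -> \forall y \near z, cmod (f y - f z) < e.
Proof.
move=> df e e0; have eC : 0 < (e%:C : C) by rewrite ltcR.
have /cvgrPdist_lt/(_ _ eC) := differentiable_continuous df.
by apply: filterS => y; rewrite normcC ltcR cmod_distC.
Qed.

Lemma holo_eps (F : Cpair R n.+1 -> C) z : holo_on_Zhat F -> Zhat z ->
  forall e : R, 0 < e -> \forall y \near z, Zhat y -> cmod (F y - F z) < e.
Proof.
move=> hF Zz e e0; have [U [f [oU Uz hf Ff]]] := hF z Zz.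
have N1 := differentiable_eps (hf z Uz) e0.
have N2 : \forall y \near z, U y by exact: open_nbhs_nbhs.
by apply: filterS (filterI N1 N2) => y [h1 h2] Zy; rewrite !Ff.
Qed.

Lemma holo_bounded (F : Cpair R n.+1 -> C) K : holo_on_Zhat F -> cpt K ->
  exists M, forall z, K z -> cmod (F z) <= M.
Proof.
move=> hF [cK KZ]; apply: (@compact_locally_bounded _ _ K (fun M z => cmod (F z) <= M)) => // z Kz.
exists (cmod (F z) + 1); have := holo_eps hF (KZ z Kz) ltr01; apply: filterS => y hy Ky M' hM'.
apply: le_trans hM'; rewrite -lerBlDl; apply: le_trans (cmod_ge_sub _ _) _.
exact: ltW (hy (KZ y Ky)).
Qed.

End Series.

(** * Expansion of holomorphic functions in the basis *)

Section Expansion.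
Variables (R : realType) (n : nat).
Local Notation C := (R[i]).
Local Notation I := (midx n * midx n)%type.
Implicit Types (i : I) (z : Cpair R n.+1) (F : Cpair R n.+1 -> C).

Let taylor_chart b F : holo_on_Zhat F -> exists alpha : I -> C,
  (forall r M : R, 0 <= r -> (forall z, chart_cpt r z -> cmod (F z) <= M) ->
     forall i, cmod (alpha i) * r ^+ isz i <= M) /\
  (forall v, csum (fun i => alpha i * mpow v (mjoin i)) (F (chart b v))).
Proof.
move=> hF; have [||a [a1 a2]] := @taylor R (n + n) (fun v => F (chart b v)).
- exact: chart_sep_entire.
- move=> r; have [M hM] := holo_bounded hF (chart_cpt_cpt n r).
  by exists M => v hv; apply: hM; exact: chart_cpt_mem.
exists (a \o @mjoin n); split.
  move=> r M r0 hM i /=; rewrite -msize_mjoin; apply: a1 => // v hv.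
  by apply: hM; exact: chart_cpt_mem.
by move=> v; exact: (csum_reindex (@mjoinK n) (@msplitK n) (a2 v)).
Qed.

(** The circle action in chart coordinates; it multiplies the monomial of index [i] by
    [w^(|P| - |Q|)], the grading to be separated. *)
Let rot (w : C) (v : 'I_(n + n) -> C) : 'I_(n + n) -> C :=
  fun k => match fintype.split k with inl _ => w * v k | inr _ => w^-1 * v k end.

Let rot_l w v j : rot w v (lshift n j) = w * v (lshift n j).
Proof. by rewrite /rot; have /= -> := unsplitK (inl j : 'I_n + 'I_n). Qed.

Let rot_r w v j : rot w v (rshift n j) = w^-1 * v (rshift n j).
Proof. by rewrite /rot; have /= -> := unsplitK (inr j : 'I_n + 'I_n). Qed.

Let mpow_rot w v i : mpow (rot w v) (mjoin i) = mpow v (mjoin i) * (w ^+ msize i.1 / w ^+ msize i.2).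
Proof.
rewrite !mpow_mjoin /mpow.
under eq_bigr do rewrite rot_l exprMn.
under [X in _ * X = _]eq_bigr do rewrite rot_r exprMn.
by rewrite !big_split /= !prodrXr exprVn -/(msize _) -/(msize _); ring.
Qed.

Let chart_form_rot w v : w != 0 -> chart_form (rot w v) = chart_form v.
Proof.
move=> w0; rewrite /chart_form; congr (_ + _); apply: eq_bigr => j _.
by rewrite rot_l rot_r mulrACA divff // mul1r.
Qed.

(** Passage from the chart [q^0 = 1] to the chart [p^0 = 1], by acting with the inverse of
    [chart_form v], which is the value of [p^0] in the former. *)
Let transition (v : 'I_(n + n) -> C) : 'I_(n + n) -> C :=
  fun k => match fintype.split k with
           | inl _ => (chart_form v)^-1 * v k | inr _ => chart_form v * v k end.

Let tr_l v j : transition v (lshift n j) = (chart_form v)^-1 * v (lshift n j).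
Proof. by rewrite /transition; have /= -> := unsplitK (inl j : 'I_n + 'I_n). Qed.

Let tr_r v j : transition v (rshift n j) = chart_form v * v (rshift n j).
Proof. by rewrite /transition; have /= -> := unsplitK (inr j : 'I_n + 'I_n). Qed.

Let chart_transition v : chart_form v != 0 ->
  chart false (transition v) =
  ((chart_form v)^-1 *: (chart true v).1, (chart_form v)^-1^-1 *: (chart true v).2).
Proof.
move=> A0; have E : chart_form (transition v) = chart_form v.
  rewrite {1}/chart_form [RHS]/chart_form; congr (_ + _); apply: eq_bigr => j _.
  by rewrite tr_l tr_r mulrACA mulVf // mul1r.
rewrite /chart E invrK; congr (_, _); apply/rowP => j; rewrite !mxE; case: unliftP => [k|] _.
- by rewrite tr_l.
- by rewrite mulVf.
- by rewrite tr_r.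
by rewrite mulr1.
Qed.

Let tr_rot w v : w != 0 -> transition (rot w v) = rot w (transition v).
Proof.
move=> w0; apply/funext => k; case: (split_ordP k) => j ->.
  by rewrite tr_l !rot_l tr_l chart_form_rot // mulrCA.
by rewrite tr_r !rot_r tr_r chart_form_rot // mulrCA.
Qed.

(** Each coefficient comes from a chart in which the basis function is a monomial, so the Cauchy
    bounds are immediate. That the series represents [F] is shown where [p^0 q^0 <> 0] and carried
    to the rest of [Zhat] by continuity of both sides. *)
Theorem expansion_exists F : holo_Dhat F -> exists g : I -> C,
  (forall r M : R, 0 <= r -> (forall z, chart_cpt r z -> cmod (F z) <= M) ->
     forall i, cmod (g i) * r ^+ isz i <= M) /\
  (forall z, Zhat z -> csum (fun i => g i * rmon i z) (F z)).
Proof.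
move=> [hF iF]; have [a [a1 a2]] := taylor_chart true hF; have [b [b1 b2]] := taylor_chart false hF.
have rap (c : I -> C) : (forall r M : R, 0 <= r -> (forall z, chart_cpt r z -> cmod (F z) <= M) ->
    forall i, cmod (c i) * r ^+ isz i <= M) -> rapid c.
  by move=> hc r r0; have [M hM] := holo_bounded hF (chart_cpt_cpt n r); exists M; exact: hc.
pose g i := if (msize i.2 <= msize i.1)%N then a i else b i.
have g1 r M : 0 <= r -> (forall z, chart_cpt r z -> cmod (F z) <= M) ->
    forall i, cmod (g i) * r ^+ isz i <= M.
  by move=> r0 hM i; rewrite /g; case: ifP => _; [exact: a1|exact: b1].
have rg := rap g g1; exists g; split => //.
(* Where [p^0 q^0 <> 0] both charts are available: compare the parts of negative degree. *)
have key v : chart_form v != 0 -> csum (fun i => g i * rmon i (chart true v)) (F (chart true v)).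
  move=> A0; have v1 := a2 v; pose v' := transition v.
  (* Both Taylor series have the same sum, being evaluated on one orbit; their difference has sum 0
     at every rotated point as well. *)
  pose u i := a i * mpow v (mjoin i) - b i * mpow v' (mjoin i).
  have su (c : I -> C) x : rapid c -> psummable (fun i => cmod (c i * mpow x (mjoin i))).
    move=> rc; pose r : R := \sum_(k < n + n) cmod (x k).
    have xr : polydisc r x.
      by move=> k; rewrite /r (bigD1 k) //= lerDl; apply: sumr_ge0 => j _; exact: cmod_ge0.
    have [|B HB] := rapid_sum rc (c := r); first by apply: sumr_ge0 => j _; exact: cmod_ge0.
    exists B => s us; apply: le_trans (HB s us); apply: ler_sum => i _.
    by rewrite cmodM ler_wpM2l ?cmod_ge0 // -msize_mjoin cmod_mpow_le.
  have psu : psummable (fun i => cmod (u i)).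
    have [B1 H1] := su a v (rap a a1); have [B2 H2] := su b v' (rap b b1).
    exists (B1 + B2) => s us; apply: le_trans (lerD (H1 s us) (H2 s us)).
    by rewrite -big_split; apply: ler_sum => i _; exact: cmodB.
  have hu (w : C) : cmod w = 1 -> csum (fun i => u i * (w ^+ msize i.1 / w ^+ msize i.2)) 0.
    move=> w1; have w0 : w != 0 by rewrite -cmod_eq0 w1 oner_eq0.
    have h1 := a2 (rot w v); have h2 := b2 (rot w v').
    have E : F (chart false (rot w v')) = F (chart true (rot w v)).
      rewrite /v' -tr_rot // chart_transition ?chart_form_rot // iF ?invr_eq0 //.
      exact: chart_Zhat.
    have := csumD h1 (csumZ (-1) h2); rewrite E mulN1r subrr; apply: eq_csum => i.
    by rewrite !mpow_rot /u; ring.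
  have := csumD v1 (csumZ (-1) (csum_neg_degree psu hu)); rewrite mulr0 addr0.
  apply: eq_csum => i; rewrite /g; case: ltnP => h; last first.
    by rewrite mulr0 addr0 rmon_chart_true.
  have -> : rmon i (chart true v) = mpow v' (mjoin i).
    by rewrite -(rmon_chart_false v' (ltnW h)) /v' chart_transition // rmon_scale // invr_eq0.
  by rewrite /u mulN1r opprB addrC subrK.
have key2 z : Zhat z -> z.1 ord0 ord0 != 0 -> z.2 ord0 ord0 != 0 ->
    csum (fun i => g i * rmon i z) (F z).
  move=> Zz p0 q0.
  (* Chart coordinates of the point obtained by acting with the scalar [q^0], which normalizes the
     zeroth entry of [q] to 1. *)
  pose v k := match fintype.split k with inl j => z.2 ord0 ord0 * z.1 ord0 (lift ord0 j)
    | inr j => (z.2 ord0 ord0)^-1 * z.2 ord0 (lift ord0 j) end.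
  have vl j : v (lshift n j) = z.2 ord0 ord0 * z.1 ord0 (lift ord0 j).
    by rewrite /v; have /= -> := unsplitK (inl j : 'I_n + 'I_n).
  have vr j : v (rshift n j) = (z.2 ord0 ord0)^-1 * z.2 ord0 (lift ord0 j).
    by rewrite /v; have /= -> := unsplitK (inr j : 'I_n + 'I_n).
  have A : chart_form v = z.2 ord0 ord0 * z.1 ord0 ord0.
    rewrite /chart_form; under eq_bigr do rewrite vl vr mulrACA divff // mul1r.
    by move: Zz; rewrite /Zhat /= hform_recl => /eqP; rewrite addrC subr_eq => /eqP ->; ring.
  have E : chart true v = (z.2 ord0 ord0 *: z.1, (z.2 ord0 ord0)^-1 *: z.2).
    rewrite /chart A; congr (_, _); apply/rowP => j; rewrite !mxE; case: unliftP => [k|] -> //.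
    by rewrite mulVf.
  have := key v; rewrite A mulf_neq0 // E iF // => /(_ isT); apply: eq_csum => i.
  by rewrite rmon_scale.
suff cont z : Zhat z -> F z = series g z by move=> z Zz; rewrite cont //; exact: seriesP.
move=> Zz; set p0 := z.1 ord0 ord0; set q0 := z.2 ord0 ord0.
have [pq0|] := eqVneq (p0 * q0) 0; last first.
  rewrite mulf_eq0 negb_or => /andP[h1 h2].
  exact: csum_unique (key2 z Zz h1 h2) (seriesP z rg).
have pq1 : \sum_(j < n) z.1 ord0 (lift ord0 j) * z.2 ord0 (lift ord0 j) = -1.
  by move: Zz; rewrite /Zhat /= hform_recl pq0 oppr0 add0r.
(* A curve in [Zhat] through [z]: as [p^0 q^0 = 0], the spatial parts pair to -1, so rescaling the
   spatial [q] by [1 - (p^0 + t)(q^0 + t)] preserves the equation while both zeroth entries move. *)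
pose y (t : C) : Cpair R n.+1 :=
  (\row_j (if unlift ord0 j is Some k then z.1 ord0 j else p0 + t),
   \row_j (if unlift ord0 j is Some k then (1 - (p0 + t) * (q0 + t)) * z.2 ord0 j else q0 + t)).
have Zy t : Zhat (y t).
  rewrite /Zhat /= hform_recl !mxE unlift_none.
  under eq_bigr do rewrite !mxE liftK mulrCA.
  by rewrite -mulr_sumr pq1; ring.
have ynear (A : set (Cpair R n.+1)) : nbhs z A -> exists2 d : R, 0 < d & forall t, cmod t < d -> A (y t).
  move=> /nbhs_entries[r r0 hr].
  pose K : R := cmod p0 + cmod q0 + 1; pose L : R := pnorm z + 1.
  have K0 : 1 <= K by rewrite /K; have := cmod_ge0 p0; have := cmod_ge0 q0; lra.
  have L0 : 1 <= L by rewrite /L; have := pnorm_ge0 z; lra.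
  exists (Num.min 1 (r / (K * L + 1))); first by rewrite lt_min ltr01 divr_gt0 //; nra.
  move=> t; rewrite lt_min ltr_pdivlMr; last nra.
  move=> /andP[t1 t2]; have t0 := cmod_ge0 t.
  have KL : 0 <= K * L by apply: mulr_ge0; lra.
  have tKL := mulr_ge0 t0 KL; rewrite mulrDr mulr1 in t2.
  have tr : cmod t < r by lra.
  apply: hr => j; rewrite mxE; case: unliftP => [k|] ->.
  - by rewrite subrr cmod0.
  - by rewrite /p0 addrC addKr.
  - have -> : (1 - (p0 + t) * (q0 + t)) * z.2 ord0 (lift ord0 k) - z.2 ord0 (lift ord0 k) =
        - (t * (p0 + q0 + t) * z.2 ord0 (lift ord0 k)) - p0 * q0 * z.2 ord0 (lift ord0 k) by ring.
    rewrite pq0 mul0r subr0 cmodN !cmodM.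
    have h1 : cmod (p0 + q0 + t) <= K.
      by apply: le_trans (cmodD _ _) _; have := cmodD p0 q0; rewrite /K; lra.
    have h2 : cmod (z.2 ord0 (lift ord0 k)) <= L.
      by have [_ h] := pnorm_entries z; have := h (lift ord0 k); rewrite /L; lra.
    have h3 := ler_pM (cmod_ge0 _) (cmod_ge0 _) h1 h2.
    rewrite -mulrA; apply: le_lt_trans (ler_wpM2l t0 h3) _; lra.
  by rewrite /q0 addrC addKr.
apply/eqP; rewrite -subr_eq0; apply/eqP; apply: cmod_eps0 => e e0.
have e2 : 0 < e / 2 by lra.
have [d d0 hd] := ynear _ (filterI (holo_eps hF Zz e2) (differentiable_eps (series_differentiable z rg) e2)).
(* Each of [p0 + t] and [q0 + t] vanishes for at most one of three distinct values of [t], so one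
   value is good for both. *)
have [t [td tp tq]] : exists t : C, [/\ cmod t < d, p0 + t != 0 & q0 + t != 0].
  pose t0 : C := (d / 2)%:C; pose t1 : C := (d / 3)%:C; pose t2 : C := (d / 4)%:C.
  have [ht0 ht1 ht2] : [/\ cmod t0 < d, cmod t1 < d & cmod t2 < d].
    by rewrite !cmod_real !gtr0_norm; try split; lra.
  have ne (s s' : R) : s != s' -> forall x : C, (x + s%:C != 0) || (x + s'%:C != 0).
    move=> ss x; rewrite -negb_and; apply: contra ss => /andP[/eqP h1 /eqP h2].
    by apply/eqP/(@complexI R)/(@addrI _ x); rewrite h1 h2.
  have n01 : d / 2 != d / 3 by apply/eqP; lra.
  have n02 : d / 2 != d / 4 by apply/eqP; lra.
  have n12 : d / 3 != d / 4 by apply/eqP; lra.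
  move: (ne _ _ n01 p0) (ne _ _ n02 p0) (ne _ _ n12 p0) (ne _ _ n01 q0) (ne _ _ n02 q0) (ne _ _ n12 q0).
  rewrite -/t0 -/t1 -/t2.
  case P0 : (p0 + t0 != 0); case P1 : (p0 + t1 != 0); case P2 : (p0 + t2 != 0);
  case Q0 : (q0 + t0 != 0); case Q1 : (q0 + t1 != 0); case Q2 : (q0 + t2 != 0) => //= _ _ _ _ _ _;
  first [by exists t0; split => //; rewrite ?P0 ?Q0|by exists t1; split => //; rewrite ?P1 ?Q1|
         by exists t2; split => //; rewrite ?P2 ?Q2].
have [h1 h2] := hd t td.
have := h1 (Zy t); rewrite (csum_unique (key2 (y t) (Zy t) _ _) (seriesP (y t) rg)); last 2 first.
- by rewrite mxE unlift_none.
- by rewrite mxE unlift_none.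
move=> h3; have := cmod_triangle (F z) (series g (y t)) (series g z).
by have := cmod_distC (F z) (series g (y t)); lra.
Qed.

End Expansion.

(** * Polynomials in variables and their conjugates *)

Section RealPoints.
Variable R : realType.
Local Notation C := (R[i]).

Definition polynomial1 (f : C -> C) := exists p : {poly C}, forall w, f w = p.[w].

Lemma polynomial1M f g : polynomial1 f -> polynomial1 g -> polynomial1 (fun w => f w * g w).
Proof. by move=> [p hp] [q hq]; exists (p * q) => w; rewrite hornerM hp hq. Qed.

Lemma polynomial1X f k : polynomial1 f -> polynomial1 (fun w => f w ^+ k).
Proof. by move=> [p hp]; exists (p ^+ k) => w; rewrite horner_exp hp. Qed.

Lemma polynomial1_prod (T : Type) (s : seq T) (f : T -> C -> C) : (forall i, polynomial1 (f i)) ->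
  polynomial1 (fun w => \prod_(i <- s) f i w).
Proof.
move=> /choice[p hp]; exists (\prod_(i <- s) p i) => w.
by rewrite horner_prod; apply: eq_bigr => i _.
Qed.

Lemma polynomial1_sum (T : Type) (s : seq T) (f : T -> C -> C) : (forall i, polynomial1 (f i)) ->
  polynomial1 (fun w => \sum_(i <- s) f i w).
Proof.
move=> /choice[p hp]; exists (\sum_(i <- s) p i) => w.
by rewrite horner_sum; apply: eq_bigr => i _.
Qed.

Lemma poly_nat_roots (p : {poly C}) : (forall k : nat, p.[k%:R] = 0) -> p = 0.
Proof.
move=> hp; apply/eqP; apply: contraT => p0.
have := @max_poly_roots _ p [seq k%:R | k <- iota 0 (size p)] p0.
rewrite size_map size_iota ltnn => h; apply: h.
  by apply/allP => _ /mapP[k _ ->]; apply/rootP.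
by rewrite map_inj_uniq ?iota_uniq // => a b /eqP; rewrite eqr_nat => /eqP.
Qed.

(** The coordinates are freed one at a time: with the others fixed, a polynomial in one coordinate
    that vanishes at all natural numbers is 0. *)
Lemma eq0_real_points d (h : ('I_d -> C) -> C) :
  (forall x i, polynomial1 (fun w => h (upd x i w))) ->
  (forall x, (forall i, exists r : R, x i = r%:C) -> h x = 0) -> forall x, h x = 0.
Proof.
move=> hp h0.
have H k : forall x, (forall i : 'I_d, (k <= i)%N -> exists r : R, x i = r%:C) -> h x = 0.
  elim: k => [|k IH] x hx; first by apply: h0 => i; exact: hx.
  have [kd|dk] := ltnP k d; last first.
    by apply: IH => i ki; have := ltn_ord i; lia.
  have [p Ep] := hp x (Ordinal kd).
  have p0 : p = 0.
    apply: poly_nat_roots => j; rewrite -Ep; apply: IH => i ki; rewrite /upd.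
    case: eqP => [_|ne]; first by exists j%:R; rewrite rmorph_nat.
    apply: hx; rewrite ltn_neqAle ki andbT; apply/eqP => E; apply: ne.
    exact/val_inj.
  have := Ep (x (Ordinal kd)); rewrite p0 horner0 => <-; congr h.
  by apply/funext => i; rewrite /upd; case: eqP => [->|].
by move=> x; apply: (H d) => i; rewrite leqNgt ltn_ord.
Qed.

(** With [v = x + i y], the identity known for real [x], [y] extends to complex ones, where
    [x + i y] and [x - i y] are independent variables; [pcoef_bound] with [M = 0] then annihilates
    every coefficient. *)
Lemma conj_poly_eq0 n (s : seq (midx n * midx n)) (g : midx n * midx n -> C) : uniq s ->
  (forall v : 'I_n -> C, \sum_(i <- s) g i * (mpow v i.1 * mpow (fun j => Num.conj (v j)) i.2) = 0) ->
  forall i, i \in s -> g i = 0.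
Proof.
move=> us hs.
pose xi (x : 'I_(n + n) -> C) j := x (lshift n j) + 'i%C * x (rshift n j).
pose eta (x : 'I_(n + n) -> C) j := x (lshift n j) - 'i%C * x (rshift n j).
pose h x := \sum_(i <- s) g i * (mpow (xi x) i.1 * mpow (eta x) i.2).
have h0 x : h x = 0.
  apply: eq0_real_points => {}x.
    move=> k; apply: polynomial1_sum => i; apply: polynomial1M.
      by exists (g i)%:P => w; rewrite hornerC.
    have aff (c : C) j : polynomial1 (fun w => upd x k w (lshift n j) + c * upd x k w (rshift n j)).
      have u1 l : polynomial1 (fun w => upd x k w l).
        rewrite /upd; case: eqP => _; first by exists 'X => w; rewrite hornerX.
        by exists (x l)%:P => w; rewrite hornerC.
      have [p hp] := u1 (lshift n j); have [q hq] := u1 (rshift n j).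
      by exists (p + c%:P * q) => w; rewrite !hornerE hp hq.
    apply: polynomial1M; apply: polynomial1_prod => j; apply: polynomial1X; first exact: aff.
    have := aff (- 'i%C) j; rewrite /polynomial1 => -[p hp]; exists p => w.
    by rewrite -hp mulNr.
  move=> hx; rewrite -[RHS](hs (xi x)); apply: eq_bigr => i _; congr (_ * (_ * _)).
  apply: eq_bigr => j _; congr (_ ^+ _); rewrite /xi /eta conjCE.
  have [a ->] := hx (lshift n j); have [b ->] := hx (rshift n j).
  by apply/eqP; rewrite eq_complex /=; apply/andP; split; apply/eqP; ring.
move=> i is_; pose t := [seq (g k, mjoin k) | k <- s].
have ht x : peval t x = 0.
  have i2 : 'i%C * 'i%C = -1 :> C by rewrite -expr2 sqr_i.
  have two0 : (2 : C) != 0 by rewrite pnatr_eq0.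
  pose y : 'I_(n + n) -> C := fun k => match fintype.split k with
    | inl j => (x (lshift n j) + x (rshift n j)) / 2
    | inr j => - 'i%C * (x (lshift n j) - x (rshift n j)) / 2 end.
  have yl j : y (lshift n j) = (x (lshift n j) + x (rshift n j)) / 2.
    by rewrite /y; have /= -> := unsplitK (inl j : 'I_n + 'I_n).
  have yr j : y (rshift n j) = - 'i%C * (x (lshift n j) - x (rshift n j)) / 2.
    by rewrite /y; have /= -> := unsplitK (inr j : 'I_n + 'I_n).
  rewrite -[RHS](h0 y) /peval big_map; apply: eq_bigr => k _ /=; rewrite mpow_mjoin.
  congr (_ * (_ * _)); apply: eq_bigr => j _; congr (_ ^+ _); rewrite /xi /eta yl yr.
    by field: i2.
  by field: i2.
have H : cmod (pcoef t (mjoin i)) <= 0.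
  rewrite -[leLHS]mulr1 -(expr1n _ (msize (mjoin i))).
  by apply: pcoef_bound => // x _; rewrite ht cmod0.
have -> : g i = pcoef t (mjoin i).
  rewrite /pcoef big_map big_mkcond /= (bigD1_seq i) //= eqxx big1 ?addr0 // => k ki.
  by rewrite (inj_eq (can_inj (@mjoinK n))) (negbTE ki).
by apply/eqP; rewrite -cmod_eq0 eq_le H cmod_ge0.
Qed.

End RealPoints.

(** * The ball determines a function on the complexified disc *)

Section Uniqueness.
Variables (R : realType) (n : nat).
Local Notation C := (R[i]).
Local Notation I := (midx n * midx n)%type.
Implicit Types (i : I).

Definition isz_seq m : seq I :=
  [seq i <- [seq ([ffun j => nat_of_ord (t.1 j)], [ffun j => nat_of_ord (t.2 j)])
            | t : {ffun 'I_n -> 'I_m.+1} * {ffun 'I_n -> 'I_m.+1}] | isz i == m].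

Lemma isz_seqP m i : (i \in isz_seq m) = (isz i == m).
Proof.
rewrite mem_filter; case: eqP => //= im; apply/fintype.imageP.
have msz (P : midx n) j : (P j <= msize P)%N by rewrite /msize (bigD1 j) //= leq_addr.
have h1 j : (i.1 j < m.+1)%N.
  by rewrite ltnS -im; apply: leq_trans (msz _ _) _; rewrite leq_addr.
have h2 j : (i.2 j < m.+1)%N.
  by rewrite ltnS -im; apply: leq_trans (msz _ _) _; rewrite leq_addl.
exists ([ffun j => Ordinal (h1 j)], [ffun j => Ordinal (h2 j)]) => //.
by case: (i) h1 h2 => P Q h1 h2; congr (_, _); apply/ffunP => j; rewrite !ffunE.
Qed.

Lemma wnorm2_real (w : 'rV[C]_n) : wnorm2 w = (\sum_j cmod (w ord0 j) ^+ 2)%:C.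
Proof.
rewrite /wnorm2 rmorph_sum; apply: eq_bigr => j _.
by rewrite rmorphXn /= -normcC sqr_normc.
Qed.

(** Induction on the degree [m]: at the point [t v] with [t] tending to 0 the terms of degree [m]
    dominate and the powers of [1 - |t v|^2] tend to 1, so the leading form in [v] and its conjugate
    vanishes identically and [conj_poly_eq0] applies. *)
Theorem series_ball_eq0 (g : I -> C) : rapid g ->
  (forall w, @ball_n R n w -> series g (DeltaD w) = 0) -> forall i, g i = 0.
Proof.
move=> rg hg.
suff H m : forall i, isz i = m -> g i = 0 by move=> i; exact: (H (isz i)).
elim/ltn_ind: m => m IH i im.
apply: (conj_poly_eq0 (s := undup (isz_seq m))); first exact: undup_uniq; last first.
  by rewrite mem_undup isz_seqP im.
move=> v; set s0 := undup _.
pose vn : R := \sum_j cmod (v j) ^+ 2; pose vr : R := 1 + \sum_j cmod (v j).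
have vn0 : 0 <= vn by apply: sumr_ge0 => j _; rewrite sqr_ge0.
have sv0 : 0 <= \sum_j cmod (v j) by apply: sumr_ge0 => j _; exact: cmod_ge0.
have vr0 : 0 <= vr by rewrite /vr; lra.
have hv j : cmod (v j) <= vr.
  rewrite /vr (bigD1 j) //=; have : 0 <= \sum_(i < n | i != j) cmod (v i).
    by apply: sumr_ge0 => k _; exact: cmod_ge0.
  by lra.
pose M k : C := mpow v k.1 * mpow (fun j => Num.conj (v j)) k.2.
have hM k : cmod (M k) <= vr ^+ isz k.
  rewrite /M cmodM exprD; apply: ler_pM; rewrite ?cmod_ge0 //; apply: cmod_mpow_le => //.
  by move=> j; rewrite conjCE cmodJ.
have [|B HB] := rapid_sum rg (c := 2 * vr); first by rewrite mulr_ge0.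
have B0 : 0 <= B by have := HB [::] isT; rewrite big_nil.
pose L : R := \sum_(k <- s0) cmod (g k * M k).
have L0 : 0 <= L by apply: sumr_ge0 => k _; exact: cmod_ge0.
apply: cmod_eps0 => e e0.
(* The error is [t B] from higher degrees ([A2]) plus [2 (vn + 1) t m 2^m L] from replacing [sg] by
   1 ([A3]); [t <= 1 / (2 (vn + 1))] keeps [t v] in the ball and [sg <= 2]. *)
pose t : R := Num.min 1 (Num.min (1 / (2 * (vn + 1))) (e / (B + 2 * (vn + 1) * (m%:R * 2 ^+ m) * L + 1))).
have D0 : 0 < B + 2 * (vn + 1) * (m%:R * 2 ^+ m) * L + 1.
  by rewrite ltr_wpDl // addr_ge0 // !mulr_ge0 // ?exprn_ge0 //; lra.
have t0 : 0 < t by rewrite !lt_min ltr01 !divr_gt0 //; lra.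
have : t <= t by [].
rewrite {2}/t !le_min => /and3P[t1 t2 t3].
move: t2 t3; rewrite !ler_pdivlMr //; last lra; move=> t2 t3.
have tt : t ^+ 2 <= t by rewrite expr2 ler_piMl // ltW.
have tvn : t ^+ 2 * vn <= 1 / 2 by nra.
pose w : 'rV[C]_n := \row_j (t%:C * v j).
have wn : wnorm2 w = (t ^+ 2 * vn)%:C.
  rewrite wnorm2_real /vn mulr_sumr; congr (_%:C); apply: eq_bigr => j _.
  by rewrite mxE cmodM cmod_real ger0_norm ?(ltW t0) // exprMn.
have wJ j : Num.conj (w ord0 j) = t%:C * Num.conj (v j).
  rewrite mxE !conjCE; case: (v j) => a b; apply/eqP; rewrite eq_complex /=.
  by apply/andP; split; apply/eqP; ring.
have wb : @ball_n R n w by rewrite /ball_n /= wn -[1]/(1%:C) ltcR; lra.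
pose sg : R := (1 - t ^+ 2 * vn)^-1.
have q0 : 0 < 1 - t ^+ 2 * vn by lra.
have sg2 : sg <= 2 by rewrite /sg -[2]invrK lef_pV2 ?posrE //; lra.
have sg1 : 1 <= sg by rewrite /sg -[1]invr1 lef_pV2 ?posrE //; have := sqr_ge0 t; nra.
have sgd : sg - 1 <= 2 * (vn + 1) * t.
  have -> : sg - 1 = t ^+ 2 * vn * sg by rewrite /sg; field; rewrite gt_eqF.
  have h : t ^+ 2 * vn <= t * (vn + 1) by nra.
  have : t ^+ 2 * vn * sg <= t * (vn + 1) * 2 by apply: ler_pM => //; [apply: mulr_ge0 => //; exact: sqr_ge0|lra].
  lra.
pose mm (k : I) : nat := maxn (msize k.1) (msize k.2).
have rE k : rmon k (DeltaD w) = (t ^+ isz k * sg ^+ mm k)%:C * M k.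
  rewrite /rmon mon_DeltaD ?msize_mext ?leq_maxl ?leq_maxr //.
  rewrite /fPQ msize_mext ?leq_maxl // wn -/(mm k) /wpow /M /mpow.
  have -> : \prod_(j < n) w ord0 j ^+ mtail (mext (mm k) k.1) j = t%:C ^+ msize k.1 * \prod_(j < n) v j ^+ k.1 j.
    rewrite -prodrXr -big_split /=; apply: eq_bigr => j _.
    by rewrite mxE exprMn ffunE mextS.
  have -> : \prod_(j < n) (w ord0 j)^* ^+ mtail (mext (mm k) k.2) j = t%:C ^+ msize k.2 * \prod_(j < n) (v j)^* ^+ k.2 j.
    rewrite -prodrXr -big_split /=; apply: eq_bigr => j _.
    by rewrite wJ exprMn ffunE mextS.
  have -> : 1 - (t ^+ 2 * vn)%:C = (1 - t ^+ 2 * vn)%:C by rewrite rmorphB rmorph1.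
  rewrite rmorphM !rmorphXn /= /sg fmorphV /= exprVn /isz exprD.
  by ring.
have cs := seriesP (DeltaD w) rg; rewrite (hg w wb) in cs.
have tm0 : 0 <= t ^+ m by rewrite exprn_ge0 // ltW.
have A1 : cmod (\sum_(k <- s0) g k * rmon k (DeltaD w)) <= t ^+ m.+1 * B.
  rewrite -cmodN -[X in cmod X]add0r; apply: csum_tail cs (undup_uniq _) _ => s us dis.
  apply: le_trans (_ : t ^+ m.+1 * \sum_(k <- s) cmod (g k) * (2 * vr) ^+ isz k <= _); last first.
    by rewrite ler_wpM2l ?HB // exprn_ge0 // ltW.
  rewrite mulr_sumr big_seq [leRHS]big_seq; apply: ler_sum => k ks.
  have [km|km] := ltnP (isz k) m.
    by rewrite (IH _ km k erefl) mul0r !cmod0 mul0r mulr0.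
  have {}km : (m < isz k)%N.
    rewrite ltn_neqAle km andbT eq_sym; apply/negP => km'.
    by have := dis k ks; rewrite mem_undup isz_seqP km'.
  rewrite rE cmodM [X in _ * X]cmodM [leRHS]mulrCA ler_wpM2l ?cmod_ge0 // cmod_real ger0_norm; last first.
    by rewrite mulr_ge0 ?exprn_ge0 ?(ltW t0) //; lra.
  rewrite exprMn [leRHS]mulrA; apply: ler_pM (cmod_ge0 _) _ (hM k).
    by rewrite mulr_ge0 ?exprn_ge0 ?(ltW t0) //; lra.
  apply: ler_pM; rewrite ?exprn_ge0 ?(ltW t0) //; first lra.
    by apply: ler_wiXn2l => //; rewrite ltW.
  apply: le_trans (_ : 2 ^+ mm k <= _); first by rewrite lerXn2r ?nnegrE //; lra.
  by apply: ler_weXn2l; [lra|rewrite geq_max leq_addr leq_addl].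
have A2 : cmod (\sum_(k <- s0) (sg ^+ mm k)%:C * (g k * M k)) <= t * B.
  have tmp : 0 < t ^+ m by rewrite exprn_gt0.
  rewrite -(ler_pM2l tmp) mulrA -exprSr; apply: le_trans A1.
  have -> : \sum_(k <- s0) g k * rmon k (DeltaD w) = (t ^+ m)%:C * \sum_(k <- s0) (sg ^+ mm k)%:C * (g k * M k).
    rewrite mulr_sumr big_seq [RHS]big_seq; apply: eq_bigr => k.
    by rewrite mem_undup isz_seqP => /eqP km; rewrite rE km rmorphM /=; ring.
  by rewrite cmodM cmod_real ger0_norm.
have A3 : cmod (\sum_(k <- s0) (sg ^+ mm k - 1)%:C * (g k * M k)) <= 2 * (vn + 1) * t * (m%:R * 2 ^+ m) * L.
  apply: le_trans (cmod_sum _ _ _) _; rewrite /L mulr_sumr big_seq [leRHS]big_seq; apply: ler_sum => k.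
  rewrite mem_undup isz_seqP => /eqP km; rewrite cmodM ler_wpM2r ?cmod_ge0 // cmod_real.
  have mk : (mm k <= m)%N by rewrite -km geq_max leq_addr leq_addl.
  rewrite subrX1 normrM ger0_norm; last lra.
  apply: ler_pM; rewrite ?normr_ge0 //; first lra.
  apply: le_trans (ler_norm_sum _ _ _) _.
  apply: le_trans (_ : \sum_(j < mm k) 2 ^+ m <= _).
    apply: ler_sum => j _; rewrite normrX ger0_norm; last lra.
    apply: le_trans (_ : 2 ^+ j <= _); first by rewrite lerXn2r ?nnegrE //; lra.
    by apply: ler_weXn2l; [lra|exact: leq_trans (ltnW (ltn_ord j)) mk].
  by rewrite sumr_const card_ord -[_ *+ mm k]mulr_natl ler_wpM2r ?exprn_ge0 // ler_nat.
have -> : \sum_(k <- s0) g k * (mpow v k.1 * mpow (fun j => Num.conj (v j)) k.2) =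
   \sum_(k <- s0) (sg ^+ mm k)%:C * (g k * M k) - \sum_(k <- s0) (sg ^+ mm k - 1)%:C * (g k * M k).
  by rewrite -sumrB; apply: eq_bigr => k _; rewrite rmorphB /= rmorph1 -/(M k); ring.
apply: le_trans (cmodB _ _) _; lra.
Qed.

Lemma DeltaD_Zhat (w : 'rV[C]_n) : ball_n w -> Zhat (DeltaD w).
Proof.
move=> wb; rewrite /Zhat /= hform_recl !mxE unlift_none.
under eq_bigr do rewrite !mxE liftK mulrA.
have n0 : 1 - wnorm2 w != 0 by rewrite subr_eq0 eq_sym lt_eqF.
by rewrite -mulr_suml -/(wnorm2 w); field.
Qed.

Lemma rapid_lin (g g' : I -> C) (c : C) : rapid g -> rapid g' -> rapid (fun i => g i + c * g' i).
Proof.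
move=> h h' r r0; have [M1 h1] := h r r0; have [M2 h2] := h' r r0; exists (M1 + cmod c * M2) => i.
have p : 0 <= r ^+ isz i by rewrite exprn_ge0.
apply: le_trans (ler_wpM2r p (cmodD _ _)) _; rewrite mulrDl cmodM -mulrA.
by apply: lerD => //; rewrite ler_wpM2l ?cmod_ge0.
Qed.

Lemma series_lin (g g' : I -> C) (c : C) z : rapid g -> rapid g' ->
  series (fun i => g i + c * g' i) z = series g z + c * series g' z.
Proof.
move=> h h'; apply: csumvE; apply: eq_csum (csumD (seriesP z h) (csumZ c (seriesP z h'))) => i.
by rewrite mulrDl mulrA.
Qed.

Lemma holo_expansion (F : Cpair R n.+1 -> C) : holo_Dhat F -> exists g, [/\ rapid g,
  forall (r M : R), 0 <= r -> (forall z, chart_cpt r z -> cmod (F z) <= M) ->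
     forall i, cmod (g i) * r ^+ isz i <= M &
  forall z, Zhat z -> F z = series g z].
Proof.
move=> hF; have [g [g1 g2]] := expansion_exists hF; have rg : rapid g.
  have [hZ _] := hF; move=> r r0; have [M hM] := holo_bounded hZ (chart_cpt_cpt n r).
  by exists M; exact: g1.
by exists g; split=> // z Zz; apply: csum_unique (g2 z Zz) (seriesP z rg).
Qed.

(** This makes the chosen extension [hat] independent of the choice on [Zhat]. *)
Lemma holo_Dhat_unique (F G : Cpair R n.+1 -> C) : holo_Dhat F -> holo_Dhat G ->
  (forall w, @ball_n R n w -> F (DeltaD w) = G (DeltaD w)) -> forall z, Zhat z -> F z = G z.
Proof.
move=> hF hG FG z Zz.
have [f [rf _ Ff]] := holo_expansion hF; have [g [rg _ Gg]] := holo_expansion hG.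
suff fg : f = g by rewrite Ff // Gg // fg.
apply/funext => i; apply/eqP; rewrite -subr_eq0 -mulN1r; apply/eqP.
apply: (@series_ball_eq0 (fun i => f i + (-1) * g i)); first exact: rapid_lin.
move=> w wb; have Zw := DeltaD_Zhat wb.
by rewrite series_lin // -Ff // -Gg // FG // mulN1r subrr.
Qed.

End Uniqueness.

(** * The star product on polynomials *)

Section FallingFactorial.
Variable A : comNzRingType.
Implicit Types a x y : A.

Definition ffact a k : A := \prod_(j < k) (a - j%:R).

Lemma ffactS a k : ffact a k.+1 = ffact a k * (a - k%:R).
Proof. by rewrite /ffact big_ord_recr. Qed.

Lemma ffactD a r k : ffact a (r + k) = ffact a r * ffact (a - r%:R) k.
Proof.
elim: k => [|k IH]; first by rewrite addn0 {3}/ffact big_ord0 mulr1.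
by rewrite addnS !ffactS IH natrD opprD addrA mulrA.
Qed.

Lemma ffact_nat s t : ffact s%:R t = (s ^_ t)%:R.
Proof.
elim: t => [|t IH]; first by rewrite /ffact big_ord0 ffactn0.
rewrite ffactS IH ffactnSr natrM; have [ts|st] := leqP t s; first by rewrite natrB.
by rewrite ffact_small // !mul0r.
Qed.

(** Since [x + y - p = (y - t) + (x - (p - t))], the new factor raises one of the two falling
    factorials, and Pascal's rule collects the terms. *)
Lemma ffact_vandermonde x y p :
  ffact (x + y) p = \sum_(t < p.+1) 'C(p, t)%:R * ffact y t * ffact x (p - t).
Proof.
elim: p => [|p IH].
  by rewrite big_ord_recl big_ord0 /= bin0 addr0 /ffact !big_ord0 !mulr1.
rewrite ffactS IH mulr_suml.
have E (t : 'I_p.+1) : 'C(p, t)%:R * ffact y t * ffact x (p - t) * (x + y - p%:R) =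
   'C(p, t)%:R * ffact y t.+1 * ffact x (p - t) + 'C(p, t)%:R * ffact y t * ffact x (p.+1 - t).
  have tp : (t <= p)%N by rewrite -ltnS.
  rewrite subSn // !ffactS natrB //; ring.
under eq_bigr do rewrite E.
rewrite big_split /= [X in _ + X]big_ord_recl [RHS]big_ord_recl /= !bin0 addrCA; congr (_ + _).
rewrite big_ord_recr [X in _ = X]big_ord_recr /= !binn.
rewrite addrAC -big_split /=; congr (_ + _).
apply: eq_bigr => t _; rewrite /bump /= add1n subSS binS natrD; ring.
Qed.

(* The contraction weights [C(p,t) C(s,t) t!] of the Wick product are those that
   re-expand a product of two shifted falling factorials. *)
Lemma ffact_wick a p r s : ffact (a - r%:R + s%:R) p * ffact a r =
  \sum_(t < p.+1) ('C(p, t) * 'C(s, t) * t`!)%:R * ffact a (p + r - t).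
Proof.
rewrite ffact_vandermonde mulr_suml; apply: eq_bigr => t _.
have tp : (t <= p)%N by rewrite -ltnS.
have -> : (p + r - t = r + (p - t))%N by lia.
rewrite ffactD ffact_nat -bin_ffact !natrM; ring.
Qed.

End FallingFactorial.

(** * The operator representation of the star product *)

Section Wick.
Variables (R : realType) (n : nat) (z : R[i]).
Local Notation C := (R[i]).
Local Notation M := (midx n.+1).
Local Notation ph := (pochhammer z).
Hypothesis ph0 : forall k, ph k != 0.

Definition hsgn (i : 'I_n.+1) : C := if i == ord0 then -1 else 1.

Lemma hsgn2 i : hsgn i * hsgn i = 1.
Proof. by rewrite /hsgn; case: eqP => _; rewrite ?mulrNN mulr1. Qed.

Definition madd (P Q : M) : M := [ffun i => (P i + Q i)%N].
Definition munit (i : 'I_n.+1) : M := [ffun j => (j == i) : nat].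

Lemma msize_madd (P Q : M) : msize (madd P Q) = (msize P + msize Q)%N.
Proof. by rewrite /msize -big_split; apply: eq_bigr => i _; rewrite ffunE. Qed.

Lemma msize_munit i : msize (munit i) = 1%N.
Proof. by rewrite /msize (bigD1 i) //= ffunE eqxx big1 // => j /negbTE h; rewrite ffunE h. Qed.

(* The operators by which [f_{P,Q}] acts on the monomials [y^A] of degree [-z]. *)
Definition tau_coef (P : M) (A : 'I_n.+1 -> C) : C :=
  (\prod_i (hsgn i ^+ P i * ffact (A i) (P i))) / ph (msize P).

(** This is the transposed operator: [u] assigns a number to each exponent vector, so compositions
    appear in reverse order. *)
Definition tau (P Q : M) (u : ('I_n.+1 -> C) -> C) (A : 'I_n.+1 -> C) : C :=
  tau_coef P A * u (fun i => A i - (P i)%:R + (Q i)%:R).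

Definition onZ (A : 'I_n.+1 -> C) : Prop := \sum_i A i = - z.

Lemma onZ_shift (P Q : M) A : msize P = msize Q -> onZ A ->
  onZ (fun i => A i - (P i)%:R + (Q i)%:R).
Proof.
by move=> PQ; rewrite /onZ !big_split /= sumrN -!natr_sum -/(msize P) -/(msize Q) PQ subrK.
Qed.

(** A functional on symbols [(P, Q)] that respects the relation [h(p, q) = -1]. Testing against all
    of these replaces equality in [P(D_n)], where the [f_{P,Q}] are dependent. *)
Definition admissible (Phi : M -> M -> C) := forall P Q, msize P = msize Q ->
  \sum_i hsgn i * Phi (madd P (munit i)) (madd Q (munit i)) = - Phi P Q.

Lemma phS k : ph k.+1 = ph k * (z + k%:R).
Proof. by rewrite /pochhammer big_ord_recr. Qed.

(** The extra factors [A i - P i] sum to [- z - |P|] in degree [-z], and this cancels the additional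
    Pochhammer factor up to the sign. *)
Lemma tau_admissible u A : onZ A -> admissible (fun P Q => tau P Q u A).
Proof.
move=> ZA P Q PQ; have k0 := ph0 (msize P); have k1 := ph0 (msize P).+1.
have zk : z + (msize P)%:R != 0 by move: k1; rewrite phS mulf_eq0 negb_or => /andP[].
have E i : hsgn i * tau (madd P (munit i)) (madd Q (munit i)) u A =
    (A i - (P i)%:R) * (tau P Q u A / (z + (msize P)%:R)).
  rewrite /tau.
  have -> : (fun j => A j - (madd P (munit i) j)%:R + (madd Q (munit i) j)%:R) =
      (fun j => A j - (P j)%:R + (Q j)%:R).
    by apply/funext => j; rewrite !ffunE !natrD; ring.
  have -> : tau_coef (madd P (munit i)) A = hsgn i * (A i - (P i)%:R) * tau_coef P A / (z + (msize P)%:R).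
    rewrite /tau_coef msize_madd msize_munit addn1 phS.
    rewrite (bigD1 i) // [X in _ = _ * (X / _) / _](bigD1 i) //= !ffunE eqxx addn1 exprS ffactS.
    under eq_bigr => j ji do rewrite !ffunE (negbTE ji) addn0.
    set X := \prod_(_ | _) _; move: k0 zk X; set a := ph _ => k0 zk X; by field; rewrite k0 zk.
  rewrite !mulrA hsgn2 mul1r; ring.
under eq_bigr do rewrite E.
rewrite -mulr_suml sumrB ZA -natr_sum -/(msize P).
by rewrite -opprD mulNr mulrCA mulfV // mulr1.
Qed.

Lemma mon_munit P i (x : 'I_n.+1 -> C) :
  \prod_j x j ^+ (madd P (munit i) j) = x i * \prod_j x j ^+ P j.
Proof.
rewrite (bigD1 i) // [in RHS](bigD1 i) //= !ffunE eqxx addn1 exprS -mulrA; congr (_ * (_ * _)).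
by apply: eq_bigr => j ji; rewrite !ffunE (negbTE ji) addn0.
Qed.

Lemma mon_admissible x : Zhat x -> admissible (fun P Q => mon P Q x).
Proof.
move=> Zx P Q _; have E i : hsgn i * mon (madd P (munit i)) (madd Q (munit i)) x =
    (if i == ord0 then -1 else 1) * x.1 ord0 i * x.2 ord0 i * mon P Q x.
  rewrite /mon (mon_munit P i (fun j => x.1 ord0 j)) (mon_munit Q i (fun j => x.2 ord0 j)) /hsgn /=.
  move: (\prod_j _) (\prod_j _) => a b; case: eqP => _; ring.
by under eq_bigr do rewrite E; rewrite -mulr_suml -/(hform _ _) Zx mulN1r.
Qed.

(* Formal linear combinations of the monomials [p^P q^Q]. *)
Definition fsum := seq (C * (M * M)).
Implicit Types X Y : fsum.

Definition lin X (Phi : M -> M -> C) : C := \sum_(x <- X) x.1 * Phi x.2.1 x.2.2.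

Definition balanced X := all (fun x : C * (M * M) => msize x.2.1 == msize x.2.2) X.

Definition wick_coef (P S T : M) : C := (-1) ^+ T ord0
    * (ph (msize P + msize S - msize T) * (mfact T)%:R / (ph (msize P) * ph (msize S)))
    * (mbin P T)%:R * (mbin S T)%:R.

(** The coefficients are those of [starPQ], but the terms remain symbols, on which both [mon] and
    [tau] can be evaluated. *)
Definition wick (P Q P' S : M) : fsum :=
  [seq (wick_coef P S [ffun i => nat_of_ord (t i)],
        ([ffun i => (P i + P' i - t i)%N], [ffun i => (Q i + S i - t i)%N]))
   | t : {ffun 'I_n.+1 -> 'I_(msize P).+1} <- [seq t : {ffun 'I_n.+1 -> 'I_(msize P).+1} <- enum {ffun 'I_n.+1 -> 'I_(msize P).+1} | [forall i, (t i <= minn (P i) (S i))%N]]].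

Lemma lin_wick P Q P' S Phi : lin (wick P Q P' S) Phi =
  \sum_(t : {ffun 'I_n.+1 -> 'I_(msize P).+1} | [forall i, (t i <= minn (P i) (S i))%N])
    wick_coef P S [ffun i => nat_of_ord (t i)] *
    Phi [ffun i => (P i + P' i - t i)%N] [ffun i => (Q i + S i - t i)%N].
Proof. by rewrite /lin big_map big_filter big_enum_cond /=. Qed.

Lemma leq_msize (P : M) i : (P i <= msize P)%N.
Proof. by rewrite /msize (bigD1 i) //= leq_addr. Qed.

Lemma msize_sub (P Q T : M) : (forall i, (T i <= P i)%N) ->
  (msize [ffun i => (P i + Q i - T i)%N] = msize P + msize Q - msize T)%N.
Proof.
move=> TP; have -> : (msize P + msize Q = msize [ffun i => (P i + Q i - T i)%N] + msize T)%N.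
  rewrite /msize -!big_split /=; apply: eq_bigr => i _; rewrite ffunE; have := TP i; lia.
by rewrite addnK.
Qed.

Lemma balanced_wick P Q P' S : msize P = msize Q -> msize P' = msize S -> balanced (wick P Q P' S).
Proof.
move=> PQ PS; apply/allP => _ /mapP[t ht ->] /=.
move: ht; rewrite mem_filter => /andP[/forallP ht _].
have tP i : (t i <= P i)%N by have := ht i; rewrite leq_min => /andP[].
have tS i : (t i <= S i)%N by have := ht i; rewrite leq_min => /andP[].
pose T : M := [ffun i => nat_of_ord (t i)].
have E (U V : M) : [ffun i => (U i + V i - t i)%N] = [ffun i => (U i + V i - T i)%N].
  by apply/ffunP => i; rewrite !ffunE.
rewrite !E msize_sub; last by move=> i; rewrite ffunE.
have -> : [ffun i => (Q i + S i - T i)%N] = [ffun i => (S i + Q i - T i)%N].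
  by apply/ffunP => i; rewrite !ffunE addnC.
by rewrite msize_sub ?PQ ?PS 1?addnC // => i; rewrite ffunE.
Qed.

(** Coordinatewise this is [ffact_wick]; distributing the product over the sums in [t] produces the
    sum over multi-indices [T]. Terms violating [T <= min(P, S)] carry a vanishing binomial
    coefficient. *)
Lemma tau_wick P Q P' S u A : msize P' = msize S ->
  lin (wick P Q P' S) (fun U V => tau U V u A) = tau P' S (tau P Q u) A.
Proof.
move=> PS; rewrite lin_wick [RHS]/tau /tau.
pose B i := A i - (P' i)%:R + (S i)%:R; pose v := u (fun i => B i - (P i)%:R + (Q i)%:R).
rewrite -[RHS]/(tau_coef P' A * (tau_coef P B * v)).
pose w p s t := ('C(p, t) * 'C(s, t) * t`!)%N.
have E1 : tau_coef P' A * tau_coef P B =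
    (\prod_i \sum_(t < (msize P).+1) hsgn i ^+ (P i + P' i) *
        ((w (P i) (S i) t)%:R * ffact (A i) (P i + P' i - t))) / (ph (msize P) * ph (msize P')).
  rewrite /tau_coef mulrACA -invfM [ph (msize P') * _]mulrC; congr (_ / _).
  rewrite -big_split /=; apply: eq_bigr => i _.
  have -> : hsgn i ^+ P' i * ffact (A i) (P' i) * (hsgn i ^+ P i * ffact (B i) (P i)) =
      hsgn i ^+ (P i + P' i) * (ffact (B i) (P i) * ffact (A i) (P' i)) by rewrite exprD; ring.
  rewrite -mulr_sumr /B ffact_wick; congr (_ * _).
  rewrite (big_ord_widen (msize P).+1
     (fun t => (w (P i) (S i) t)%:R * ffact (A i) (P i + P' i - t))) ?ltnS ?leq_msize //.
  rewrite big_mkcond /=; apply: eq_bigr => t _; case: leqP => // Pt.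
  by rewrite /w bin_small // !mul0n mul0r.
rewrite mulrA E1 bigA_distr_bigA /= mulrAC !mulr_suml.
rewrite big_mkcond /=; apply: eq_bigr => t _; case: ifP => [/forallP ht|/negbT].
  have tP i : (t i <= P i)%N by have := ht i; rewrite leq_min => /andP[].
  have tS i : (t i <= S i)%N by have := ht i; rewrite leq_min => /andP[].
  pose T : M := [ffun i => nat_of_ord (t i)].
  have ET : [ffun i => (P i + P' i - t i)%N] = [ffun i => (P i + P' i - T i)%N] :> M.
    by apply/ffunP => i; rewrite !ffunE.
  have -> : u (fun i => A i - ([ffun i => (P i + P' i - t i)%N] i)%:R +
       ([ffun i => (Q i + S i - t i)%N] i)%:R) = v.
    rewrite /v; congr u; apply/funext => i; rewrite !ffunE /B !natrB ?natrD; first ring.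
      by apply: leq_trans (tS i) _; rewrite leq_addl.
    by apply: leq_trans (tP i) _; rewrite leq_addr.
  rewrite mulrA -!mulrA [v / _]mulrC !mulrA; congr (_ * v).
  rewrite /wick_coef /tau_coef ET msize_sub -/T; last by move=> i; rewrite ffunE.
  rewrite PS; set a := ph (msize P); set b := ph (msize S); set c := ph _.
  have -> : (-1) ^+ T ord0 = \prod_i hsgn i ^+ T i :> C.
    rewrite big_ord_recl /hsgn eqxx big1 ?mulr1 // => i _.
    by rewrite -[_ == ord0]/(false) expr1n.
  have -> : \prod_i (hsgn i ^+ (P i + P' i) * ((w (P i) (S i) (t i))%:R * ffact (A i) (P i + P' i - t i))) =
     (\prod_i hsgn i ^+ T i) * (mfact T)%:R * (mbin P T)%:R * (mbin S T)%:R *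
     \prod_i (hsgn i ^+ [ffun i => (P i + P' i - T i)%N] i * ffact (A i) ([ffun i => (P i + P' i - T i)%N] i)).
    rewrite /mfact /mbin !natr_prod -!big_split /=; apply: eq_bigr => i _.
    have -> : hsgn i ^+ (P i + P' i) = hsgn i ^+ T i * hsgn i ^+ (P i + P' i - T i).
      by rewrite -exprD subnKC // ffunE; apply: leq_trans (tP i) _; rewrite leq_addr.
    by rewrite /w !ffunE !natrM; ring.
  have a0 : a != 0 by exact: ph0.
  have b0 : b != 0 by exact: ph0.
  have c0 : c != 0 by exact: ph0.
  move: (\prod_i _) => X; move: (\prod_i _) => Y; move: ((mfact T)%:R : C) ((mbin P T)%:R : C) ((mbin S T)%:R : C) => d e f.
  by field; rewrite a0 b0 c0.
rewrite negb_forall; case/existsP => i; rewrite leq_min negb_and -!ltnNge => hi.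
have -> : \prod_i (hsgn i ^+ (P i + P' i) * ((w (P i) (S i) (t i))%:R * ffact (A i) (P i + P' i - t i))) = 0 :> C.
  by rewrite (bigD1 i) //= /w; case/orP: hi => hi; rewrite (bin_small hi) ?muln0 mul0n !mul0r mulr0 mul0r.
by rewrite !mul0r.
Qed.

End Wick.

(** * Reduction of symbols to the basis *)

Section Reduction.
Variables (R : realType) (n : nat).
Local Notation C := (R[i]).
Local Notation M := (midx n.+1).
Local Notation I := (midx n * midx n)%type.

Definition emb (i : I) : M * M :=
  (mext (maxn (msize i.1) (msize i.2)) i.1, mext (maxn (msize i.1) (msize i.2)) i.2).

Lemma msize_emb1 i : msize (emb i).1 = maxn (msize i.1) (msize i.2).
Proof. by rewrite msize_mext ?leq_maxl. Qed.

Lemma msize_emb2 i : msize (emb i).2 = maxn (msize i.1) (msize i.2).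
Proof. by rewrite msize_mext ?leq_maxr. Qed.

Lemma msize_tail (P : M) : msize P = (P ord0 + msize (mtail P))%N.
Proof. by rewrite /msize big_ord_recl; congr addn; apply: eq_bigr => j _; rewrite ffunE. Qed.

Lemma mext_tail (P : M) m : m = msize P -> mext m (mtail P) = P.
Proof.
move=> ->; apply/ffunP => k; rewrite !ffunE; case: unliftP => [j|] ->; first by rewrite ffunE.
by rewrite msize_tail addnK.
Qed.

Definition comb (Y : seq (C * I)) (Phi : M -> M -> C) : C :=
  \sum_(y <- Y) y.1 * Phi (emb y.2).1 (emb y.2).2.

Lemma madd_sub (P : M) k : (0 < P k)%N -> exists P1, P = madd P1 (munit k).
Proof.
move=> Pk; exists [ffun j => (P j - munit k j)%N]; apply/ffunP => j; rewrite !ffunE.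
by rewrite subnK //; case: eqP => // ->.
Qed.

(** The relation trades a common factor [p^0 q^0] for 1 plus the sum of the [p^j q^j], which lowers
    [min(P_0, Q_0)]; at 0 the symbol belongs to the basis. [Y] is chosen before [Phi], so one
    rewriting serves all functionals. *)
Lemma reduction P Q : msize P = msize Q ->
  exists Y, forall Phi, admissible Phi -> Phi P Q = comb Y Phi.
Proof.
have [k] : exists k, minn (P ord0) (Q ord0) = k by eexists.
elim: k P Q => [|k IH] P Q hk PQ.
  exists [:: (1, (mtail P, mtail Q))] => Phi _; rewrite /comb big_seq1 mul1r /emb /=.
  have mP := msize_tail P; have mQ := msize_tail Q.
  by rewrite !mext_tail //; lia.
have [P1 EP] : exists P1, P = madd P1 (munit ord0) by apply: madd_sub; lia.
have [Q1 EQ] : exists Q1, Q = madd Q1 (munit ord0) by apply: madd_sub; lia.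
have PQ1 : msize P1 = msize Q1.
  by move: PQ; rewrite EP EQ !msize_madd !msize_munit => /addIn.
have hk1 : minn (P1 ord0) (Q1 ord0) = k by move: hk; rewrite EP EQ !ffunE eqxx; lia.
have [Y0 H0] := IH P1 Q1 hk1 PQ1.
have /choice[Y HY] : forall j : 'I_n, exists Y, forall Phi, admissible Phi ->
    Phi (madd P1 (munit (lift ord0 j))) (madd Q1 (munit (lift ord0 j))) = comb Y Phi.
  move=> j; apply: IH; last by rewrite !msize_madd PQ1 !msize_munit.
  by rewrite !ffunE !addn0.
exists (Y0 ++ flatten [seq Y j | j <- enum 'I_n]) => Phi aPhi.
rewrite /comb big_cat big_flatten big_map big_enum /= -/(comb Y0 Phi) -H0 //.
under eq_bigr => j _ do rewrite -/(comb (Y j) Phi) -HY //.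
have := aPhi P1 Q1 PQ1; rewrite big_ord_recl -EP -EQ [hsgn _ ord0]/(-1) mulN1r.
have hS j : hsgn R (lift (@ord0 n) j) = 1 by [].
move=> h; rewrite -[Phi P1 Q1]opprK -h opprD opprK -addrA -[LHS]addr0; congr (_ + _).
by rewrite addrC -sumrB big1 // => j _; rewrite hS mul1r subrr.
Qed.

Lemma reductionX (X : fsum R n) : balanced X ->
  exists Y, forall Phi, admissible Phi -> lin X Phi = comb Y Phi.
Proof.
elim: X => [_|[c [P Q]] X IH /= /andP[/eqP PQ bX]].
  by exists [::] => Phi _; rewrite /lin /comb !big_nil.
have [Y1 h1] := reduction PQ; have [Y2 h2] := IH bX.
exists ([seq (c * y.1, y.2) | y <- Y1] ++ Y2) => Phi aPhi.
rewrite /lin /comb big_cons big_cat big_map /= -/(lin X Phi) h2 // h1 //.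
by rewrite mulr_sumr; congr (_ + _); apply: eq_bigr => y _; rewrite mulrA.
Qed.

Lemma sum_collect (T : eqType) (V : pzRingType) (Y : seq (V * T)) (Psi : T -> V) :
  \sum_(y <- Y) y.1 * Psi y.2 =
  \sum_(i <- undup (map snd Y)) (\sum_(y <- Y | y.2 == i) y.1) * Psi i.
Proof.
under [RHS]eq_bigr do rewrite mulr_suml big_mkcond /=.
rewrite exchange_big /=; apply: eq_big_seq => y yY.
rewrite (bigD1_seq y.2) ?undup_uniq ?mem_undup ?map_f //= eqxx big1 ?addr0 // => i.
by rewrite eq_sym => /negbTE ->.
Qed.

End Reduction.

(** * Faithfulness of the representation and its consequences *)

Section Faithful.
Variables (R : realType) (n : nat) (z : R[i]).
Local Notation C := (R[i]).
Local Notation M := (midx n.+1).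
Local Notation I := (midx n * midx n)%type.
Local Notation ph := (pochhammer z).
Hypothesis ph0 : forall k, ph k != 0.
Implicit Types X Y : fsum R n.

Lemma ffact_neq0 m k : ffact (- z - m%:R) k != 0.
Proof.
apply/prodf_neq0 => j _.
have := ph0 (m + j).+1; rewrite phS mulf_eq0 negb_or => /andP[_].
by rewrite natrD -oppr_eq0 !opprD addrA.
Qed.

(** Triangularity. At an exponent with spatial part [i.1], falling factorials of natural numbers
    kill every [k] unless [k.1 <= i.1]; the coefficients of smaller [k.1] vanish by induction on
    [|i.1|], and an indicator function [u] selects [k.2 = i.2]. *)
Lemma comb_faithful (Y : seq (C * I)) :
  (forall u A, onZ z A -> comb Y (fun P Q => tau z P Q u A) = 0) ->
  forall Psi : I -> C, \sum_(y <- Y) y.1 * Psi y.2 = 0.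
Proof.
move=> H Psi; rewrite sum_collect big1_seq // => i /andP[_ iS].
set S := undup _ in iS; pose g j : C := \sum_(y <- Y | y.2 == j) y.1.
suff : g i = 0 by rewrite /g => ->; rewrite mul0r.
move: {2}(msize i.1) (erefl (msize i.1)) iS => m; elim/ltn_ind: m i => m IH i im iS.
(* The zeroth exponent is forced by the total degree [-z]; its falling factorials are non-zero
   because the Pochhammer symbols of [z] are. *)
pose A (k : 'I_n.+1) : C := if unlift ord0 k is Some j then (i.1 j)%:R else - z - m%:R.
have AS j : A (lift ord0 j) = (i.1 j)%:R by rewrite /A liftK.
have A0 : A ord0 = - z - m%:R by rewrite /A unlift_none.
have ZA : onZ z A.
  rewrite /onZ big_ord_recl A0; under eq_bigr do rewrite AS.
  by rewrite -natr_sum -/(msize i.1) im subrK.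
pose u (x : 'I_n.+1 -> C) : C := if [forall j : 'I_n, x (lift ord0 j) == (i.2 j)%:R] then 1 else 0.
have := H u A ZA; rewrite /comb (@sum_collect _ _ Y (fun k => tau z (emb k).1 (emb k).2 u A)) -/S.
rewrite (bigD1_seq i) ?undup_uniq //= [X in _ + X]big1_seq ?addr0; last first.
  move=> k /andP[ki kS]; rewrite -/(g k).
  have [/forallP le|] := boolP [forall j, (k.1 j <= i.1 j)%N]; last first.
    rewrite negb_forall; case/existsP => j; rewrite -ltnNge => lt.
    rewrite /tau /tau_coef (bigD1 (lift ord0 j)) //= mextS AS ffact_nat ffact_small //.
    by rewrite mulr0 !mul0r mulr0.
  have [lt|ge] := ltnP (msize k.1) m; first by rewrite (IH _ lt k) ?mul0r.
  have E1 : k.1 = i.1.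
    apply/ffunP => j; apply/eqP; rewrite eqn_leq le /= leqNgt; apply/negP => lt.
    move: ge; rewrite -im leqNgt /msize (bigD1 j) // [X in (_ < X)%N](bigD1 j) //=.
    by rewrite -addSn leq_add // leq_sum.
  have E2 : k.2 != i.2.
    by apply: contra_neq ki => E2; case: (k) (i) E1 E2 => ? ? [? ?] /= -> ->.
  rewrite /tau /u ifF ?mulr0 //; apply/negbTE; rewrite negb_forall; apply/existsP.
  apply/existsP; apply: contraR E2; rewrite negb_exists => /forallP h; apply/eqP/ffunP => j.
  have /negPn := h j; rewrite AS !mextS E1 subrr add0r => /eqP /eqP.
  by rewrite eqr_nat => /eqP.
rewrite -/(g i) => /eqP; rewrite mulf_eq0 => /orP[/eqP //|].
have u1 : u (fun k => A k - ((emb i).1 k)%:R + ((emb i).2 k)%:R) = 1.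
  by rewrite /u ifT //; apply/forallP => j; rewrite AS !mextS subrr add0r.
rewrite /tau u1 mulr1 /tau_coef mulf_eq0 invr_eq0 (negbTE (ph0 _)) orbF.
rewrite big_ord_recl A0 mulf_eq0 mulf_eq0 (negbTE (ffact_neq0 _ _)) orbF expf_eq0.
have h0 (k : 'I_n.+1) : hsgn R k != 0 :> C by apply: contra_eq_neq (hsgn2 R k) => ->; rewrite mul0r eq_sym oner_eq0.
rewrite (negbTE (h0 ord0)) andbF /=; apply: contraTeq => _; apply/prodf_neq0 => j _.
rewrite mulf_neq0 ?expf_neq0 // AS mextS ffact_nat ffactnn.
by rewrite pnatr_eq0 -lt0n fact_gt0.
Qed.

Theorem faithful X : balanced X ->
  (forall u A, onZ z A -> lin X (fun P Q => tau z P Q u A) = 0) ->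
  forall Phi, admissible Phi -> lin X Phi = 0.
Proof.
move=> bX H Phi aPhi; have [Y HY] := reductionX bX.
rewrite HY //; apply: (@comb_faithful Y _ (fun i => Phi (emb i).1 (emb i).2)) => u A ZA.
by rewrite -HY ?H //; exact: tau_admissible.
Qed.

Definition scalef (c : C) X : fsum R n := [seq (c * x.1, x.2) | x <- X].

Lemma lin_scalef c X Phi : lin (scalef c X) Phi = c * lin X Phi.
Proof. by rewrite /lin big_map mulr_sumr; apply: eq_bigr => x _; rewrite mulrA. Qed.

Lemma lin_cat X Y Phi : lin (X ++ Y) Phi = lin X Phi + lin Y Phi.
Proof. by rewrite /lin big_cat. Qed.

Lemma balanced_scalef c X : balanced (scalef c X) = balanced X.
Proof. by rewrite /balanced all_map. Qed.

Corollary faithful2 X Y : balanced X -> balanced Y ->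
  (forall u A, onZ z A -> lin X (fun P Q => tau z P Q u A) = lin Y (fun P Q => tau z P Q u A)) ->
  forall Phi, admissible Phi -> lin X Phi = lin Y Phi.
Proof.
move=> bX bY H Phi aPhi; apply/eqP; rewrite -subr_eq0 -mulN1r -lin_scalef -lin_cat; apply/eqP.
apply: faithful aPhi; first by rewrite /balanced all_cat -/(balanced X) bX -/(balanced _) balanced_scalef.
by move=> u A ZA; rewrite lin_cat lin_scalef H // mulN1r subrr.
Qed.

Definition wickX X Y : fsum R n :=
  flatten [seq flatten [seq scalef (x.1 * y.1) (wick z x.2.1 x.2.2 y.2.1 y.2.2) | y <- Y] | x <- X].

Lemma lin_wickX X Y Phi : lin (wickX X Y) Phi =
  \sum_(x <- X) \sum_(y <- Y) x.1 * y.1 * lin (wick z x.2.1 x.2.2 y.2.1 y.2.2) Phi.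
Proof.
rewrite {1}/lin big_flatten big_map; apply: eq_bigr => x _.
by rewrite big_flatten big_map; apply: eq_bigr => y _; rewrite -lin_scalef.
Qed.

Lemma balanced_wickX X Y : balanced X -> balanced Y -> balanced (wickX X Y).
Proof.
move=> /allP bX /allP bY; rewrite /balanced /wickX; apply/allP => s /flattenP[l /mapP[x xX ->]].
move=> /flattenP[l' /mapP[y yY ->]]; move: s; apply/allP; rewrite -/(balanced _) balanced_scalef.
by apply: balanced_wick; apply/eqP; [exact: bX|exact: bY].
Qed.

Definition op X (u : ('I_n.+1 -> C) -> C) A : C := lin X (fun P Q => tau z P Q u A).

Lemma op_wickX X Y u A : balanced Y -> op (wickX X Y) u A = op Y (op X u) A.
Proof.
move=> /allP bY; rewrite /op lin_wickX exchange_big /= [RHS]/lin; apply: eq_big_seq => y yY.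
have E (x : C * (M * M)) : lin (wick z x.2.1 x.2.2 y.2.1 y.2.2) (fun P Q => tau z P Q u A) =
    tau z y.2.1 y.2.2 (tau z x.2.1 x.2.2 u) A by apply: tau_wick => //; exact/eqP/bY.
under eq_bigr => x _ do rewrite E.
rewrite [in RHS]/tau /lin !mulr_sumr; apply: eq_bigr => x _; rewrite [in LHS]/tau; ring.
Qed.

Lemma op_onZ X Y u A : balanced X -> balanced Y ->
  (forall Phi, admissible Phi -> lin X Phi = lin Y Phi) -> onZ z A -> op X u A = op Y u A.
Proof. by move=> bX bY H ZA; apply: H; exact: tau_admissible. Qed.

Lemma eq_op Y u v A : balanced Y -> (forall B, onZ z B -> u B = v B) -> onZ z A -> op Y u A = op Y v A.
Proof.
move=> /allP bY uv ZA; apply: eq_big_seq => y yY; rewrite /tau uv //.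
by apply: onZ_shift => //; apply/eqP/bY.
Qed.

(** The relation spans a two-sided ideal: congruent symbols define equal operators, products become
    compositions, and faithfulness carries the equality back to all admissible functionals. *)
Lemma wickX_congr X X' Y Y' : balanced X -> balanced X' -> balanced Y -> balanced Y' ->
  (forall Phi, admissible Phi -> lin X Phi = lin X' Phi) ->
  (forall Phi, admissible Phi -> lin Y Phi = lin Y' Phi) ->
  forall Phi, admissible Phi -> lin (wickX X Y) Phi = lin (wickX X' Y') Phi.
Proof.
move=> bX bX' bY bY' hX hY; apply: faithful2; rewrite ?balanced_wickX // => u A ZA.
rewrite -!/(op _ _ _) !op_wickX // (op_onZ _ bY bY') //.
by apply: eq_op => // B ZB; exact: op_onZ.
Qed.

Lemma wickX_assoc X Y W : balanced X -> balanced Y -> balanced W ->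
  forall Phi, admissible Phi -> lin (wickX (wickX X Y) W) Phi = lin (wickX X (wickX Y W)) Phi.
Proof.
move=> bX bY bW; apply: faithful2; rewrite ?balanced_wickX // => u A ZA.
rewrite -!/(op _ _ _) !op_wickX // ?balanced_wickX //.
by congr op; apply/funext => B; rewrite op_wickX.
Qed.

End Faithful.

(** * Exchange of the two factors *)

Section Symmetry.
Variables (R : realType) (n : nat) (z : R[i]).
Local Notation M := (midx n.+1).

(** The range of the contraction index depends on [P] by definition; a common larger range allows
    [P] and [S] to change places. *)
Lemma lin_wick_wide N P Q P' S Phi : (msize P <= N)%N -> lin (wick z P Q P' S) Phi =
  \sum_(t : {ffun 'I_n.+1 -> 'I_N.+1} | [forall i, (t i <= minn (P i) (S i))%N])
    wick_coef z P S [ffun i => nat_of_ord (t i)] *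
    Phi [ffun i => (P i + P' i - t i)%N] [ffun i => (Q i + S i - t i)%N].
Proof.
move=> PN; rewrite lin_wick.
pose h (t : {ffun 'I_n.+1 -> 'I_N.+1}) : {ffun 'I_n.+1 -> 'I_(msize P).+1} := [ffun i => inord (t i)].
pose h' (t : {ffun 'I_n.+1 -> 'I_(msize P).+1}) : {ffun 'I_n.+1 -> 'I_N.+1} := [ffun i => inord (t i)].
have hE (t : {ffun 'I_n.+1 -> 'I_N.+1}) i : (t i <= minn (P i) (S i))%N -> h t i = t i :> nat.
  move=> ti; rewrite ffunE inordK // ltnS; apply: leq_trans ti _.
  by apply: leq_trans (geq_minl _ _) (leq_msize P i).
have h'E t i : h' t i = t i :> nat.
  by rewrite ffunE inordK // ltnS; apply: leq_trans PN; rewrite -ltnS.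
rewrite (reindex_onto h h') /=; last first.
  by move=> t _; apply/ffunP => i; apply/val_inj; rewrite /h ffunE /= h'E inord_val.
apply: eq_big => t.
  apply/andP/forallP => [[/forallP ht /eqP E] i|ht].
    by rewrite -E h'E.
  split; first by apply/forallP => i; rewrite hE.
  by apply/eqP/ffunP => i; apply/val_inj; rewrite /= h'E hE.
move=> /andP[_ /eqP E].
have tE i : h t i = t i :> nat by rewrite -{2}E h'E.
congr (wick_coef _ _ _ _ * Phi _ _); apply/ffunP => i; rewrite !ffunE.
all: by have := tE i; rewrite ffunE => ->.
Qed.

(** The coefficients are symmetric in [P] and [S]. Complex conjugation acts by this exchange, which
    is why it reverses products. *)
Lemma lin_wick_flip P Q P' S (Phi : M -> M -> R[i]) :
  lin (wick z P Q P' S) Phi = lin (wick z S P' Q P) (fun U V => Phi V U).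
Proof.
rewrite (lin_wick_wide _ _ _ _ (leq_maxl (msize P) (msize S))).
rewrite (lin_wick_wide _ _ _ _ (leq_maxr (msize P) (msize S))).
apply: eq_big => t; first by apply/eq_forallb => i; rewrite minnC.
move=> _; congr (_ * Phi _ _).
- by rewrite /wick_coef [(msize S + _)%N]addnC [pochhammer z (msize S) * _]mulrC [LHS]mulrAC.
- by apply/ffunP => i; rewrite !ffunE addnC.
- by apply/ffunP => i; rewrite !ffunE addnC.
Qed.

End Symmetry.

(** * Estimates *)

Section Binomials.

Lemma sum_bin_ord N p : (p <= N)%N -> (\sum_(t < N.+1) 'C(p, t) = 2 ^ p)%N.
Proof.
move=> pN; rewrite -[2%N]/(1 + 1)%N Pascal (big_ord_widen N.+1 (fun t => 'C(p, t) * (1 ^ (p - t) * 1 ^ t))%N) ?ltnS //.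
rewrite [RHS]big_mkcond /=; apply: eq_bigr => t _; rewrite !exp1n !muln1.
by case: leqP => // pt; rewrite bin_small.
Qed.

Lemma bin_le_exp p t : ('C(p, t) <= 2 ^ p)%N.
Proof.
have [tp|pt] := leqP t p; last by rewrite bin_small.
by rewrite -(sum_bin_ord (leqnn p)) (bigD1 (Ordinal (leq_ltn_trans tp (ltnSn p)))) //= leq_addr.
Qed.

Lemma fact_mul_le a b : (a`! * b`! <= (a + b)`!)%N.
Proof.
have := bin_fact (leq_addr b a); rewrite addKn => <-.
by rewrite leq_pmull // bin_gt0 leq_addr.
Qed.

Lemma fact_add_le a b : ((a + b)`! <= 2 ^ (a + b) * (a`! * b`!))%N.
Proof.
have := bin_fact (leq_addr b a); rewrite addKn => <-.
by rewrite leq_mul2r bin_le_exp orbT.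
Qed.

Lemma mfact_le k (T : midx k) : (mfact T <= (msize T)`!)%N.
Proof.
rewrite /mfact /msize; elim/big_rec2: _ => // i a b _ IH.
by apply: leq_trans (fact_mul_le _ _); rewrite leq_mul2l IH orbT.
Qed.

Lemma mbin_le k (S T : midx k) : (mbin S T <= 2 ^ msize S)%N.
Proof.
rewrite /mbin /msize; elim/big_rec2: _ => // i a b _ IH.
by rewrite expnD leq_mul // bin_le_exp.
Qed.

End Binomials.

(** * Growth of the structure constants *)

Section Estimate.
Variables (R : realType) (n : nat).
Local Notation C := (R[i]).
Local Notation M := (midx n.+1).

Lemma inH_neq0 (h : C) (k : nat) : inH h -> 1 + 2 * h * k%:R != 0.
Proof.
move=> [h0 hH]; case: k => [|k]; first by rewrite mulr0 addr0 oner_eq0.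
apply: contra (hH k) => /eqP E.
have k0 : k.+1%:R != 0 :> C by rewrite pnatr_eq0.
have k2 : 2 * k.+1%:R != 0 :> C by rewrite mulf_neq0 // pnatr_eq0.
rewrite -(inj_eq (mulIf k2)) mulNr mulVf //; apply/eqP.
have -> : h * (2 * k.+1%:R) = 2 * h * k.+1%:R by ring.
by rewrite -[LHS](addKr 1) E addr0.
Qed.

Lemma pochhammer_neq0 (h : C) k : inH h -> pochhammer (2 * h)^-1 k != 0.
Proof.
move=> hH; apply/prodf_neq0 => j _; have [h0 _] := hH.
have h2 : 2 * h != 0 by rewrite mulf_neq0 // pnatr_eq0.
apply: contra (inH_neq0 j hH) => /eqP E.
have -> : 1 + 2 * h * j%:R = 2 * h * ((2 * h)^-1 + j%:R) by rewrite mulrDr mulfV.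
by rewrite E mulr0.
Qed.

(** Equal to [(2 h)^k (1 / (2 h))_k]: a polynomial in [h] which is comparable to [k!] up to
    geometric factors. *)
Definition qpoch (h : C) k : C := \prod_(j < k) (1 + 2 * h * j%:R).

Lemma pochhammerE (h : C) k : h != 0 -> pochhammer (2 * h)^-1 k = qpoch h k / (2 * h) ^+ k.
Proof.
move=> h0; have h2 : 2 * h != 0 by rewrite mulf_neq0 // pnatr_eq0.
elim: k => [|k IH]; first by rewrite /pochhammer /qpoch !big_ord0 expr0 divr1.
rewrite phS IH /qpoch big_ord_recr /= -/(qpoch h k) exprSr.
by have := expf_neq0 k h2; move: (_ ^+ k) => c c0; field; rewrite h0 c0.
Qed.

(** For large [k] the term [2 h k] dominates; the finitely many other factors are non-zero and admit
    a common constant. *)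
Lemma inH_lower (h : C) : inH h -> exists2 d : R, 0 < d &
  forall k : nat, d * k.+1%:R <= cmod (1 + 2 * h * k%:R).
Proof.
move=> hH; have [h0 _] := hH; have ch : 0 < cmod h by rewrite cmod_gt0.
have [N hN] : exists N : nat, forall k : nat, (N <= k)%N -> cmod h * k.+1%:R <= cmod (1 + 2 * h * k%:R).
  pose x : R := (1 + cmod h) / cmod h; have x0 : 0 <= x by rewrite divr_ge0 //; lra.
  exists (Num.truncn x).+1 => k; rewrite truncn_lt_nat //.
  rewrite /x ltr_pdivrMr // => xk.
  have := cmod_ge_sub (2 * h * k%:R) (-1).
  rewrite opprK [_ + 1]addrC cmodN cmod1 !cmodM !cmod_nat -(natr1 k); lra.
have [d d0 hd] : exists2 d : R, 0 < d & forall k : nat, (k < N)%N -> d * k.+1%:R <= cmod (1 + 2 * h * k%:R).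
  elim: (N) => [|m [d d0 hd]]; first by exists 1.
  pose y := cmod (1 + 2 * h * m%:R) / m.+1%:R.
  have y0 : 0 < y by rewrite divr_gt0 // cmod_gt0 // inH_neq0.
  exists (Num.min d y); first by rewrite lt_min d0.
  move=> k; rewrite ltnS leq_eqVlt => /predU1P[->|km].
    by rewrite -ler_pdivlMr // ge_min lexx orbT.
  by apply: le_trans (hd k km); rewrite ler_wpM2r // ge_min lexx.
exists (Num.min d (cmod h)) => [|k]; first by rewrite lt_min d0.
have [Nk|kN] := leqP N k.
  by apply: le_trans (hN k Nk); rewrite ler_wpM2r // ge_min lexx orbT.
by apply: le_trans (hd k kN); rewrite ler_wpM2r // ge_min lexx.
Qed.

(** Moving [h] by less than [d / 4] changes the factor of index [k] by at most [d / 2 * (k + 1)],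
    half of its lower bound; compactness then makes the constant uniform. *)
Lemma compact_inH (L : set C^o) : compact L -> L `<=` (fun h => inH h) ->
  exists2 G : R, 1 <= G & forall h, L h -> cmod h <= G /\
    forall k : nat, k.+1%:R <= G * cmod (1 + 2 * h * k%:R).
Proof.
move=> cL LH.
suff [G hG] : exists G : R, forall h, L h -> 1 <= G /\ cmod h <= G /\
    forall k : nat, k.+1%:R <= G * cmod (1 + 2 * h * k%:R).
  exists (Num.max 1 G) => [|h Lh]; first by rewrite le_max lexx.
  have [G1 [h1 h2]] := hG h Lh.
  by rewrite (max_idPr G1).
apply: (@compact_locally_bounded _ _ _ (fun (G : R) (h : C^o) => 1 <= G /\ cmod h <= G /\
    forall k : nat, k.+1%:R <= G * cmod (1 + 2 * h * k%:R)) cL) => h Lh.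
have [d d0 hd] := inH_lower (LH h Lh).
(* The three summands ensure [1 <= G], the bound on nearby moduli and the inverse of the halved
   lower bound. *)
exists (1 + (cmod h + 1) + 2 / d).
have e0 : 0 < (Num.min 1 (d / 4))%:C :> C by rewrite ltcR lt_min ltr01 divr_gt0.
have := nbhsx_ballx (h : C^o) _ e0; apply: filterS => y.
rewrite /ball /= normcC ltcR lt_min => /andP[hy1 hy2] _ G hG.
have ch := cmod_ge0 h; have d2 : 0 < 2 / d by rewrite divr_gt0.
have cy := cmod_ge_sub y h; have := cmod_distC h y => Ey; rewrite -Ey in cy.
split; first lra.
split; first lra.
move=> k; have a1 := hd k.
have E : 1 + 2 * y * k%:R = (1 + 2 * h * k%:R) - 2 * k%:R * (h - y) by ring.
have a2 := cmod_ge_sub (1 + 2 * h * k%:R) (2 * k%:R * (h - y)).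
have a3 : cmod (2 * k%:R * (h - y)) <= d / 2 * k.+1%:R.
  rewrite !cmodM !cmod_nat -(natr1 k); have k0 := ler0n R k.
  apply: le_trans (_ : 2 * k%:R * (d / 4) <= _); first by rewrite ler_wpM2l ?mulr_ge0 // ltW.
  by have -> : 2 * k%:R * (d / 4) = d / 2 * k%:R; [field|rewrite mulrDr lerDl; lra].
have a4 : d / 2 * k.+1%:R <= cmod (1 + 2 * y * k%:R) by rewrite E; lra.
apply: le_trans (_ : 2 / d * cmod (1 + 2 * y * k%:R) <= _).
  rewrite -(ler_pM2l (_ : 0 < d / 2)) ?divr_gt0 // mulrA.
  by have -> : d / 2 * (2 / d) = 1; [field; lra|rewrite mul1r].
by rewrite ler_wpM2r ?cmod_ge0 //; lra.
Qed.

Variables (h : C) (G : R).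
Hypotheses (hH : inH h) (G1 : 1 <= G) (hG : cmod h <= G)
  (hq : forall k : nat, k.+1%:R <= G * cmod (1 + 2 * h * k%:R)).

Lemma qpoch_ge k : k`!%:R <= G ^+ k * cmod (qpoch h k).
Proof.
elim: k => [|k IH]; first by rewrite /qpoch big_ord0 cmod1 mulr1.
rewrite /qpoch big_ord_recr /= -/(qpoch h k) cmodM factS natrM exprSr.
have -> : G ^+ k * G * (cmod (qpoch h k) * cmod (1 + 2 * h * k%:R)) =
  (G * cmod (1 + 2 * h * k%:R)) * (G ^+ k * cmod (qpoch h k)) by ring.
exact: ler_pM.
Qed.

Lemma qpoch_le k : cmod (qpoch h k) <= (2 * G) ^+ k * k`!%:R.
Proof.
elim: k => [|k IH]; first by rewrite /qpoch big_ord0 cmod1 mulr1.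
rewrite /qpoch big_ord_recr /= -/(qpoch h k) cmodM factS natrM exprSr.
have -> : (2 * G) ^+ k * (2 * G) * (k.+1%:R * k`!%:R) = ((2 * G) ^+ k * k`!%:R) * (2 * G * k.+1%:R) by ring.
apply: ler_pM; rewrite ?cmod_ge0 //; apply: le_trans (cmodD _ _) _.
rewrite cmod1 !cmodM !cmod_nat -(natr1 k); have a := ler_wpM2r (ler0n R k) hG; rewrite mulrDr mulr1 -!mulrA.
by have := G1; move: a; move: (cmod h * _) (G * k%:R) => x y; lra.
Qed.

(** The factorials cancel through [(a + b - t)! t! <= (a + b)! <= 2^(a + b) a! b!]. In
    [8 G^2 = (2 G) (2 G) 2] the factors come from the numerator with its power of [2 h], from the
    denominators with this binomial bound, and from [mbin S T]. The factor [mbin P T] is kept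
    because its sum over [T] is [2^|P|]. *)
Lemma cmod_wick_coef_le (P S T : M) : (forall i, (T i <= P i)%N) ->
  cmod (wick_coef (2 * h)^-1 P S T) <= (8 * G ^+ 2) ^+ (msize P + msize S) * (mbin P T)%:R.
Proof.
move=> TP; have [h0 _] := hH; have c0 : 2 * h != 0 by rewrite mulf_neq0 // pnatr_eq0.
rewrite /wick_coef; set a := msize P; set b := msize S; set t := msize T.
have ta : (t <= a + b)%N.
  by apply: leq_trans (leq_addr _ _); apply: leq_sum => i _; exact: TP.
have qn k : qpoch h k != 0 by apply/prodf_neq0 => j _; exact: inH_neq0.
rewrite !pochhammerE //.
have -> : qpoch h (a + b - t) / (2 * h) ^+ (a + b - t) * (mfact T)%:R /
    (qpoch h a / (2 * h) ^+ a * (qpoch h b / (2 * h) ^+ b)) =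
    qpoch h (a + b - t) * (2 * h) ^+ t * (mfact T)%:R / (qpoch h a * qpoch h b).
  have E : (2 * h) ^+ a * (2 * h) ^+ b = (2 * h) ^+ (a + b - t) * (2 * h) ^+ t by rewrite -!exprD subnK.
  have n1 := expf_neq0 (a + b - t) c0; have n2 := expf_neq0 a c0; have n3 := expf_neq0 b c0.
  move: n1 n2 n3 E (qn a) (qn b); move: (_ ^+ (a + b - t)) (_ ^+ a) (_ ^+ b) (_ ^+ t).
  move: (qpoch h a) (qpoch h b) => x y c1 c2 c3 c4 n1 n2 n3 E x0 y0.
  have -> : c4 = c2 * c3 / c1 by rewrite E; field.
  by field; rewrite n1 n2 n3 x0 y0.
set Q := qpoch h (a + b - t); set qa := qpoch h a; set qb := qpoch h b.
have Ya : 0 < cmod qa by rewrite cmod_gt0 qn.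
have Yb : 0 < cmod qb by rewrite cmod_gt0 qn.
have -> : cmod ((-1) ^+ T ord0 * (Q * (2 * h) ^+ t * (mfact T)%:R / (qa * qb)) * (mbin P T)%:R * (mbin S T)%:R) =
    (cmod Q * (2 * cmod h) ^+ t * (mfact T)%:R * (mbin S T)%:R / (cmod qa * cmod qb)) * (mbin P T)%:R.
  rewrite !cmodM cmodV !cmodM !cmod_nat !cmodX cmodN cmod1 expr1n mul1r cmodM cmod_nat; ring.
rewrite ler_wpM2r // ler_pdivrMr ?mulr_gt0 //.
have G0 : 0 <= G by apply: le_trans G1.
have g2 : 0 <= 2 * G by rewrite mulr_ge0.
have h2 : 0 <= 2 * cmod h by rewrite mulr_ge0 ?cmod_ge0.
have b1 : cmod Q * (2 * cmod h) ^+ t <= (2 * G) ^+ (a + b) * (a + b - t)`!%:R.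
  rewrite -{1}(subnK ta) exprD mulrAC; apply: ler_pM; rewrite ?cmod_ge0 ?exprn_ge0 ?qpoch_le //.
  by rewrite lerXn2r ?nnegrE // ler_wpM2l.
have b2 : (a + b - t)`!%:R * (mfact T)%:R <= (2 * G) ^+ (a + b) * (cmod qa * cmod qb) :> R.
  apply: le_trans (_ : (2 ^ (a + b) * (a`! * b`!))%:R <= _).
    rewrite -natrM ler_nat; apply: leq_trans (fact_add_le _ _).
    apply: leq_trans (_ : (a + b - t)`! * t`! <= _)%N; first by rewrite leq_mul2l mfact_le orbT.
    by apply: leq_trans (fact_mul_le _ _) _; rewrite subnK.
  rewrite !natrM natrX exprMn -mulrA ler_wpM2l ?exprn_ge0 //.
  have -> : G ^+ (a + b) * (cmod qa * cmod qb) = (G ^+ a * cmod qa) * (G ^+ b * cmod qb).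
    by rewrite exprD; ring.
  by apply: ler_pM; rewrite ?qpoch_ge.
have b3 : (mbin S T)%:R <= 2 ^+ (a + b) :> R.
  by rewrite -natrX ler_nat; apply: leq_trans (mbin_le _ _) _; rewrite leq_pexp2l // leq_addl.
have -> : (8 * G ^+ 2) ^+ (a + b) * (cmod qa * cmod qb) =
  (2 * G) ^+ (a + b) * ((2 * G) ^+ (a + b) * (cmod qa * cmod qb)) * 2 ^+ (a + b).
  have -> : 8 * G ^+ 2 = 2 * G * (2 * G) * 2 by ring.
  by rewrite ![(_ * 2) ^+ _]exprMn [(2 * G * (2 * G)) ^+ _]exprMn; ring.
apply: ler_pM b3; rewrite ?mulr_ge0 ?exprn_ge0 ?cmod_ge0 //.
apply: le_trans (_ : (2 * G) ^+ (a + b) * (a + b - t)`!%:R * (mfact T)%:R <= _).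
  by rewrite ler_wpM2r.
by rewrite -mulrA ler_wpM2l ?exprn_ge0.
Qed.

Lemma sum_wick_coef (P Q P' S : M) :
  \sum_(x <- wick (2 * h)^-1 P Q P' S) cmod x.1 <= (16 * G ^+ 2) ^+ (msize P + msize S).
Proof.
rewrite big_map big_filter big_enum_cond /=; have G0 : 0 <= G by apply: le_trans G1.
have G8 : 1 <= 2 :> R by rewrite ler1n.
apply: le_trans (_ : \sum_(t : {ffun 'I_n.+1 -> 'I_(msize P).+1})
  (8 * G ^+ 2) ^+ (msize P + msize S) * (mbin P [ffun i => nat_of_ord (t i)])%:R <= _).
  rewrite big_mkcond /=; apply: ler_sum => t _; case: ifP => [/forallP ht|_].
    apply: cmod_wick_coef_le => i; rewrite ffunE.
    by have := ht i; rewrite leq_min => /andP[].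
  by rewrite mulr_ge0 ?exprn_ge0 // mulr_ge0 // exprn_ge0.
rewrite -mulr_sumr -natr_sum.
have -> : (\sum_(t : {ffun 'I_n.+1 -> 'I_(msize P).+1}) mbin P [ffun i => nat_of_ord (t i)] = 2 ^ msize P)%N.
  transitivity (\prod_i \sum_(t < (msize P).+1) 'C(P i, t))%N.
    by rewrite bigA_distr_bigA; apply: eq_bigr => t _; apply: eq_bigr => i _; rewrite ffunE.
  by under eq_bigr do rewrite sum_bin_ord ?leq_msize //; rewrite -expn_sum.
rewrite natrX; have -> : 16 * G ^+ 2 = 8 * G ^+ 2 * 2 by ring.
rewrite [leRHS]exprMn ler_wpM2l ?exprn_ge0 ?mulr_ge0 ?exprn_ge0 //.
by apply: ler_weXn2l => //; rewrite leq_addr.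
Qed.

End Estimate.

(** * The Frechet space and its product *)

Section FunctionSpace.
Variables (R : realType) (n : nat).
Local Notation C := (R[i]).
Local Notation I := (midx n * midx n)%type.
Implicit Types (a b : 'rV[C]_n -> C) (F : Cpair R n.+1 -> C) (g : I -> C).

Definition series_on_ball a : set (I -> C) :=
  [set g | rapid g /\ forall w, ball_n w -> a w = series g (DeltaD w)].

(** The Schauder coefficients; unique by [series_ball_eq0], and dependent only on the values of [a]
    on the ball. *)
Definition coef a : I -> C := xget (fun=> 0) (series_on_ball a).

Lemma series_on_ball_unique a g g' : series_on_ball a g -> series_on_ball a g' -> g = g'.
Proof.
move=> [rg hg] [rg' hg']; apply/funext => i; apply/eqP; rewrite -subr_eq0 -mulN1r; apply/eqP.
apply: (@series_ball_eq0 _ _ (fun i => g i + (-1) * g' i)); first exact: rapid_lin.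
by move=> w wb; rewrite series_lin // -hg // -hg' // mulN1r subrr.
Qed.

Lemma coefE a g : series_on_ball a g -> coef a = g.
Proof. by move=> h; apply: xget_unique => // g' h'; exact: series_on_ball_unique h' h. Qed.

Lemma eq_coef a b : eqD a b -> coef a = coef b.
Proof.
move=> ab; congr xget; apply/funext => g; apply/propext.
by split=> -[rg hg]; split=> // w wb; rewrite -hg // ab.
Qed.

Lemma coefP a : inA a -> series_on_ball a (coef a).
Proof.
move=> [F [hF aF]]; have [g [rg _ Fg]] := holo_expansion hF.
have sg : series_on_ball a g by split=> // w wb; rewrite aF // Fg //; exact: DeltaD_Zhat.
by rewrite (coefE sg).
Qed.

Lemma coef_rapid a : inA a -> rapid (coef a). Proof. by case/coefP. Qed.

Lemma series_inA a g : series_on_ball a g -> inA a.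
Proof. by move=> [rg hg]; exists (series g); split=> //; exact: series_holo. Qed.

Lemma hat_is_hat a : inA a -> is_hat a (hat a).
Proof. by move=> [F hF]; exact: xgetI hF. Qed.

Lemma hatE a F z : is_hat a F -> Zhat z -> hat a z = F z.
Proof.
move=> hF; have [h1 h2] : is_hat a (hat a) by apply: hat_is_hat; exists F.
have [h3 h4] := hF.
by apply: holo_Dhat_unique => // w wb; rewrite -h2 // -h4.
Qed.

Lemma hat_series a z : inA a -> Zhat z -> hat a z = series (coef a) z.
Proof.
by move=> aA; have [ra ha] := coefP aA; apply: hatE; split => //; exact: series_holo.
Qed.

Lemma hat_DeltaD a w : inA a -> ball_n w -> hat a (DeltaD w) = a w.
Proof. by move=> aA wb; have [_ <-] := hat_is_hat aA. Qed.

Lemma lin_series_on_ball a b (c : C) : inA a -> inA b ->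
  series_on_ball (fadd a (fscale c b)) (fun i => coef a i + c * coef b i).
Proof.
move=> aA bA; have [ra ha] := coefP aA; have [rb hb] := coefP bA.
split; first exact: rapid_lin.
by move=> w wb; rewrite series_lin // /fadd /fscale ha // hb.
Qed.

Lemma lin_inA a b (c : C) : inA a -> inA b -> inA (fadd a (fscale c b)).
Proof. by move=> aA bA; apply: series_inA (lin_series_on_ball c aA bA). Qed.

Lemma coef_lin a b (c : C) : inA a -> inA b ->
  coef (fadd a (fscale c b)) = fun i => coef a i + c * coef b i.
Proof. by move=> aA bA; apply: coefE (lin_series_on_ball c aA bA). Qed.

Lemma hat_lin a b (c : C) z : inA a -> inA b -> Zhat z ->
  hat (fadd a (fscale c b)) z = hat a z + c * hat b z.
Proof.
move=> aA bA Zz; rewrite !hat_series //; last exact: lin_inA.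
by rewrite coef_lin // series_lin //; exact: coef_rapid.
Qed.

Lemma inA0 : inA (fun _ : 'rV[C]_n => 0).
Proof.
apply: (@series_inA _ (fun=> 0)); split=> [r r0|w wb].
  by exists 0 => i; rewrite cmod0 mul0r.
apply/esym/csumvE; have := @csum_finite _ _ (fun i : I => 0 * rmon i (DeltaD w)) [::] isT.
by rewrite big_nil; apply => i _; rewrite mul0r.
Qed.

Section FiniteSums.
Variables (T : eqType) (c : T -> C) (x : T -> 'rV[C]_n -> C) (y : 'rV[C]_n -> C).
Hypotheses (yA : inA y) (xA : forall k, inA (x k)).

(** [hat] and [coef] are defined by choice and known to be linear only on [A(D_n)]; this form lets
    an induction peel off one term at a time. *)
Lemma sub_sum_cons k s : (fun w => y w - \sum_(k <- k :: s) c k * x k w) =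
  fadd (fun w => y w - \sum_(k <- s) c k * x k w) (fscale (- c k) (x k)).
Proof. by apply/funext => w; rewrite /fadd /fscale big_cons opprD mulNr [RHS]addrAC -addrA. Qed.

Lemma sub_sum_nil : (fun w => y w - \sum_(k <- [::]) c k * x k w) = y.
Proof. by apply/funext => w; rewrite big_nil subr0. Qed.

Lemma sub_sum_inA s : inA (fun w => y w - \sum_(k <- s) c k * x k w).
Proof. by elim: s => [|k s IH]; rewrite ?sub_sum_nil ?sub_sum_cons //; exact: lin_inA. Qed.

Lemma hat_sub_sum s z : Zhat z ->
  hat (fun w => y w - \sum_(k <- s) c k * x k w) z = hat y z - \sum_(k <- s) c k * hat (x k) z.
Proof.
move=> Zz; elim: s => [|k s IH]; first by rewrite sub_sum_nil big_nil subr0.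
rewrite sub_sum_cons hat_lin //; last exact: sub_sum_inA.
by rewrite IH big_cons opprD mulNr addrAC addrA.
Qed.

Lemma coef_sub_sum s i :
  coef (fun w => y w - \sum_(k <- s) c k * x k w) i = coef y i - \sum_(k <- s) c k * coef (x k) i.
Proof.
elim: s => [|k s IH]; first by rewrite sub_sum_nil big_nil subr0.
rewrite sub_sum_cons coef_lin //; last exact: sub_sum_inA.
by rewrite IH big_cons opprD mulNr addrAC addrA.
Qed.

End FiniteSums.

(** [0 <= B] covers an empty [K], where the supremum is 0 by convention. *)
Lemma snorm_le K a (B : R) : cpt K -> 0 <= B -> (forall z, K z -> cmod (hat a z) <= B) -> snorm K a <= B.
Proof.
move=> cK B0 h; rewrite /snorm; set A := [set _ | _ in _].
have [->|/set0P A0] := eqVneq A set0; first by rewrite sup0.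
by apply: ge_sup => // _ [z Kz <-]; exact: h.
Qed.

Lemma cmod_hat_le K a z : cpt K -> inA a -> K z -> cmod (hat a z) <= snorm K a.
Proof.
move=> cK aA Kz; have [[hZ _] _] := hat_is_hat aA; have [M hM] := holo_bounded hZ cK.
apply: sup_ubound; last by exists z.
by exists M => _ [y Ky <-]; exact: hM.
Qed.

Lemma snorm_ge0 K a : snorm K a >= 0.
Proof.
rewrite /snorm; set A := [set _ | _ in _].
have [[[x Ax] Aub]|] := pselect (has_sup A); last by move=> /sup_out ->.
by apply: le_trans (ub_le_sup Aub Ax); case: Ax => z _ <-; exact: cmod_ge0.
Qed.

(** Converse to the bound of seminorms by coefficients that [cmod_rmon_le] gives; the two together
    describe the topology by weighted norms of coefficient sequences. *)
Lemma coef_le a (r : R) i : inA a -> 0 <= r -> cmod (coef a i) * r ^+ isz i <= snorm (chart_cpt r) a.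
Proof.
move=> aA r0; have [hF ah] := hat_is_hat aA; have [g [rg hg Fg]] := holo_expansion hF.
have -> : coef a = g by apply: coefE; split=> // w wb; rewrite ah // Fg //; exact: DeltaD_Zhat.
by apply: hg => // z Kz; apply: cmod_hat_le => //; exact: chart_cpt_cpt.
Qed.

Lemma frPQ_rmon i : frPQ i.1 i.2 = (fun w => rmon i (DeltaD w)) :> ('rV[C]_n -> C).
Proof.
apply/funext => w; rewrite /rmon mon_DeltaD ?msize_mext ?leq_maxl ?leq_maxr //.
rewrite /fPQ msize_mext ?leq_maxl // /frPQ; congr (wpow w _ _ / _).
all: by apply/ffunP => j; rewrite ffunE mextS.
Qed.

Lemma csum_delta (u : I -> C) i : csum (fun k => (k == i)%:R * u k) (u i).
Proof.
have := @csum_finite _ _ (fun k => (k == i)%:R * u k) [:: i] isT.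
rewrite big_seq1 eqxx mul1r; apply => k; rewrite inE => /negbTE ->; by rewrite mul0r.
Qed.

Lemma frPQ_series i : series_on_ball (frPQ i.1 i.2) (fun k => (k == i)%:R).
Proof.
split=> [r r0|w wb].
  exists (r ^+ isz i) => k; case: eqVneq => [->|_]; first by rewrite cmod1 mul1r.
  by rewrite cmod0 mul0r exprn_ge0.
by apply/esym/csumvE; rewrite frPQ_rmon; exact: csum_delta.
Qed.

Lemma frPQ_inA i : inA (frPQ i.1 i.2 : 'rV[C]_n -> C).
Proof. exact: series_inA (frPQ_series i). Qed.

Lemma coef_frPQ i : coef (frPQ i.1 i.2) = fun k => (k == i)%:R.
Proof. exact: coefE (frPQ_series i). Qed.

Lemma hat_frPQ i z : Zhat z -> hat (frPQ i.1 i.2 : 'rV[C]_n -> C) z = rmon i z.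
Proof.
move=> Zz; rewrite hat_series ?coef_frPQ; [|exact: frPQ_inA|by []].
by apply: csumvE; exact: csum_delta.
Qed.

(** Density of the span of the basis as a vanishing criterion: a functional bounded by one seminorm
    sees only the tail of the expansion, which is arbitrarily small. *)
Lemma functional_eq0 (K : set (Cpair R n.+1)) (M : R) (Lam : ('rV[C]_n -> C) -> C) : cpt K ->
  (forall a b (c : C), inA a -> inA b -> Lam (fadd a (fscale c b)) = Lam a + c * Lam b) ->
  (forall a, inA a -> cmod (Lam a) <= M * snorm K a) ->
  (forall i : I, Lam (frPQ i.1 i.2) = 0) -> forall a, inA a -> Lam a = 0.
Proof.
move=> cK linL bL L0 a aA; apply: cmod_eps0 => e e0.
have [r r1 hr] := cpt_entries cK.1; have ra := coef_rapid aA.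
have [|B HB] := rapid_sum ra (c := r ^+ 2); first by rewrite sqr_ge0.
have w0 i : 0 <= cmod (coef a i) * (r ^+ 2) ^+ isz i by rewrite mulr_ge0 ?cmod_ge0 // exprn_ge0 // sqr_ge0.
have M0 : 0 < `|M| + 1 by rewrite ltr_wpDl.
have [|s0 us0 hs0] := psummable_tail w0 (ex_intro _ B HB) (e := e / (`|M| + 1)); first by rewrite divr_gt0.
pose x (i : I) : 'rV[C]_n -> C := frPQ i.1 i.2.
pose y w := a w - \sum_(k <- s0) coef a k * x k w.
have yA : inA y by apply: sub_sum_inA => // k; exact: frPQ_inA.
have <- : Lam y = Lam a.
  rewrite /y; elim: (s0) => [|k s IH]; first by rewrite sub_sum_nil.
  rewrite sub_sum_cons linL ?IH ?L0 ?mulr0 ?addr0 //; last exact: frPQ_inA.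
  by apply: sub_sum_inA => // j; exact: frPQ_inA.
apply: le_trans (bL y yA) _.
have sy : snorm K y <= e / (`|M| + 1).
  apply: snorm_le => //; first by rewrite divr_ge0 // ltW.
  move=> z Kz; have Zz := cK.2 z Kz; rewrite hat_sub_sum //; last by move=> k; exact: frPQ_inA.
  under eq_bigr do rewrite hat_frPQ //.
  rewrite hat_series //; apply: csum_tail (seriesP z ra) us0 _ => s us dis.
  apply: le_trans (ltW (hs0 s us dis)); apply: ler_sum => i _.
  by rewrite cmodM ler_wpM2l ?cmod_ge0 //; apply: cmod_rmon_le => //; exact: hr.
apply: le_trans (_ : `|M| * snorm K y <= _); first by rewrite ler_wpM2r ?snorm_ge0 // ler_norm.
apply: le_trans (_ : (`|M| + 1) * (e / (`|M| + 1)) <= _).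
  by apply: ler_pM; rewrite ?snorm_ge0 // lerDl.
by rewrite mulrC divfK // gt_eqF.
Qed.

End FunctionSpace.

(** * The product of coefficient sequences *)

Section StarHat.
Variables (R : realType) (n : nat).
Local Notation C := (R[i]).
Local Notation M := (midx n.+1).
Local Notation I := (midx n * midx n)%type.

Definition basis_star (hb : C) (i j : I) : fsum R n :=
  wick (2 * hb)^-1 (emb i).1 (emb i).2 (emb j).1 (emb j).2.

Definition starhat hb i j (x : Cpair R n.+1) : C := lin (basis_star hb i j) (fun P Q => mon P Q x).

Lemma balanced_emb i : msize (@emb n i).1 = msize (emb i).2.
Proof. by rewrite msize_emb1 msize_emb2. Qed.

Lemma msize_emb_le i : (msize (@emb n i).1 <= isz i)%N.
Proof. by rewrite msize_emb1 geq_max leq_addr leq_addl. Qed.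

Lemma balanced_basis_star hb i j : balanced (basis_star hb i j).
Proof. by apply: balanced_wick; exact: balanced_emb. Qed.

Lemma starPQ_lin hb (P Q P' S : M) (w : 'rV[C]_n) : msize P = msize Q -> msize P' = msize S ->
  starPQ hb P Q P' S w = lin (wick (2 * hb)^-1 P Q P' S) (fun U V => mon U V (DeltaD w)).
Proof.
move=> PQ PS; transitivity (lin (wick (2 * hb)^-1 P Q P' S) (fun U V => fPQ U V w)).
  rewrite lin_wick; apply: eq_bigr => t _; rewrite -/(wick_coef _ _ _ _).
  by congr (_ * fPQ _ _ w); apply/ffunP => i; rewrite !ffunE.
have /allP b := balanced_wick (2 * hb)^-1 PQ PS.
by apply: eq_big_seq => x /b /eqP h; rewrite mon_DeltaD.
Qed.

Lemma star_r_starhat hb i j (w : 'rV[C]_n) : star_r hb i.1 i.2 j.1 j.2 w = starhat hb i j (DeltaD w).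
Proof. by rewrite /star_r starPQ_lin ?msize_mext ?leq_maxl ?leq_maxr. Qed.

Lemma lin_scale_inv (X : fsum R n) (c : C) x : balanced X -> c != 0 ->
  lin X (fun P Q => mon P Q (c *: x.1, c^-1 *: x.2)) = lin X (fun P Q => mon P Q x).
Proof. by move=> /allP b c0; apply: eq_big_seq => y /b /eqP h; rewrite mon_scale. Qed.

Lemma wick_msize (z : C) (P Q P' S : M) x : x \in wick z P Q P' S ->
  (msize x.2.1 + msize x.2.2 <= (msize P + msize P') + (msize Q + msize S))%N.
Proof.
move=> /mapP[t _ ->] /=; rewrite /msize -!big_split /=.
by apply: leq_sum => i _; rewrite !ffunE; lia.
Qed.

Lemma basis_star_msize hb i j x : x \in basis_star hb i j ->
  (msize x.2.1 + msize x.2.2 <= 2 * (isz i + isz j))%N.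
Proof.
move=> /wick_msize; have := msize_emb_le i; have := msize_emb_le j.
have := balanced_emb i; have := balanced_emb j; lia.
Qed.

(** Rapidly decreasing coefficients absorb any geometric rate; having [E] common to [L] is the
    source of local uniformity in the parameter. *)
Lemma compact_star_bound (L : set C^o) : compact L -> L `<=` (fun h => inH h) ->
  exists2 E : R, 1 <= E & forall h, L h -> forall i j : I,
    \sum_(x <- basis_star h i j) cmod x.1 <= E ^+ (isz i + isz j).
Proof.
move=> cL LH; have [G G1 hG] := compact_inH cL LH.
have G2 : 1 <= 16 * G ^+ 2 by nra.
exists (16 * G ^+ 2) => // h Lh i j; have [h1 h2] := hG h Lh.
apply: le_trans (sum_wick_coef (LH h Lh) G1 h1 h2 _ _ _ _) _.
by apply: ler_weXn2l => //; rewrite leq_add // ?msize_emb_le // -balanced_emb msize_emb_le.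
Qed.

Lemma star_bound (h : C) : inH h -> exists2 E : R, 1 <= E & forall i j : I,
    \sum_(x <- basis_star h i j) cmod x.1 <= E ^+ (isz i + isz j).
Proof.
move=> hH; have cL : compact ([set h] : set C^o) by exact: compact_set1.
have [|E E1 hE] := compact_star_bound cL.
  by move=> _ ->.
by exists E => // i j; exact: hE.
Qed.

Lemma starhat_le h (E r : R) i j x : 1 <= r -> entries_le x r ->
  \sum_(y <- basis_star h i j) cmod y.1 <= E ^+ (isz i + isz j) ->
  cmod (starhat h i j x) <= (E * r ^+ 2) ^+ (isz i + isz j).
Proof.
move=> r1 hx hE; apply: le_trans (cmod_sum _ _ _) _.
apply: le_trans (_ : \sum_(y <- basis_star h i j) cmod y.1 * (r ^+ 2) ^+ (isz i + isz j) <= _).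
  rewrite big_seq [leRHS]big_seq; apply: ler_sum => y /basis_star_msize hy.
  rewrite cmodM ler_wpM2l ?cmod_ge0 //; apply: le_trans (cmod_mon_le _ _ _ hx) _; first lra.
  by rewrite -exprM; exact: ler_weXn2l.
by rewrite -mulr_suml [leRHS]exprMn ler_wpM2r // exprn_ge0 // sqr_ge0.
Qed.

(** A finite set of pairs lies in the product of its projections, over which the sum factors. *)
Lemma sum_prod_le (T T' : eqType) (u : T -> R) (v : T' -> R) (A B : R) (s : seq (T * T')) :
  (forall x, 0 <= u x) -> (forall x, 0 <= v x) ->
  (forall s, uniq s -> \sum_(x <- s) u x <= A) -> (forall s, uniq s -> \sum_(x <- s) v x <= B) ->
  uniq s -> \sum_(p <- s) u p.1 * v p.2 <= A * B.
Proof.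
move=> u0 v0 hA hB us.
pose s1 := undup (map fst s); pose s2 := undup (map snd s).
have ut : uniq [seq (x, y) | x <- s1, y <- s2].
  by apply: allpairs_uniq; rewrite ?undup_uniq // => -[? ?] [? ?] _ _ [-> ->].
have sub : {subset s <= [seq (x, y) | x <- s1, y <- s2]}.
  by move=> p ps; apply/allpairsP; exists p; rewrite !mem_undup !map_f //; case: p ps.
apply: le_trans (_ : \sum_(p <- [seq (x, y) | x <- s1, y <- s2]) u p.1 * v p.2 <= _).
  by rewrite (sum_seq_sub_split _ us ut sub) lerDl; apply: sumr_ge0 => p _; rewrite mulr_ge0.
rewrite big_allpairs /=; under eq_bigr do rewrite -mulr_sumr; rewrite -mulr_suml.
by apply: ler_pM; rewrite ?hA ?hB ?undup_uniq //; apply: sumr_ge0.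
Qed.

Variables (hb : C).
Hypothesis hH : inH hb.
Implicit Types alpha beta : I -> C.

Lemma rapid_pair alpha beta (c : R) : rapid alpha -> rapid beta -> 0 <= c ->
  psummable (fun p : I * I => cmod (alpha p.1 * beta p.2) * c ^+ (isz p.1 + isz p.2)).
Proof.
move=> ra rb c0; have [A hA] := rapid_sum ra c0; have [B hB] := rapid_sum rb c0.
have w0 (g : I -> C) x : 0 <= cmod (g x) * c ^+ isz x by rewrite mulr_ge0 ?cmod_ge0 ?exprn_ge0.
exists (A * B) => s us.
apply: le_trans (sum_prod_le (w0 alpha) (w0 beta) hA hB us); apply: ler_sum => p _; rewrite cmodM exprD.
by rewrite mulrACA.
Qed.

(** Defined bilinearly from the basis and on the whole ambient space, so that [tame_series] yields
    its holomorphy. *)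
Definition mulhat alpha beta x : C :=
  csumv (fun p : I * I => alpha p.1 * beta p.2 * starhat hb p.1 p.2 x).

Lemma mulhatP alpha beta x : rapid alpha -> rapid beta ->
  csum (fun p : I * I => alpha p.1 * beta p.2 * starhat hb p.1 p.2 x) (mulhat alpha beta x).
Proof.
move=> ra rb; apply: csumvP; have [r r1 hr] := entries_le_pnorm1 x; have [E E1 hE] := star_bound hH.
have [|B HB] := rapid_pair ra rb (c := E * r ^+ 2).
  by rewrite mulr_ge0 ?sqr_ge0 // (le_trans _ E1).
exists B => s us; apply: le_trans (HB s us); apply: ler_sum => p _.
by rewrite cmodM ler_wpM2l ?cmod_ge0 //; exact: starhat_le.
Qed.

Lemma mulhat_differentiable alpha beta x : rapid alpha -> rapid beta ->
  differentiable (mulhat alpha beta : Cpair R n.+1 -> C^o) x.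
Proof.
move=> ra rb; have [r r1 hr] := entries_le_pnorm1 x; have [E E1 hE] := star_bound hH.
pose K := tame_cst R n.+1; have K1 : 1 <= K := tame_cst_ge1 R n.+1.
have Kr : 1 <= K * r by nra.
have [|B HB] := rapid_pair ra rb (c := E * (K * r) ^+ 2).
  by rewrite mulr_ge0 ?sqr_ge0 // (le_trans _ E1).
(* The two single factors [K] pay for the multiplications by [alpha p.1 * beta p.2] and by [y.1],
   the power for [tame_mon]. *)
pose c0 : R := K * K * K ^+ (2 * n.+1).+1.
have K0 : 0 <= K by apply: le_trans K1.
have c00 : 0 <= c0 by apply: mulr_ge0; [exact: mulr_ge0|exact: exprn_ge0].
pose B' (p : I * I) : R := c0 * (cmod (alpha p.1 * beta p.2) * (E * (K * r) ^+ 2) ^+ (isz p.1 + isz p.2)).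
apply: (@tame_series _ _ _ (fun p x => alpha p.1 * beta p.2 * starhat hb p.1 p.2 x) B').
- by exists (c0 * B) => s us; rewrite -mulr_sumr ler_wpM2l // HB.
- move=> p.
  have t1 : tame (\sum_(y <- basis_star hb p.1 p.2) K * (cmod y.1 *
      (K ^+ (2 * n.+1).+1 * (K * r) ^+ (msize y.2.1 + msize y.2.2)))) (starhat hb p.1 p.2) x.
    apply: (@tame_sum _ _ _ _ _ (fun y x => y.1 * mon y.2.1 y.2.2 x)) => y.
    exact: tameM (tame_const _ _) (tame_mon _ _ hr r1).
  apply: tame_le (tameM (tame_const (alpha p.1 * beta p.2) x) t1).
  rewrite -/K /B' /c0 [(E * _) ^+ _]exprMn.
  set ab := cmod _; have ab0 : 0 <= ab by exact: cmod_ge0.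
  apply: le_trans (_ : K * (ab * (K * (K ^+ (2 * n.+1).+1 *
     (((K * r) ^+ 2) ^+ (isz p.1 + isz p.2) * E ^+ (isz p.1 + isz p.2))))) <= _); last first.
    by rewrite le_eqVlt; apply/orP; left; apply/eqP; ring.
  apply: ler_wpM2l => //; apply: ler_wpM2l => //; rewrite -mulr_sumr; apply: ler_wpM2l => //.
  apply: le_trans (_ : K ^+ (2 * n.+1).+1 * (((K * r) ^+ 2) ^+ (isz p.1 + isz p.2) * \sum_(y <- basis_star hb p.1 p.2) cmod y.1) <= _); last first.
    apply: ler_wpM2l; first exact: exprn_ge0.
    by apply: ler_wpM2l; [apply: exprn_ge0; exact: sqr_ge0|exact: hE].
  rewrite !mulr_sumr big_seq [leRHS]big_seq; apply: ler_sum => y /basis_star_msize hy.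
  rewrite mulrCA ler_wpM2l ?exprn_ge0 // mulrC ler_wpM2r ?cmod_ge0 //.
  by rewrite -exprM; exact: ler_weXn2l.
- by move=> y; exact: mulhatP.
Qed.

Lemma mulhat_holo alpha beta : rapid alpha -> rapid beta -> holo_Dhat (mulhat alpha beta).
Proof.
move=> ra rb; split=> [x _|x _ c c0].
  exists setT, (mulhat alpha beta : Cpair R n.+1 -> C^o); split => //; first exact: openT.
  by move=> y _; exact: mulhat_differentiable.
rewrite /mulhat; congr csumv; apply/funext => p; congr (_ * _).
exact: lin_scale_inv (balanced_basis_star _ _ _) c0.
Qed.

Lemma mulhat_linl alpha alpha' beta (c : C) x : rapid alpha -> rapid alpha' -> rapid beta ->
  mulhat (fun i => alpha i + c * alpha' i) beta x = mulhat alpha beta x + c * mulhat alpha' beta x.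
Proof.
move=> ra ra' rb; apply: csumvE.
apply: eq_csum (csumD (mulhatP x ra rb) (csumZ c (mulhatP x ra' rb))) => p; ring.
Qed.

Lemma mulhat_linr alpha beta beta' (c : C) x : rapid alpha -> rapid beta -> rapid beta' ->
  mulhat alpha (fun i => beta i + c * beta' i) x = mulhat alpha beta x + c * mulhat alpha beta' x.
Proof.
move=> ra rb rb'; apply: csumvE.
apply: eq_csum (csumD (mulhatP x ra rb) (csumZ c (mulhatP x ra rb'))) => p; ring.
Qed.

Lemma mulhat_delta i j x :
  mulhat (fun k => (k == i)%:R) (fun k => (k == j)%:R) x = starhat hb i j x.
Proof.
apply: csumvE; have := @csum_finite _ _ (fun p : I * I => (p.1 == i)%:R * (p.2 == j)%:R * starhat hb p.1 p.2 x) [:: (i, j)] isT.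
rewrite big_seq1 /= !eqxx !mul1r; apply => -[k l]; rewrite inE xpair_eqE negb_and /=.
by case/orP=> /negbTE ->; rewrite ?mul0r ?mulr0 ?mul0r.
Qed.

End StarHat.

(** * Continuity, associativity and the series formula *)

Section Product.
Variables (R : realType) (n : nat).
Local Notation C := (R[i]).
Local Notation M := (midx n.+1).
Local Notation I := (midx n * midx n)%type.
Local Notation fct := ('rV[C]_n -> C).
Implicit Types (a b c : fct) (i j k : I) (T S : fct -> fct).

Definition continuous_op T := forall K : set (Cpair R n.+1), cpt K ->
  exists K', cpt K' /\ exists B : R, forall a, inA a -> snorm K (T a) <= B * snorm K' a.

Definition linear_op T := forall a b (x : C), inA a -> inA b ->
  T (fadd a (fscale x b)) = fadd (T a) (fscale x (T b)).

Definition preserves_A T := forall a, inA a -> inA (T a).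

Lemma continuous_op_comp T S : preserves_A T -> continuous_op T -> continuous_op S ->
  continuous_op (S \o T).
Proof.
move=> TA cT cS K cK; have [K1 [cK1 [B1 h1]]] := cS K cK; have [K2 [cK2 [B2 h2]]] := cT K1 cK1.
exists K2; split=> //; exists (`|B1| * B2) => a aA; apply: le_trans (h1 _ (TA a aA)) _.
rewrite -mulrA; apply: le_trans (_ : `|B1| * snorm K1 (T a) <= _).
  by rewrite ler_wpM2r ?snorm_ge0 // ler_norm.
by rewrite ler_wpM2l // h2.
Qed.

Lemma linear_op_comp T S : preserves_A T -> linear_op T -> linear_op S -> linear_op (S \o T).
Proof. by move=> TA lT lS a b x aA bA; rewrite /= lT // lS //; exact: TA. Qed.

Lemma snorm_subset (K K' : set (Cpair R n.+1)) a : cpt K -> cpt K' -> K `<=` K' -> inA a ->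
  snorm K a <= snorm K' a.
Proof.
move=> cK cK' KK aA; apply: snorm_le => //; first exact: snorm_ge0.
by move=> z /KK Kz; exact: cmod_hat_le.
Qed.

(** Evaluation of [T - S] at a point of the ball is bounded by a seminorm over the union of two
    compact sets, so [functional_eq0] applies. *)
Lemma op_eq T S : linear_op T -> linear_op S -> continuous_op T -> continuous_op S ->
  preserves_A T -> preserves_A S -> (forall i, eqD (T (frPQ i.1 i.2)) (S (frPQ i.1 i.2))) ->
  forall a, inA a -> eqD (T a) (S a).
Proof.
move=> lT lS cT cS TA SA TS a aA w wb.
have Zw := DeltaD_Zhat wb.
have cw : cpt [set (DeltaD w : Cpair R n.+1)] by split; [exact: compact_set1|move=> _ ->].
have [K1 [cK1 [B1 h1]]] := cT _ cw; have [K2 [cK2 [B2 h2]]] := cS _ cw.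
have cU : cpt (K1 `|` K2).
  by split; [exact: compactU cK1.1 cK2.1|move=> z [/cK1.2|/cK2.2]].
pose Lam a := T a w - S a w.
suff : Lam a = 0 by move/eqP; rewrite subr_eq0 => /eqP.
apply: (@functional_eq0 _ _ _ (`|B1| + `|B2|) Lam cU) aA.
- by move=> x y t xA yA; rewrite /Lam lT // lS // /fadd /fscale; ring.
- move=> x xA; apply: le_trans (cmodB _ _) _; rewrite mulrDl; apply: lerD.
    rewrite -(hat_DeltaD (TA x xA) wb); apply: le_trans (cmod_hat_le cw (TA x xA) _) _ => //.
    apply: le_trans (h1 x xA) _; apply: le_trans (_ : `|B1| * snorm K1 x <= _).
      by rewrite ler_wpM2r ?snorm_ge0 // ler_norm.
    by rewrite ler_wpM2l // snorm_subset // => z ?; left.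
  rewrite -(hat_DeltaD (SA x xA) wb); apply: le_trans (cmod_hat_le cw (SA x xA) _) _ => //.
  apply: le_trans (h2 x xA) _; apply: le_trans (_ : `|B2| * snorm K2 x <= _).
    by rewrite ler_wpM2r ?snorm_ge0 // ler_norm.
  by rewrite ler_wpM2l // snorm_subset // => z ?; right.
- by move=> k; rewrite /Lam TS // subrr.
Qed.

(** A coefficient is continuous for the seminorm over [chart_cpt 1], and a partial sum containing
    [i] has [i]-th coefficient [alpha i]. *)
Lemma coef_expansion a (alpha : I -> C) : inA a -> expansion alpha a -> alpha = coef a.
Proof.
move=> aA [_ ha]; apply/funext => i; apply/eqP; rewrite eq_sym -subr_eq0; apply/eqP.
apply: cmod_eps0 => e e0; have [s0 hs0] := ha _ (chart_cpt_cpt n 1) e e0.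
pose s := undup (i :: s0); have us : uniq s := undup_uniq _.
have := hs0 s us; set y := fun w => _ => hy.
have yA : inA y by apply: sub_sum_inA => // k; exact: frPQ_inA.
have Ey : coef y i = coef a i - alpha i.
  rewrite coef_sub_sum //; last by move=> k; exact: frPQ_inA.
  rewrite (bigD1_seq i) ?mem_undup ?mem_head //= coef_frPQ eqxx mulr1 big1 ?addr0 // => k ki.
  by rewrite coef_frPQ eq_sym (negbTE ki) mulr0.
have := coef_le i yA ler01; rewrite expr1n mulr1 Ey => h; apply: le_trans h _; apply: ltW.
by apply: hy => x xs; rewrite mem_undup inE xs orbT.
Qed.

Section Fixed.
Variables (hb : C).
Hypothesis hH : inH hb.
Let z := (2 * hb)^-1.
Let z0 m : pochhammer z m != 0 := pochhammer_neq0 m hH.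

Definition star_mult a b : fct := fun w => mulhat hb (coef a) (coef b) (DeltaD w).

Lemma star_mult_is_hat a b : inA a -> inA b ->
  is_hat (star_mult a b) (mulhat hb (coef a) (coef b)).
Proof. by move=> aA bA; split=> //; apply: mulhat_holo => //; exact: coef_rapid. Qed.

Lemma star_mult_inA a b : inA a -> inA b -> inA (star_mult a b).
Proof. by move=> aA bA; exists (mulhat hb (coef a) (coef b)); exact: star_mult_is_hat. Qed.

Lemma hat_star_mult a b x : inA a -> inA b -> Zhat x ->
  hat (star_mult a b) x = mulhat hb (coef a) (coef b) x.
Proof. by move=> aA bA Zx; apply: hatE => //; exact: star_mult_is_hat. Qed.

Lemma star_mult_eqD a a' b b' : eqD a a' -> eqD b b' -> star_mult a b = star_mult a' b'.
Proof. by move=> aa bb; rewrite /star_mult (eq_coef aa) (eq_coef bb). Qed.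

Lemma star_mult_linl b : inA b -> linear_op (star_mult^~ b).
Proof.
move=> bA a a' x aA aA'; apply/funext => w.
by rewrite /star_mult coef_lin // mulhat_linl //; exact: coef_rapid.
Qed.

Lemma star_mult_linr a : inA a -> linear_op (star_mult a).
Proof.
move=> aA b b' x bA bA'; apply/funext => w.
by rewrite /star_mult coef_lin // mulhat_linr //; exact: coef_rapid.
Qed.

Lemma star_mult_frPQ i j : star_mult (frPQ i.1 i.2) (frPQ j.1 j.2) = star_r hb i.1 i.2 j.1 j.2.
Proof.
by apply/funext => w; rewrite /star_mult !coef_frPQ mulhat_delta star_r_starhat.
Qed.

(** On [K] basis products grow at the rate [D = E r^2]; measuring coefficients at radius [2 D]
    leaves [2^-|i| 2^-|j|], whose sum is at most [2^(2n) * 2^(2n)]. *)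
Lemma star_mult_snorm (K : set (Cpair R n.+1)) : cpt K -> exists K', cpt K' /\ exists B : R,
  forall a b, inA a -> inA b -> snorm K (star_mult a b) <= B * snorm K' a * snorm K' b.
Proof.
move=> cK; have [r r1 hr] := cpt_entries cK.1; have [E E1 hE] := star_bound n hH.
pose D := E * r ^+ 2; have D0 : 0 <= D by rewrite mulr_ge0 ?sqr_ge0 // (le_trans _ E1).
have D2 : 0 <= 2 * D by rewrite mulr_ge0.
exists (chart_cpt (2 * D)); split; first exact: chart_cpt_cpt.
exists (2 ^+ (n + n) * 2 ^+ (n + n)) => a b aA bA; set sa := snorm _ a; set sb := snorm _ b.
have co (x : fct) i : inA x -> cmod (coef x i) * D ^+ isz i <= snorm (chart_cpt (2 * D)) x * 2^-1 ^+ isz i.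
  move=> xA; have h := coef_le i xA D2; rewrite exprVn ler_pdivlMr ?exprn_gt0 //.
  by rewrite -[leLHS]mulrA -exprMn [D * 2]mulrC.
have sa0 : 0 <= sa by exact: snorm_ge0.
have sb0 : 0 <= sb by exact: snorm_ge0.
apply: snorm_le => //; first by rewrite !mulr_ge0 // exprn_ge0.
move=> x Kx; rewrite hat_star_mult //; last exact: cK.2.
apply: csum_bound (mulhatP hH x (coef_rapid aA) (coef_rapid bA)) _ => s us.
apply: le_trans (_ : \sum_(p <- s) (sa * sb) * (2^-1 ^+ isz p.1 * 2^-1 ^+ isz p.2) <= _).
  apply: ler_sum => p _; rewrite !cmodM.
  apply: le_trans (_ : cmod (coef a p.1) * cmod (coef b p.2) * D ^+ (isz p.1 + isz p.2) <= _).
    by rewrite ler_wpM2l ?mulr_ge0 ?cmod_ge0 //; apply: starhat_le => //; exact: hr.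
  rewrite exprD mulrACA [leRHS]mulrACA.
  by apply: ler_pM; rewrite ?mulr_ge0 ?cmod_ge0 ?exprn_ge0 ?co.
rewrite -mulr_sumr -[leRHS]mulrA [leRHS]mulrC; apply: ler_wpM2l; first exact: mulr_ge0.
have w0 i : 0 <= 2^-1 ^+ isz i :> R by rewrite exprn_ge0.
by apply: (sum_prod_le w0 w0 _ _ us) => t ut; exact: sum_half_pow_isz.
Qed.

Lemma star_mult_contl b : inA b -> continuous_op (star_mult^~ b).
Proof.
move=> bA K cK; have [K' [cK' [B h]]] := star_mult_snorm cK.
by exists K'; split=> //; exists (B * snorm K' b) => a aA; rewrite mulrAC h.
Qed.

Lemma star_mult_contr a : inA a -> continuous_op (star_mult a).
Proof.
move=> aA K cK; have [K' [cK' [B h]]] := star_mult_snorm cK.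
by exists K'; split=> //; exists (B * snorm K' a) => b bA; rewrite h.
Qed.

Lemma star_mult_preservesl b : inA b -> preserves_A (star_mult^~ b).
Proof. by move=> bA a aA; exact: star_mult_inA. Qed.

Lemma star_mult_preservesr a : inA a -> preserves_A (star_mult a).
Proof. by move=> aA b bA; exact: star_mult_inA. Qed.

Definition fct_of (X : fsum R n) : fct := fun w => lin X (fun P Q => mon P Q (DeltaD w)).

Definition emb_comb (Y : seq (C * I)) : fsum R n := [seq (y.1, emb y.2) | y <- Y].

Lemma lin_emb_comb Y Phi : lin (emb_comb Y) Phi = comb Y Phi.
Proof. by rewrite /lin big_map. Qed.

Lemma balanced_emb_comb Y : balanced (emb_comb Y).
Proof. by apply/allP => _ /mapP[y _ ->] /=; rewrite balanced_emb. Qed.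

Lemma fct_of_emb_cons y Y : fct_of (emb_comb (y :: Y)) =
  fadd (fct_of (emb_comb Y)) (fscale y.1 (frPQ y.2.1 y.2.2)).
Proof. by apply/funext => w; rewrite /fct_of /lin big_cons /fadd /fscale addrC frPQ_rmon. Qed.

Lemma fct_of_emb_nil : fct_of (emb_comb [::]) = fun=> 0.
Proof. by apply/funext => w; rewrite /fct_of /lin big_nil. Qed.

Lemma fct_of_emb_inA Y : inA (fct_of (emb_comb Y)).
Proof.
elim: Y => [|y Y IH]; first by rewrite fct_of_emb_nil; exact: inA0.
by rewrite fct_of_emb_cons; apply: lin_inA => //; exact: frPQ_inA.
Qed.

Lemma linear_op_comb T Y w : linear_op T ->
  T (fct_of (emb_comb Y)) w = \sum_(y <- Y) y.1 * T (frPQ y.2.1 y.2.2) w.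
Proof.
move=> lT; elim: Y => [|y Y IH].
  rewrite big_nil fct_of_emb_nil; have := lT _ _ 1 (inA0 R n) (inA0 R n).
  have -> : fadd (fun=> 0) (fscale 1 (fun=> 0)) = (fun=> 0) :> fct.
    by apply/funext => x; rewrite /fadd /fscale mulr0 addr0.
  move=> /(congr1 (fun f => f w)); rewrite /fadd /fscale mul1r => /eqP.
  by rewrite -{1}[T _ w]addr0 (inj_eq (addrI _)) eq_sym => /eqP.
rewrite fct_of_emb_cons lT; [|exact: fct_of_emb_inA|exact: frPQ_inA].
by rewrite /fadd /fscale IH big_cons addrC.
Qed.

Lemma eqD_fct_of X Y : (forall Phi, admissible Phi -> lin X Phi = lin Y Phi) ->
  eqD (fct_of X) (fct_of Y).
Proof. by move=> h w wb; apply: h; apply: mon_admissible; exact: DeltaD_Zhat. Qed.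

(** The definition gives the product on the basis only. Both factors are rewritten in the basis, and
    by [wickX_congr] the formal product does not depend on the rewriting. *)
Lemma star_mult_fct_of X X' : balanced X -> balanced X' ->
  eqD (star_mult (fct_of X) (fct_of X')) (fct_of (wickX z X X')).
Proof.
move=> bX bX'; have [Y hY] := reductionX bX; have [Y' hY'] := reductionX bX'.
have XY Phi : admissible Phi -> lin X Phi = lin (emb_comb Y) Phi by rewrite lin_emb_comb; exact: hY.
have XY' Phi : admissible Phi -> lin X' Phi = lin (emb_comb Y') Phi by rewrite lin_emb_comb; exact: hY'.
move=> w wb; rewrite (star_mult_eqD (eqD_fct_of XY) (eqD_fct_of XY')).
have := wickX_congr z0 bX (balanced_emb_comb Y) bX' (balanced_emb_comb Y') XY XY'.
move=> /(_ _ (mon_admissible (DeltaD_Zhat wb))) E; rewrite [RHS]E lin_wickX big_map.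
rewrite (linear_op_comb _ _ (star_mult_linl (fct_of_emb_inA Y'))); apply: eq_bigr => y _.
rewrite (linear_op_comb _ _ (star_mult_linr (frPQ_inA R y.2))) big_map mulr_sumr.
by apply: eq_bigr => y' _; rewrite star_mult_frPQ star_r_starhat mulrA.
Qed.

Lemma fct_of_seq1 P Q : msize P = msize Q -> fct_of [:: (1, (P, Q))] = fPQ P Q.
Proof. by move=> PQ; apply/funext => w; rewrite /fct_of /lin big_seq1 mul1r mon_DeltaD. Qed.

Lemma star_mult_fPQ (P Q P' S : M) : msize P = msize Q -> msize P' = msize S ->
  eqD (star_mult (fPQ P Q) (fPQ P' S)) (starPQ hb P Q P' S).
Proof.
move=> PQ PS w wb; rewrite -(fct_of_seq1 PQ) -(fct_of_seq1 PS) star_mult_fct_of //=.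
- by rewrite /fct_of lin_wickX !big_seq1 !mul1r starPQ_lin.
- by rewrite PQ eqxx.
- by rewrite PS eqxx.
Qed.

(** For basis functions associativity comes from composing operators; the arguments are then
    extended to [A(D_n)] one after the other by [op_eq], with the other two fixed. *)
Lemma star_mult_assoc a b c : inA a -> inA b -> inA c ->
  eqD (star_mult (star_mult a b) c) (star_mult a (star_mult b c)).
Proof.
have bi i : balanced [:: (1 : C, emb i)] by rewrite /= balanced_emb eqxx.
have fr i : frPQ i.1 i.2 = fct_of [:: (1, emb i)].
  by apply/funext => w; rewrite /fct_of /lin big_seq1 mul1r frPQ_rmon.
have fA i : inA (frPQ i.1 i.2 : fct) by exact: frPQ_inA.
have h0 i j k : eqD (star_mult (star_mult (frPQ i.1 i.2) (frPQ j.1 j.2)) (frPQ k.1 k.2))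
                    (star_mult (frPQ i.1 i.2) (star_mult (frPQ j.1 j.2) (frPQ k.1 k.2))).
  move=> w wb; rewrite !fr.
  rewrite (star_mult_eqD (star_mult_fct_of (bi i) (bi j)) (fun _ _ => erefl)).
  rewrite (star_mult_eqD (fun _ _ => erefl) (star_mult_fct_of (bi j) (bi k))).
  rewrite !star_mult_fct_of ?balanced_wickX //.
  by apply: wickX_assoc => //; apply: mon_admissible; exact: DeltaD_Zhat.
have h1 j k x : inA x -> eqD (star_mult (star_mult x (frPQ j.1 j.2)) (frPQ k.1 k.2))
                    (star_mult x (star_mult (frPQ j.1 j.2) (frPQ k.1 k.2))).
  have jkA := star_mult_inA (fA j) (fA k).
  apply: (op_eq (T := star_mult^~ (frPQ k.1 k.2) \o star_mult^~ (frPQ j.1 j.2))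
    (S := star_mult^~ (star_mult (frPQ j.1 j.2) (frPQ k.1 k.2)))) => //.
  - by apply: linear_op_comp; [exact: star_mult_preservesl|exact: star_mult_linl|exact: star_mult_linl].
  - exact: star_mult_linl.
  - by apply: continuous_op_comp; [exact: star_mult_preservesl|exact: star_mult_contl|exact: star_mult_contl].
  - exact: star_mult_contl.
  - by move=> y yA /=; do 2![apply: star_mult_inA => //].
  - exact: star_mult_preservesl.
  - by move=> i; exact: h0.
have h2 k x y : inA x -> inA y -> eqD (star_mult (star_mult x y) (frPQ k.1 k.2))
                    (star_mult x (star_mult y (frPQ k.1 k.2))).
  move=> xA; apply: (op_eq (T := star_mult^~ (frPQ k.1 k.2) \o star_mult x)
    (S := star_mult x \o star_mult^~ (frPQ k.1 k.2))) => //.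
  - by apply: linear_op_comp; [exact: star_mult_preservesr|exact: star_mult_linr|exact: star_mult_linl].
  - by apply: linear_op_comp; [exact: star_mult_preservesl|exact: star_mult_linl|exact: star_mult_linr].
  - by apply: continuous_op_comp; [exact: star_mult_preservesr|exact: star_mult_contr|exact: star_mult_contl].
  - by apply: continuous_op_comp; [exact: star_mult_preservesl|exact: star_mult_contl|exact: star_mult_contr].
  - by move=> t tA /=; do 2![apply: star_mult_inA => //].
  - by move=> t tA /=; do 2![apply: star_mult_inA => //].
  - by move=> i; exact: h1.
move=> aA bA; have abA := star_mult_inA aA bA.
apply: (op_eq (T := star_mult (star_mult a b)) (S := star_mult a \o star_mult b)) => //.
- exact: star_mult_linr.
- by apply: linear_op_comp; [exact: star_mult_preservesr|exact: star_mult_linr|exact: star_mult_linr].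
- exact: star_mult_contr.
- by apply: continuous_op_comp; [exact: star_mult_preservesr|exact: star_mult_contr|exact: star_mult_contr].
- exact: star_mult_preservesr.
- by move=> t tA /=; do 2![apply: star_mult_inA => //].
- by move=> i; exact: h2.
Qed.

Lemma star_mult_usum a b : inA a -> inA b ->
  usum_to (fun p : I * I => coef a p.1 * coef b p.2)
    (fun p => star_r hb p.1.1 p.1.2 p.2.1 p.2.2) (star_mult a b).
Proof.
move=> aA bA K cK e e0; have [r r1 hr] := cpt_entries cK.1; have [E E1 hE] := star_bound n hH.
have ra := coef_rapid aA; have rb := coef_rapid bA.
have D0 : 0 <= E * r ^+ 2 by rewrite mulr_ge0 ?sqr_ge0 // (le_trans _ E1).
pose v (p : I * I) := cmod (coef a p.1 * coef b p.2) * (E * r ^+ 2) ^+ (isz p.1 + isz p.2).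
have v0 p : 0 <= v p by rewrite mulr_ge0 ?cmod_ge0 // exprn_ge0.
have e2 : 0 < e / 2 by rewrite divr_gt0.
have [s0 us0 hs0] := psummable_tail v0 (rapid_pair ra rb D0) e2.
exists s0 => s us sub; apply: le_lt_trans (_ : e / 2 < e); last by rewrite ltr_pdivrMr // ltr_pMr // ltr1n.
have sA (p : I * I) : inA (star_r hb p.1.1 p.1.2 p.2.1 p.2.2 : fct).
  by rewrite -star_mult_frPQ; apply: star_mult_inA; exact: frPQ_inA.
apply: snorm_le => //; first exact: ltW.
move=> x Kx; have Zx := cK.2 x Kx; rewrite hat_sub_sum //; last exact: star_mult_inA.
rewrite hat_star_mult //.
under eq_bigr => p _.
  rewrite -star_mult_frPQ hat_star_mult ?coef_frPQ ?mulhat_delta //; try exact: frPQ_inA.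
  over.
apply: csum_tail (mulhatP hH x ra rb) us _ => t ut dis.
apply: le_trans (ltW (hs0 t ut _)); last by move=> p /dis; apply: contra; exact: sub.
apply: ler_sum => p _; rewrite cmodM ler_wpM2l ?cmod_ge0 //.
by apply: starhat_le => //; exact: hr.
Qed.

End Fixed.

(** The majorant [(E r^2)^(|i| + |j|)] depends on [L] and [K] only, not on the point of [L]. *)
Lemma star_series_bound (L : set C^o) (K : set (Cpair R n.+1)) (alpha beta : I -> C) :
  compact L -> L `<=` (fun h => inH h) -> cpt K -> rapid alpha -> rapid beta ->
  exists bnd : I * I -> R,
    (forall p h, L h -> snorm K (star_r h p.1.1 p.1.2 p.2.1 p.2.2) <= bnd p) /\
    psummable (fun p : I * I => cmod (alpha p.1 * beta p.2) * bnd p).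
Proof.
move=> cL LH cK ra rb; have [r r1 hr] := cpt_entries cK.1; have [E E1 hE] := compact_star_bound n cL LH.
have D0 : 0 <= E * r ^+ 2 by rewrite mulr_ge0 ?sqr_ge0 // (le_trans _ E1).
exists (fun p => (E * r ^+ 2) ^+ (isz p.1 + isz p.2)); split; last exact: rapid_pair.
move=> p h Lh; apply: snorm_le => //; first exact: exprn_ge0.
move=> x Kx; rewrite -(star_mult_frPQ h) (hat_star_mult (LH h Lh)).
- by rewrite !coef_frPQ mulhat_delta; apply: starhat_le => //; [exact: hr|exact: hE].
- exact: frPQ_inA.
- exact: frPQ_inA.
- exact: cK.2.
Qed.

End Product.

(** * Complex conjugation as an involution *)

Section Conjugation.
Variables (R : realType) (n : nat).
Local Notation C := (R[i]).
Local Notation M := (midx n.+1).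
Local Notation I := (midx n * midx n)%type.
Local Notation fct := ('rV[C]_n -> C).
Implicit Types (a b : fct) (i j : I).

(** The index of the conjugate: [f_{r,P,Q}] is sent to [f_{r,Q,P}]. *)
Definition iswap i : I := (i.2, i.1).

Lemma iswapK : involutive iswap. Proof. by case. Qed.

Lemma isz_iswap i : isz (iswap i) = isz i. Proof. exact: addnC. Qed.

Lemma emb_iswap i : emb (iswap i) = ((emb i).2, (emb i).1).
Proof. by rewrite /emb /= maxnC. Qed.

Lemma csum_conj (T : eqType) (u : T -> C) l : csum u l -> csum (fun x => conjc (u x)) (conjc l).
Proof.
move=> h e e0; have [s0 h0] := h e e0; exists s0 => s us sub.
by rewrite -(raddf_sum conjc) -(raddfB conjc) cmodJ; exact: h0.
Qed.

Lemma conj_mon (P Q : M) (w : 'rV[C]_n) : msize P = msize Q ->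
  conjc (mon P Q (DeltaD w)) = mon Q P (DeltaD w).
Proof.
move=> PQ; rewrite !mon_DeltaD // /fPQ /wpow PQ -!conjCE.
rewrite fmorph_div rmorphM rmorphXn rmorphB rmorph1 !rmorph_prod; congr (_ / _).
  rewrite mulrC; congr (_ * _); apply: eq_bigr => j _; rewrite rmorphXn //.
  by congr (_ ^+ _); exact: conjCK.
congr ((1 - _) ^+ _); rewrite /wnorm2 rmorph_sum; apply: eq_bigr => j _.
by rewrite rmorphM mulrC; congr (_ * _); exact: conjCK.
Qed.

Lemma conj_rmon i (w : 'rV[C]_n) : conjc (rmon i (DeltaD w)) = rmon (iswap i) (DeltaD w).
Proof.
rewrite -[rmon i _]/(mon (emb i).1 (emb i).2 _) conj_mon ?balanced_emb //.
by rewrite -[RHS]/(mon (emb (iswap i)).1 (emb (iswap i)).2 _) emb_iswap.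
Qed.

Lemma fconj_series a : inA a -> series_on_ball (fconj a) (fun i => conjc (coef a (iswap i))).
Proof.
move=> aA; have [ra ha] := coefP aA; split=> [r r0|w wb].
  by have [B hB] := ra r r0; exists B => i; rewrite cmodJ -isz_iswap.
apply/esym/csumvE; have := csum_conj (seriesP (DeltaD w) ra); rewrite -ha //.
move=> /(csum_reindex iswapK iswapK); apply: eq_csum => i.
by rewrite rmorphM /= conj_rmon iswapK.
Qed.

Lemma fconj_inA a : inA a -> inA (fconj a).
Proof. by move/fconj_series/series_inA. Qed.

Lemma coef_fconj a : inA a -> coef (fconj a) = fun i => conjc (coef a (iswap i)).
Proof. by move/fconj_series/coefE. Qed.

(** Obtained from the coefficients, which are only permuted and conjugated, rather than from the
    reflection [(p, q) |-> (conj q, conj p)] of [Zhat]. *)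
Lemma fconj_snorm (K : set (Cpair R n.+1)) : cpt K -> exists K', cpt K' /\ exists B : R,
  forall a, inA a -> snorm K (fconj a) <= B * snorm K' a.
Proof.
move=> cK; have [r r1 hr] := cpt_entries cK.1.
have D0 : 0 <= 2 * r ^+ 2 by rewrite mulr_ge0 ?sqr_ge0.
exists (chart_cpt (2 * r ^+ 2)); split; first exact: chart_cpt_cpt.
exists (2 ^+ (n + n)) => a aA; apply: snorm_le => //; first by rewrite mulr_ge0 ?exprn_ge0 ?snorm_ge0.
move=> x Kx; have fA := fconj_inA aA; rewrite hat_series //; last exact: cK.2.
apply: csum_bound (seriesP x (coef_rapid fA)) _ => s us.
apply: le_trans (_ : \sum_(i <- s) snorm (chart_cpt (2 * r ^+ 2)) a * 2^-1 ^+ isz i <= _).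
  apply: ler_sum => i _; rewrite cmodM coef_fconj // cmodJ.
  apply: le_trans (_ : cmod (coef a (iswap i)) * (r ^+ 2) ^+ isz i <= _).
    by rewrite ler_wpM2l ?cmod_ge0 //; apply: cmod_rmon_le => //; exact: hr.
  have := coef_le (iswap i) aA D0; rewrite isz_iswap [(2 * _) ^+ _]exprMn => h.
  by rewrite exprVn ler_pdivlMr ?exprn_gt0 // -mulrA [_ * 2 ^+ _]mulrC.
rewrite -mulr_sumr mulrC ler_wpM2r ?snorm_ge0 //; exact: sum_half_pow_isz.
Qed.

(** For real [hb] the structure constants are real, so conjugation only exchanges the two indices of
    each monomial; [lin_wick_flip] reads the result as the product in the opposite order. *)
Lemma conj_starhat hb i j (w : 'rV[C]_n) : conjc hb = hb ->
  conjc (starhat hb i j (DeltaD w)) = starhat hb (iswap j) (iswap i) (DeltaD w).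
Proof.
move=> hr; rewrite /starhat /basis_star !emb_iswap /= -[RHS](lin_wick_flip _ _ _ _ _ (fun U V => mon V U (DeltaD w))).
have /allP b := balanced_basis_star hb i j.
rewrite /lin raddf_sum; apply: eq_big_seq => x xX.
transitivity (conjc x.1 * conjc (mon x.2.1 x.2.2 (DeltaD w))); first exact: rmorphM.
rewrite conj_mon; last exact/eqP/b.
congr (_ * _); case/mapP: xX => t _ -> /=.
have ph m : conjc (pochhammer (2 * hb)^-1 m) = pochhammer (2 * hb)^-1 m.
  rewrite /pochhammer rmorph_prod; apply: eq_bigr => k _.
  by rewrite rmorphD fmorphV rmorphM !rmorph_nat /= hr.
by rewrite /wick_coef !rmorphM fmorphV rmorphM !rmorphXn rmorphN rmorph1 !rmorph_nat /= !ph.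
Qed.

Lemma fconj_star_mult hb a b : inH hb -> conjc hb = hb -> inA a -> inA b ->
  eqD (fconj (star_mult hb a b)) (star_mult hb (fconj b) (fconj a)).
Proof.
move=> hH hr aA bA w wb.
have := csum_conj (mulhatP hH (DeltaD w) (coef_rapid aA) (coef_rapid bA)).
pose f (p : I * I) : I * I := (iswap p.2, iswap p.1).
have fK : involutive f by move=> [[? ?] [? ?]].
move=> /(csum_reindex fK fK) h; apply/esym/csumvE; apply: eq_csum h => p /=.
rewrite !rmorphM /= conj_starhat // !iswapK !coef_fconj //; congr (_ * _); exact: mulrC.
Qed.

End Conjugation.


Theorem theorem3p17 (R : realType) (n : nat) (hn : (0 < n)%N) :
  exists mult : R[i] -> ('rV[R[i]]_n -> R[i]) -> ('rV[R[i]]_n -> R[i]) ->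
                ('rV[R[i]]_n -> R[i]),
  forall hb : R[i], inH hb ->
  (
    (* mult hb is an associative bilinear product on A(D_n) *)
    (forall a b, inA a -> inA b -> inA (mult hb a b)) /\
    (forall a a' b b', inA a -> inA a' -> inA b -> inA b' ->
        eqD a a' -> eqD b b' -> eqD (mult hb a b) (mult hb a' b')) /\
    (forall a a' b (c : R[i]), inA a -> inA a' -> inA b ->
        eqD (mult hb (fadd a (fscale c a')) b)
            (fadd (mult hb a b) (fscale c (mult hb a' b)))
     /\ eqD (mult hb b (fadd a (fscale c a')))
            (fadd (mult hb b a) (fscale c (mult hb b a')))) /\
    (forall a b c, inA a -> inA b -> inA c ->
        eqD (mult hb (mult hb a b) c) (mult hb a (mult hb b c))) /\
    (* it extends the star product of P(D_n) *)
    (forall P Q R' S : midx n.+1, msize P = msize Q -> msize R' = msize S ->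
        eqD (mult hb (fPQ P Q) (fPQ R' S)) (starPQ hb P Q R' S)) /\
    (* it is (jointly) continuous for the Frechet topology *)
    (forall K, cpt K -> exists K', cpt K' /\ exists M : R,
        forall a b, inA a -> inA b ->
          snorm K (mult hb a b) <= M * snorm K' a * snorm K' b) /\
    (* the series formula, with absolute and locally uniform convergence in hb *)
    (forall a b (alpha beta : midx n * midx n -> R[i]),
        inA a -> inA b -> expansion alpha a -> expansion beta b ->
        (forall (L : set R[i]^o), compact L -> L `<=` (fun h => inH h) ->
          forall K, cpt K ->
          exists bnd : (midx n * midx n) * (midx n * midx n) -> R,
            (forall idx h, L h ->
               snorm K (star_r h idx.1.1 idx.1.2 idx.2.1 idx.2.2) <= bnd idx)
            /\ psummable (fun idx : (midx n * midx n) * (midx n * midx n) =>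
                           cmod (alpha idx.1 * beta idx.2) * bnd idx))
        /\ usum_to (fun idx : (midx n * midx n) * (midx n * midx n) =>
                      alpha idx.1 * beta idx.2)
                   (fun idx => star_r hb idx.1.1 idx.1.2 idx.2.1 idx.2.2)
                   (mult hb a b))
  /\
    (* for real hb: pointwise complex conjugation is a continuous involution *)
    (hb^* = hb ->
       (forall a : 'rV[R[i]]_n -> R[i], inA a -> inA (fconj a))
       /\ (forall K, cpt K -> exists K', cpt K' /\ exists M : R,
             forall a : 'rV[R[i]]_n -> R[i], inA a -> snorm K (fconj a) <= M * snorm K' a)
       /\ (forall a b, inA a -> inA b ->
             eqD (fconj (mult hb a b)) (mult hb (fconj b) (fconj a))))
  ).
Proof.
exists (@star_mult R n) => hb hH.
split; first by move=> a b; exact: star_mult_inA.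
split; first by move=> a a' b b' _ _ _ _ aa bb w wb; rewrite (star_mult_eqD hb aa bb).
split.
  move=> a a' b c aA aA' bA; split=> w wb.
    by rewrite (star_mult_linl hH bA _ aA aA').
  by rewrite (star_mult_linr hH bA _ aA aA').
split; first by move=> a b c; exact: star_mult_assoc.
split; first by move=> P Q P' S; exact: star_mult_fPQ.
split; first by move=> K; exact: star_mult_snorm.
split.
  move=> a b alpha beta aA bA ea eb; rewrite (coef_expansion aA ea) (coef_expansion bA eb).
  split; last exact: star_mult_usum.
  by move=> L cL LH K cK; apply: star_series_bound => //; exact: coef_rapid.
move=> hr; split; first by move=> a; exact: fconj_inA.
split=> [K cK|a b aA bA]; first exact: fconj_snorm.
exact: fconj_star_mult.
Qed.
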